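(* Let $m\ge1$, $\vec{\bm{c}}_0,\vec{\bm{c}}_1\in\mathcal{C}^m$, let $f$ be a spherical polynomial of degree $d$ on $\mathbb{R}^{2m}$, and let $\vec{\bm{a}},\vec{\bm{b}}\in\mathbb{R}^{2m}$. For $\tau=u+iv\in\mathbb{H}$ the series $$\theta^{\vec{\bm{c}}_0,\vec{\bm{c}}_1}_{\vec{\bm{a}},\vec{\bm{b}}}[f](\tau)=v^{-d/2}\sum_{\vec{\bm{x}}\in\vec{\bm{a}}+\mathbb{Z}^{2m}}p^{\vec{\bm{c}}_0,\vec{\bm{c}}_1}[f](\vec{\bm{x}}\sqrt v)\,q^{Q_m(\vec{\bm{x}})}e^{2\pi iB_m(\vec{\bm{x}},\vec{\bm{b}})}$$ converges absolutely and satisfies $$\theta^{\vec{\bm{c}}_0,\vec{\bm{c}}_1}_{\vec{\bm{a}},\vec{\bm{b}}}[f]\Big(-\frac1\tau\Big)=(-\tau)^{m+d}e^{2\pi iB_m(\vec{\bm{a}},\vec{\bm{b}})}\theta^{\vec{\bm{c}}_0,\vec{\bm{c}}_1}_{-\vec{\bm{b}},\vec{\bm{a}}}[f](\tau).$$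
   Context: $q^{c}=e^{2\pi ic\tau}$. Write $\vec{\bm{x}}=(\bm{x}_1,\dots,\bm{x}_m)\in\mathbb{R}^{2m}$, $\bm{x}_j=(x_j,y_j)$. $Q_1(x,y)=\frac12(x^2-y^2)$, $B_1((x,y),(x',y'))=xx'-yy'$, $Q_m(\vec{\bm{x}})=\sum_jQ_1(\bm{x}_j)$, $B_m(\vec{\bm{x}},\vec{\bm{y}})=\sum_jB_1(\bm{x}_j,\bm{y}_j)$. $\Delta_m=\sum_{j}(\partial_{x_j}^2-\partial_{y_j}^2)$; a polynomial is spherical of degree $d$ if homogeneous of degree $d$ and annihilated by $\Delta_m$. $\mathcal{C}=\{(x,y)\in\mathbb{R}^2\mid Q_1(x,y)<0,\ y>0\}$, $E(z)=2\int_0^ze^{-\pi u^2}du$, and for $\bm{c}=(c_1,c_2)\in\mathcal{C}$, $\partial_{\bm{c}}(\bm{x})=\frac{1}{\sqrt{-Q_1(\bm{c})}}(c_1\partial_x+c_2\partial_y)$ in the variable $\bm{x}=(x,y)$. For $\vec{\bm{c}}_0=(\bm{c}^{(0)}_j)_j,\vec{\bm{c}}_1=(\bm{c}^{(1)}_j)_j\in\mathcal{C}^m$ and $f$ of degree $d$, $$p^{\vec{\bm{c}}_0,\vec{\bm{c}}_1}[f](\vec{\bm{x}})=\sum_{\vec\sigma\in\{0,1\}^m}(-1)^{|\vec\sigma|}\sum_{k=0}^d\frac{(-1)^k}{(4\pi)^k}\sum_{\substack{\vec k\in(\mathbb{Z}_{\ge0})^m\\|\vec k|=k}}\prod_{j=1}^m\frac{1}{k_j!}E^{(k_j)}\Big(\frac{B_1(\bm{c}_j^{(\sigma_j)},\bm{x}_j)}{\sqrt{-Q_1(\bm{c}_j^{(\sigma_j)})}}\Big)\cdot\Big(\prod_{j=1}^m\partial_{\bm{c}_j^{(\sigma_j)}}(\bm{x}_j)^{k_j}\Big)f(\vec{\bm{x}}),$$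 with $|\vec v|=v_1+\cdots+v_m$. *)

(* Defs.v *)
(* `mpoly` is imported without its notations, which conflict with those of
   mathcomp-analysis: `mpoly n R` is {mpoly R[n]}, `ishomog1 d mdeg` is d.-homog,
   `mderiv i f` is f^`M(i) and `meval v f` is f.@[v]. *)
From HB Require Import structures.
From mathcomp Require Import all_boot all_order all_algebra.
From mathcomp Require Import all_classical all_reals all_analysis.
From mathcomp Require Import complex.
From mathcomp Require summability.
From mathcomp Require Import -(notations) mpoly.

Set Implicit Arguments.
Unset Strict Implicit.
Unset Printing Implicit Defensive.
Import Order.TTheory GRing.Theory Num.Theory.
Import numFieldNormedType.Exports.

Local Open Scope classical_set_scope.
Local Open Scope complex_scope.
Local Open Scope ring_scope.

(* A point of R^(2m) is an m x 2 matrix whose j-th row is (x_j, y_j). *)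

Definition Q1 (R : realType) (x : 'rV[R]_2) : R :=
  (x 0 0 ^+ 2 - x 0 1 ^+ 2) / 2.

Definition B1 (R : realType) (x y : 'rV[R]_2) : R :=
  x 0 0 * y 0 0 - x 0 1 * y 0 1.

Definition Qm (R : realType) (m : nat) (x : 'M[R]_(m, 2)) : R :=
  \sum_(j < m) Q1 (row j x).

Definition Bm (R : realType) (m : nat) (x y : 'M[R]_(m, 2)) : R :=
  \sum_(j < m) B1 (row j x) (row j y).

Definition coneC (R : realType) : set 'rV[R]_2 :=
  [set c | Q1 c < 0 /\ 0 < c 0 1].

(* The 2m polynomial variables are numbered by `mxvec_index j k`, with k = 0
   for x_j and k = 1 for y_j, so that `mxvec` lists the coordinates of a point
   in the same order. *)

Definition laplacian (R : realType) (m : nat) (f : mpoly (m * 2) R[i]) :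
    mpoly (m * 2) R[i] :=
  \sum_(j < m) (mderiv (mxvec_index j 0) (mderiv (mxvec_index j 0) f)
              - mderiv (mxvec_index j 1) (mderiv (mxvec_index j 1) f)).

Definition spherical (R : realType) (m d : nat) (f : mpoly (m * 2) R[i]) : Prop :=
  f \is ishomog1 d mdeg /\ laplacian f = 0.

Definition evalat (R : realType) (m : nat) (f : mpoly (m * 2) R[i])
    (x : 'M[R]_(m, 2)) : R[i] :=
  meval (fun i => (mxvec x 0 i)%:C) f.

(* One of the two integrals is over an empty or degenerate interval, so that
   this is 2 times the oriented integral from 0 to z. *)
Definition Efun (R : realType) (z : R) : R :=
  2 * (\int[@lebesgue_measure R]_(u in `[0, z]) expR (- (pi * u ^+ 2))
     - \int[@lebesgue_measure R]_(u in `[z, 0]) expR (- (pi * u ^+ 2))).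

Definition dirderiv (R : realType) (m : nat) (c : 'rV[R]_2) (j : 'I_m)
    (f : mpoly (m * 2) R[i]) : mpoly (m * 2) R[i] :=
  ((Num.sqrt (- Q1 c))^-1)%:C *:
    ((c 0 0)%:C *: mderiv (mxvec_index j 0) f
   + (c 0 1)%:C *: mderiv (mxvec_index j 1) f).

Definition dirderivs (R : realType) (m : nat) (c : 'M[R]_(m, 2))
    (k : 'I_m -> nat) (f : mpoly (m * 2) R[i]) : mpoly (m * 2) R[i] :=
  foldr (fun j g => iter (k j) (dirderiv (row j c) j) g) f (enum 'I_m).

Definition choose_rows (R : realType) (m : nat) (c0 c1 : 'M[R]_(m, 2))
    (sigma : 'I_m -> bool) : 'M[R]_(m, 2) :=
  \matrix_(j < m, l < 2) (if sigma j then c1 j l else c0 j l).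

(* The components of a vector of naturals with |kk| = k are at most k, hence
   the index type of the innermost sum. *)
Definition pfun (R : realType) (m d : nat) (c0 c1 : 'M[R]_(m, 2))
    (f : mpoly (m * 2) R[i]) (x : 'M[R]_(m, 2)) : R[i] :=
  \sum_(sigma : {ffun 'I_m -> bool})
    let c := choose_rows c0 c1 sigma in
    (-1) ^+ (\sum_(j < m) sigma j)%N *
    \sum_(k < d.+1)
      (-1) ^+ k / ((4 * pi) ^+ k)%:C *
      \sum_(kk : {ffun 'I_m -> 'I_k.+1} | (\sum_(j < m) kk j)%N == k)
        (\prod_(j < m)
           (((kk j)`!%:R)^-1 *
            ((@Efun R)^`(kk j))%classic
              (B1 (row j c) (row j x) / Num.sqrt (- Q1 (row j c)))))%:C *
        evalat (dirderivs c (fun j => kk j) f) x.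

Definition expc (R : realType) (z : R[i]) : R[i] :=
  (expR (complex.Re z) * cos (complex.Im z)) +i*
  (expR (complex.Re z) * sin (complex.Im z)).

Definition eipi2 (R : realType) (z : R[i]) : R[i] :=
  expc ((2 * pi)%:C * 'i%C * z).

Definition theta_term (R : realType) (m d : nat) (c0 c1 a b : 'M[R]_(m, 2))
    (f : mpoly (m * 2) R[i]) (tau : R[i]) (n : 'M[int]_(m, 2)) : R[i] :=
  let x := a + map_mx intr n in
  pfun d c0 c1 f (Num.sqrt (complex.Im tau) *: x) *
  eipi2 ((Qm x)%:C * tau) * eipi2 (Bm x b)%:C.

Definition abs_convergent (R : realType) (T : choiceType) (F : T -> R[i]) : Prop :=
  (\esum_(t in [set: T]) (complex.Re `|F t|)%:E < +oo)%E.

(* `summability.sum` is the limit of the finite partial sums along the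
   directed set of finite subsets of the index type. *)
Definition csum (R : realType) (T : choiceType) (F : T -> R[i]) : R[i] :=
  summability.sum (F : T -> R[i]^o).

Definition theta (R : realType) (m d : nat) (c0 c1 a b : 'M[R]_(m, 2))
    (f : mpoly (m * 2) R[i]) (tau : R[i]) : R[i] :=
  (complex.Im tau `^ (- (d%:R / 2)))%:C *
  csum (theta_term d c0 c1 a b f tau).

(* Main.v *)
Require Import Defs.
From HB Require Import structures.
From mathcomp Require Import all_boot all_order all_algebra.
From mathcomp Require Import all_classical all_reals all_analysis.
From mathcomp Require Import complex.
From mathcomp Require Import -(notations) mpoly.
From mathcomp Require summability.
From mathcomp Require Import zify ring lra.

Set Implicit Arguments.
Unset Strict Implicit.
Unset Printing Implicit Defensive.
Import Order.TTheory GRing.Theory Num.Theory.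
Import numFieldNormedType.Exports.

Local Open Scope classical_set_scope.
Local Open Scope complex_scope.
Local Open Scope ring_scope.
(* On a monomial f every factor of p[f](x sqrt v) q^(Q_m(x)) involves one row
   x_j only, so the series is a combination of products of two-dimensional
   series, and it suffices to find, for each row, profiles g, g' on R^2 with
     Th g a b = e(B(a,b)) Th g' (-b) a,   Th g a b = sum_{x in a+Z^2} g(x) e(B(x,b)),
   a relation called FT g g'.

   - Write c/sqrt(-Q_1(c)) = sqrt 2 (sinh t, cosh t) and z_t(x) = B(c,x)/sqrt(-Q_1(c)).
     The Gaussian q^Q exp(-pi v z_t^2) satisfies FT by two applications of the
     one-dimensional Jacobi identity; that identity comes from Fourier inversion
     for periodized Gaussians, and the integral of exp(-pi al x^2) is identified
     through an ODE in al.
   - FT turns multiplication by a linear form into differentiation.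
     Differentiating the Gaussian along its fixed direction gives FT for
     d/dt E(z_t sqrt v) q^Q. The defect of FT for
     Rho s t = (E(z_s sqrt v) - E(z_t sqrt v)) q^Q thus has zero derivative in s
     and vanishes at s = t.
   - The operators (1/(4 pi v)) (2 pi i conj(tau) X_e - d_e) preserve FT up to a
     factor -tau. Applied to Rho they produce p[U f](x sqrt v) q^Q with
     U = exp(-Delta/(8 pi)): on the polynomial side they act as
     X_e - (1/4 pi) d_e = U X_e U^-1. A spherical f is fixed by U. *)

(** * Unordered complex sums *)

(** The terms q^Q alone are not summable, since Q is indefinite; a difference of two error functions
    restores decay because it is an integral, over a segment of hyperbolic parameters, of Gaussians
    attached to positive definite forms. Hence all bounds for [Rho] are taken uniformly along that
    segment. [FT] relates sums for all characteristics instead of going through a Fourier integral: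
    moving b multiplies the profile by a linear form, moving a differentiates it, and both rules
    follow from termwise Taylor estimates. No branch of a complex square root is ever chosen in the
    final formula: the two Jacobi steps involve al and |tau|^2/al, whose constants multiply to
    1/|tau|. The conjugate of tau in the raising operator is forced: on F q^Q the derivative of q^Q
    contributes - 2 pi i tau X, and 2 pi i (conj(tau) - tau) = 4 pi v, so a real operator on F
    remains. The weight is a count of factors -tau: one per row from [Rho] and one per letter of a
    word of length d, hence m + d. *)

Section Modulus.
Variable R : realType.
Local Notation C := R[i].
Implicit Types z w : C.

Definition cmod (z : C) : R := ComplexField.Normc.normc z.

Lemma cmodE z : (cmod z)%:C = `|z|. Proof. by []. Qed.

Lemma cmod_ge0 z : 0 <= cmod z.
Proof. by case: z => a b; exact: sqrtr_ge0. Qed.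

Lemma cmod0 : cmod 0 = 0. Proof. exact: ComplexField.Normc.normc0. Qed.

Lemma cmod0_eq z : cmod z = 0 -> z = 0. Proof. exact: ComplexField.Normc.eq0_normc. Qed.

Lemma cmodM z w : cmod (z * w) = cmod z * cmod w.
Proof. exact: ComplexField.Normc.normcM. Qed.

Lemma cmodD z w : cmod (z + w) <= cmod z + cmod w.
Proof. exact: le_normcD. Qed.

Lemma cmodN z : cmod (- z) = cmod z. Proof. exact: normcN. Qed.

Lemma cmodB z w : cmod (z - w) <= cmod z + cmod w.
Proof. by rewrite -(cmodN w) cmodD. Qed.

Lemma cmodBC z w : cmod (z - w) = cmod (w - z).
Proof. by rewrite -cmodN opprB. Qed.

Lemma cmodBD w z v : cmod (z - v) <= cmod (z - w) + cmod (w - v).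
Proof. by have := cmodD (z - w) (w - v); rewrite addrA subrK. Qed.

Lemma cmodR (r : R) : cmod r%:C = `|r|.
Proof. by rewrite /cmod /= expr0n /= addr0 sqrtr_sqr. Qed.

Lemma cmodi : cmod ('i%C : C) = 1.
Proof. by rewrite /cmod /= expr0n /= add0r expr1n sqrtr1. Qed.

Lemma cmod_sqr z : cmod z ^+ 2 = complex.Re z ^+ 2 + complex.Im z ^+ 2.
Proof. by case: z => a b; rewrite /cmod /= sqr_sqrtr // addr_ge0 ?sqr_ge0. Qed.

Lemma cmod_Re z : `|complex.Re z| <= cmod z.
Proof.
rewrite -(ler_pXn2r (ltn0Sn 1)) ?nnegrE ?cmod_ge0 // cmod_sqr real_normK ?num_real //.
by rewrite lerDl sqr_ge0.
Qed.

Lemma cmod_Im z : `|complex.Im z| <= cmod z.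
Proof.
rewrite -(ler_pXn2r (ltn0Sn 1)) ?nnegrE ?cmod_ge0 // cmod_sqr real_normK ?num_real //.
by rewrite lerDr sqr_ge0.
Qed.

Lemma cplxE z : z = (complex.Re z)%:C + 'i%C * (complex.Im z)%:C.
Proof. exact: complexE. Qed.

Lemma cmod_ReIm z : cmod z <= `|complex.Re z| + `|complex.Im z|.
Proof.
by rewrite {1}(cplxE z) (le_trans (cmodD _ _)) // cmodM cmodi mul1r !cmodR.
Qed.

Lemma cmod_sum (I : Type) (s : seq I) (P : pred I) (F : I -> C) :
  cmod (\sum_(i <- s | P i) F i) <= \sum_(i <- s | P i) cmod (F i).
Proof.
elim/big_rec2: _ => [|i x y _ h]; first by rewrite cmod0.
by rewrite (le_trans (cmodD _ _)) // lerD2l.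
Qed.

Lemma cmod_gt0 z : z != 0 -> 0 < cmod z.
Proof.
move=> z0; rewrite lt_neqAle cmod_ge0 andbT eq_sym.
by apply: contra z0 => /eqP/cmod0_eq ->.
Qed.

End Modulus.

Section Sums.
Variable R : realType.
Local Notation C := R[i].

Section Def.
Variable T : choiceType.
Implicit Types (F G : T -> C) (s A B : seq T).

(** Convergence along the directed set of finite subsets, encoded as duplicate-free sequences, with
    a real tolerance; [hassum_csum] identifies it with the limit behind [csum]. *)
Definition hassum F (S : C) := forall e : R, 0 < e ->
  exists A : seq T, forall B, uniq B -> {subset A <= B} ->
    cmod (S - \sum_(t <- B) F t) <= e.

Definition bounded_sums F (M : R) :=
  forall s, uniq s -> \sum_(t <- s) cmod (F t) <= M.

Definition asum F := exists M, bounded_sums F M.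

Lemma uniq_undup_cat A B : {subset A <= undup (A ++ B)} /\ {subset B <= undup (A ++ B)}.
Proof. by split=> t ht; rewrite mem_undup mem_cat ht ?orbT. Qed.

Lemma le_eps_eq0 (x : R) : 0 <= x -> (forall e : R, 0 < e -> x <= e) -> x = 0.
Proof.
move=> x0 h; apply/eqP; rewrite eq_le x0 andbT leNgt; apply/negP => xp.
by have := h (x / 2) ltac:(lra); lra.
Qed.

Lemma hassumD F G S S' : hassum F S -> hassum G S' ->
  hassum (fun t => F t + G t) (S + S').
Proof.
move=> h h' e e0; have e2 : 0 < e / 2 by lra.
have [A hA] := h _ e2; have [A' hA'] := h' _ e2.
exists (A ++ A') => B uB sB; rewrite big_split /= opprD addrACA.
rewrite (le_trans (cmodD _ _)) // (splitr e) lerD //.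
  by apply: hA => // t ht; apply: sB; rewrite mem_cat ht.
by apply: hA' => // t ht; apply: sB; rewrite mem_cat ht orbT.
Qed.

Lemma hassumZ F S (c : C) : hassum F S -> hassum (fun t => c * F t) (c * S).
Proof.
move=> h e e0; have c0 : 0 < cmod c + 1 by have := cmod_ge0 c; lra.
have [A hA] := h (e / (cmod c + 1)) (divr_gt0 e0 c0).
exists A => B uB sB; rewrite -big_distrr /= -mulrBr cmodM.
have := hA B uB sB; rewrite ler_pdivlMr // => h1.
rewrite (le_trans _ h1) // mulrC ler_wpM2l ?cmod_ge0 //; lra.
Qed.

Lemma hassum_le F S M : bounded_sums F M -> hassum F S -> cmod S <= M.
Proof.
move=> hb h; rewrite leNgt; apply/negP => hlt.
have [|A hA] := h ((cmod S - M) / 2); first by lra.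
have := hA (undup A) (undup_uniq _) ltac:(by move=> t; rewrite mem_undup).
set s := \sum_(_ <- _) _ => h1.
have h2 : cmod s <= M by rewrite (le_trans (cmod_sum _ _ _)) // hb ?undup_uniq.
by have := cmodD (S - s) s; rewrite subrK; lra.
Qed.

Lemma sum_subset_split (V : nmodType) (f : T -> V) A B :
  uniq A -> uniq B -> {subset A <= B} ->
  \sum_(t <- B) f t = \sum_(t <- A) f t + \sum_(t <- [seq t <- B | t \notin A]) f t.
Proof.
move=> uA uB sB; rewrite -big_cat; apply: perm_big; apply: uniq_perm => //.
  rewrite cat_uniq uA filter_uniq // andbT; apply/hasPn => t.
  by rewrite mem_filter => /andP[].
by move=> t; rewrite mem_cat mem_filter; case: (boolP (t \in A)) => //= /sB ->.
Qed.

Lemma sum_subset_le (f : T -> R) A B : (forall t, 0 <= f t) ->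
  uniq A -> uniq B -> {subset A <= B} ->
  \sum_(t <- A) f t <= \sum_(t <- B) f t.
Proof. by move=> f0 uA uB sB; rewrite (sum_subset_split f uA uB sB) lerDl sumr_ge0. Qed.

Lemma ge0_hassum (f : T -> R) M : (forall t, 0 <= f t) ->
  (forall s, uniq s -> \sum_(t <- s) f t <= M) ->
  exists S : R, hassum (fun t => (f t)%:C) S%:C.
Proof.
move=> f0 hM; pose E := [set x | exists2 s, uniq s & x = \sum_(t <- s) f t].
have hE : has_sup E.
  split; first by exists 0; exists [::]; rewrite ?big_nil.
  by exists M => _ [s us ->]; exact: hM.
exists (sup E) => e e0; have [_ [A uA ->] hA] := sup_adherent e0 hE.
exists A => B uB sB; rewrite -rmorph_sum -rmorphB cmodR.
have h1 := sum_subset_le f0 uA uB sB.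
have h2 : \sum_(t <- B) f t <= sup E by apply: ub_le_sup; [case: hE|exists B].
by rewrite ger0_norm ?subr_ge0 //; lra.
Qed.

Lemma asum_hassum F : asum F -> exists S, hassum F S.
Proof.
case=> M hM.
have [S hS] := ge0_hassum (fun t => cmod_ge0 (F t)) hM.
(* Adding the summable modulus makes each real or imaginary part nonnegative, so that suprema of
   partial sums apply; the sum of the moduli is subtracted afterwards. *)
have real (g : C -> R) : (forall z, `|g z| <= cmod z) ->
    exists S, hassum (fun t => (g (F t))%:C) S.
  move=> hg.
  have [|t|S' hS'] := @ge0_hassum (fun t => g (F t) + cmod (F t)) (M + M).
  - by move=> t; have := hg (F t); rewrite ler_norml => /andP[]; lra.
  - move=> us; rewrite big_split /= lerD ?hM //.
    rewrite (le_trans _ (hM _ us)) //; apply: ler_sum => t' _.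
    by have := hg (F t'); rewrite ler_norml => /andP[].
  exists (S'%:C + (-1) * S%:C).
  have := hassumD hS' (hassumZ (-1) hS); congr hassum.
  by apply/funext => t /=; rewrite rmorphD /= mulN1r addrK.
have [Sr hr] := real _ (@cmod_Re R); have [Si hi] := real _ (@cmod_Im R).
exists (Sr + 'i%C * Si); have := hassumD hr (hassumZ 'i%C hi); congr hassum.
by apply/funext => t /=; rewrite -cplxE.
Qed.

Lemma hassum_csum F S : hassum F S -> csum F = S.
Proof.
move=> h; rewrite /csum /summability.sum.
have Tf := @summability.totally_filter T.
apply: (@cvg_lim R[i]^o (@norm_hausdorff _ _)).
apply/cvgrPdist_le => e e0.
(* A positive element of R[i] is real, so the complex tolerance reduces to its real part. *)
have e1 : 0 < complex.Re e /\ e = (complex.Re e)%:C.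
  by move: e0; case: e => a b; rewrite ltcE /= => /andP[/eqP -> h2].
case: e1 => e1 ->.
have [A hA] := h _ e1.
exists (finmap.seq_fset tt A) => // B /= sB.
rewrite /summability.partial_sum -(finmap.big_seq_fsetE _ _ xpredT) /=.
rewrite -[`|_|]cmodE lecR; apply: hA; first exact: finmap.fset_uniq.
move=> t tA; apply: (finmap.fsubsetP sB).
by have := finmap.seq_fsetE tt A t; rewrite tA.
Qed.

(** Domination with an explicit total M: remainders are bounded by k times one weight, and the bound
    k M keeps the dependence on the increment visible. *)
Definition wsum (W : T -> R) (M : R) := forall s, uniq s -> \sum_(t <- s) W t <= M.

Lemma wsum_dom W M F (k : R) : wsum W M -> 0 <= k ->
  (forall t, cmod (F t) <= k * W t) -> bounded_sums F (k * M).
Proof.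
move=> hW k0 h s us; rewrite (le_trans (ler_sum _ (fun t _ => h t))) //.
by rewrite -big_distrr ler_wpM2l // hW.
Qed.

Lemma wsum_asum W M F (k : R) : wsum W M -> 0 <= k ->
  (forall t, cmod (F t) <= k * W t) -> asum F.
Proof. by move=> hW k0 h; exists (k * M); apply: wsum_dom hW k0 h. Qed.

Lemma asum_csum F : asum F -> hassum F (csum F).
Proof. by move=> /asum_hassum [S hS]; rewrite (hassum_csum hS). Qed.

Lemma wsum_csum W M F (k : R) : wsum W M -> 0 <= k ->
  (forall t, cmod (F t) <= k * W t) -> cmod (csum F) <= k * M.
Proof.
move=> hW k0 h; apply: hassum_le (wsum_dom hW k0 h) _.
exact: asum_csum (wsum_asum hW k0 h).
Qed.

Lemma asumD F G : asum F -> asum G -> asum (fun t => F t + G t).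
Proof.
move=> [M hM] [N hN]; exists (M + N) => s us.
rewrite (le_trans (ler_sum _ (fun t _ => cmodD _ _))) // big_split lerD //.
  exact: hM.
exact: hN.
Qed.

Lemma asumZ F c : asum F -> asum (fun t => c * F t).
Proof.
move=> [M hM]; apply: (@wsum_asum (fun t => cmod (F t)) M _ (cmod c)) => //.
  exact: cmod_ge0.
by move=> t; rewrite cmodM.
Qed.

Lemma csumD F G : asum F -> asum G -> csum (fun t => F t + G t) = csum F + csum G.
Proof. by move=> /asum_csum h1 /asum_csum h2; apply/hassum_csum/hassumD. Qed.

Lemma csumZ F c : asum F -> csum (fun t => c * F t) = c * csum F.
Proof. by move=> /asum_csum h1; apply/hassum_csum/hassumZ. Qed.

Lemma csumB F G : asum F -> asum G -> csum (fun t => F t - G t) = csum F - csum G.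
Proof.
move=> h1 h2; rewrite -[in RHS]mulN1r -csumZ // -csumD //; last exact: asumZ.
by congr csum; apply/funext => t; rewrite mulN1r.
Qed.

Lemma asumB F G : asum F -> asum G -> asum (fun t => F t - G t).
Proof.
move=> h1 h2; have := asumD h1 (asumZ (-1) h2); congr asum.
by apply/funext => t; rewrite mulN1r.
Qed.

Lemma csum0 : csum (fun _ : T => 0 : C) = 0.
Proof.
apply: hassum_csum => e e0; exists [::] => B _ _.
by rewrite big1 // subrr cmod0 ltW.
Qed.

Lemma csum_finsum (I : Type) (s : seq I) (F : I -> T -> C) :
  (forall i, asum (F i)) ->
  asum (fun t => \sum_(i <- s) F i t) /\
  csum (fun t => \sum_(i <- s) F i t) = \sum_(i <- s) csum (F i).
Proof.
move=> h; elim: s => [|i s [IH1 IH2]].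
  rewrite big_nil; under [X in asum X]eq_fun do rewrite big_nil.
  under [X in csum X]eq_fun do rewrite big_nil.
  split; last exact: csum0.
  by exists 0 => s _; rewrite big1 // => t _; rewrite cmod0.
rewrite big_cons; under [X in asum X]eq_fun do rewrite big_cons.
under [X in csum X]eq_fun do rewrite big_cons.
by split; [exact: asumD|rewrite csumD // IH2].
Qed.

Lemma abs_convergentP F : asum F -> abs_convergent F.
Proof.
move=> [M hM]; rewrite /abs_convergent.
apply: (@le_lt_trans _ _ M%:E); last exact: ltry.
apply: ge_ereal_sup => _ [A [fA _] <-].
rewrite fsbig_finite //= sumEFin lee_fin.
exact: hM (finmap.fset_uniq _).
Qed.

End Def.

Section Reindex.
Variables (T U : choiceType) (h : T -> U).

Lemma asum_inj (F : U -> C) : injective h -> asum F -> asum (fun t => F (h t)).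
Proof.
move=> hi [M hM]; exists M => s us.
by have := hM (map h s); rewrite big_map map_inj_uniq //; apply.
Qed.

Lemma wsum_inj (W : U -> R) M : injective h -> wsum W M -> wsum (fun t => W (h t)) M.
Proof.
move=> hi hM s us.
by have := hM (map h s); rewrite big_map map_inj_uniq //; apply.
Qed.

Lemma csum_bij (F : U -> C) : bijective h -> asum F ->
  csum (fun t => F (h t)) = csum F.
Proof.
move=> [g hg gh] /asum_csum hF; apply: hassum_csum => e e0.
have [A hA] := hF e e0; exists (map g A) => B uB sB.
have := hA (map h B); rewrite big_map map_inj_uniq; last exact: can_inj hg.
apply=> // u uA; rewrite -[u]gh map_f //; apply: sB; exact: map_f.
Qed.

End Reindex.

(** * Sums over pairs *)

Section Product.
Variables (T U : choiceType).

Lemma wsum_prod (V : T -> R) (W : U -> R) M N :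
  (forall t, 0 <= V t) -> (forall u, 0 <= W u) -> wsum V M -> wsum W N ->
  wsum (fun p : T * U => V p.1 * W p.2) (M * N).
Proof.
move=> V0 W0 hV hW s us.
(* The finite set is enlarged to the rectangle spanned by its projections, where the sum factors. *)
pose A := undup (map fst s); pose B := undup (map snd s).
have N0 : 0 <= N by have := hW [::] isT; rewrite big_nil.
apply: le_trans (_ : \sum_(p <- [seq (t, u) | t <- A, u <- B]) V p.1 * W p.2 <= _).
  apply: sum_subset_le => //.
  - by move=> p; rewrite mulr_ge0.
  - by apply: allpairs_uniq; rewrite ?undup_uniq // => -[? ?] [].
  - move=> [t u] hp; apply/allpairsP; exists (t, u); rewrite /= !mem_undup.
    by split=> //; apply/mapP; exists (t, u).
rewrite big_allpairs_dep /=.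
under eq_bigr => t _ do rewrite -big_distrr /=.
rewrite -big_distrl /= ler_pM ?sumr_ge0 ?hV ?hW ?undup_uniq //.
Qed.

Lemma asum_prod (F : T -> C) (G : U -> C) : asum F -> asum G ->
  asum (fun p : T * U => F p.1 * G p.2).
Proof.
move=> [M hM] [N hN].
apply: (@wsum_asum _ (fun p : T * U => cmod (F p.1) * cmod (G p.2)) (M * N) _ 1) => //.
  by apply: (@wsum_prod (fun t => cmod (F t)) (fun t => cmod (G t))) => // t; exact: cmod_ge0.
by move=> p; rewrite mul1r cmodM.
Qed.

Variable F : T * U -> C.
Hypothesis aF : asum F.

Lemma asum_slice t : asum (fun u => F (t, u)).
Proof. by apply: (asum_inj (h := fun u => (t, u)) _ aF) => ? ? []. Qed.

(** Simultaneous finite approximations of all slice sums, each containing a prescribed set; they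
    replace an iterated sum by a finite sum over pairs. *)
Lemma slice_approx (A : seq U) (e : R) : 0 < e ->
  exists B : T -> seq U, forall t, [/\ uniq (B t), {subset A <= B t} &
    cmod (csum (fun u => F (t, u)) - \sum_(u <- B t) F (t, u)) <= e].
Proof.
move=> e0; suff /choice [B hB] : forall t, exists B, [/\ uniq B, {subset A <= B} &
    cmod (csum (fun u => F (t, u)) - \sum_(u <- B) F (t, u)) <= e] by exists B.
move=> t; have [D hD] := asum_csum (asum_slice t) e0.
have [i1 i2] := uniq_undup_cat A D.
by exists (undup (A ++ D)); split; rewrite ?undup_uniq // hD ?undup_uniq.
Qed.

Lemma uniq_pairs (s : seq T) (B : T -> seq U) : uniq s -> (forall t, uniq (B t)) ->
  uniq [seq (t, u) | t <- s, u <- B t].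
Proof. by move=> us uB; apply: allpairs_uniq_dep => // -[? ?] [? ?] _ _ /= [-> ->]. Qed.

(** Spreads an error over the terms; the successor avoids a division by zero for the empty list. *)
Lemma sum_const_div (s : seq T) (e : R) : 0 < e ->
  \sum_(t <- s) (e / (size s).+1%:R) <= e.
Proof.
move=> e0; rewrite big_const_seq count_predT iter_addr_0 -[leLHS]mulr_natr.
by rewrite mulrAC ler_pdivrMr ?ltr0n // ler_wpM2l ?ltW // ltr_nat.
Qed.

Lemma asum_inner : asum (fun t => csum (fun u => F (t, u))).
Proof.
case: (aF) => M hM; exists M => s us; apply/ler_addgt0Pr => e e0.
have [B hB] := @slice_approx [::] _ (divr_gt0 e0 (ltr0Sn R (size s))).
apply: (@le_trans _ _ (\sum_(t <- s) (\sum_(u <- B t) cmod (F (t, u)) + e / (size s).+1%:R))).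
  apply: ler_sum => t _; have [_ _ h] := hB t.
  rewrite -[X in cmod X](subrK (\sum_(u <- B t) F (t, u))) addrC.
  by rewrite (le_trans (cmodD _ _)) // lerD // cmod_sum.
rewrite big_split /= lerD ?sum_const_div //.
have := hM _ (uniq_pairs us (fun t => let: And3 h _ _ := hB t in h)).
by rewrite big_allpairs_dep.
Qed.

(** Fubini: a large finite set of pairs is within e / 2 of the full sum, and its slices are together
    within e / 2 of the slice sums. *)
Lemma csum_pair : csum F = csum (fun t => csum (fun u => F (t, u))).
Proof.
apply/esym/hassum_csum => e e0; have e2 : 0 < e / 2 by lra.
have [A hA] := asum_csum aF e2.
exists (map fst A) => s us sA.
have [B hB] := @slice_approx (map snd A) _ (divr_gt0 e2 (ltr0Sn R (size s))).
have := hA _ (uniq_pairs us (fun t => let: And3 h _ _ := hB t in h)).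
rewrite big_allpairs_dep /= => hS.
rewrite (le_trans (cmodBD (\sum_(t <- s) \sum_(u <- B t) F (t, u)) _ _)) //.
rewrite (splitr e) lerD //.
  apply: hS => -[t u] tuA; apply/allpairsPdep; exists t, u.
  split=> //; first by apply: sA; apply/mapP; exists (t, u).
  by have [_ h _] := hB t; apply: h; apply/mapP; exists (t, u).
rewrite -sumrB (le_trans (cmod_sum _ _ _)) //.
rewrite (le_trans _ (sum_const_div s e2)) //; apply: ler_sum => t _.
by rewrite cmodBC; have [] := hB t.
Qed.

End Product.

Lemma csum_prod (T U : choiceType) (F : T -> C) (G : U -> C) : asum F -> asum G ->
  csum (fun p : T * U => F p.1 * G p.2) = csum F * csum G.
Proof.
move=> hF hG; rewrite csum_pair; last exact: asum_prod.
under [X in csum X]eq_fun do rewrite /= csumZ //.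
rewrite [RHS]mulrC -csumZ //; congr csum; apply/funext => t; exact: mulrC.
Qed.

Lemma csum_exchange (T U : choiceType) (F : T * U -> C) : asum F ->
  csum (fun t => csum (fun u => F (t, u))) = csum (fun u => csum (fun t => F (t, u))).
Proof.
move=> hF; rewrite -csum_pair //.
have swb : bijective (fun p : U * T => (p.2, p.1)).
  by exists (fun p : T * U => (p.2, p.1)) => -[].
rewrite -(csum_bij swb) // csum_pair //.
exact: asum_inj (bij_inj swb) hF.
Qed.

End Sums.

(** * Complex-valued functions of a real variable *)

Section RealDerivative.
Variable R : realType.
Implicit Types (f g : R -> R) (x h : R).

Definition rder x f d := is_derive x (1 : R) f d.

Lemma rder_eq x f d d' : rder x f d -> d = d' -> rder x f d'.
Proof. by move=> h <-. Qed.

Lemma rder_cst x c : rder x (fun=> c) 0.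
Proof. exact: is_derive_cst. Qed.

Lemma rder_id x : rder x id 1.
Proof. exact: is_derive_id. Qed.

Lemma rderD x f g df dg : rder x f df -> rder x g dg -> rder x (fun t => f t + g t) (df + dg).
Proof. by move=> h1 h2; exact: is_deriveD. Qed.

Lemma rderN x f df : rder x f df -> rder x (fun t => - f t) (- df).
Proof. by move=> h1; exact: is_deriveN. Qed.

Lemma rderM x f g df dg : rder x f df -> rder x g dg ->
  rder x (fun t => f t * g t) (df * g x + f x * dg).
Proof.
move=> h1 h2; apply: rder_eq (is_deriveM h1 h2) _.
by rewrite addrC mulrC.
Qed.

Lemma rder_comp x f g df dg : rder x f df -> rder (f x) g dg ->
  rder x (fun t => g (f t)) (dg * df).
Proof. by move=> h1 h2; have := is_derive1_comp h2 h1. Qed.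

Lemma rder_uniq x f d d' : rder x f d -> rder x f d' -> d = d'.
Proof. by move=> [_ <-] [_ <-]. Qed.

Lemma MVT_line f df x h : (forall t, rder t f (df t)) ->
  exists2 c, `|c - x| <= `|h| & f (x + h) - f x = df c * h.
Proof.
move=> hf.
have cf a b : {within `[a, b], continuous f}.
  apply: continuous_subspaceT => t; apply: differentiable_continuous.
  by apply/derivable1_diffP; case: (hf t).
have [h0|h0] := leP 0 h.
  have [|c hc e] := @MVT_segment R f df x (x + h) _ (fun t _ => hf t) (cf _ _); first by lra.
  exists c; last by rewrite e addrAC subrr add0r.
  move: hc; rewrite in_itv /= => /andP[h1 h2]; rewrite !ger0_norm //; lra.
have [|c hc e] := @MVT_segment R f df (x + h) x _ (fun t _ => hf t) (cf _ _); first by lra.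
exists c; last by rewrite -opprB e; ring.
move: hc; rewrite in_itv /= => /andP[h1 h2]; rewrite [`|h|]ltr0_norm // ler0_norm; lra.
Qed.

Lemma taylor1_real f df x h M : (forall t, rder t f (df t)) ->
  (forall t, `|t - x| <= `|h| -> `|df t| <= M) -> `|f (x + h) - f x| <= M * `|h|.
Proof.
move=> hf hM; have [c hc ->] := MVT_line x h hf.
by rewrite normrM ler_wpM2r // hM.
Qed.

(** Two uses of the mean value theorem give the constant M in place of the sharp M / 2, which
    suffices. *)
Lemma taylor2_real f df ddf x h M : (forall t, rder t f (df t)) ->
  (forall t, rder t df (ddf t)) ->
  (forall t, `|t - x| <= `|h| -> `|ddf t| <= M) ->
  `|f (x + h) - f x - h * df x| <= M * h ^+ 2.
Proof.
move=> hf hdf hM; have [c hc ->] := MVT_line x h hf.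
have [c' hc' e] := MVT_line x (c - x) hdf.
have xc : x + (c - x) = c by rewrite addrC subrK.
rewrite xc in e.
rewrite (mulrC (df c)) -mulrBr e normrM normrM mulrCA ler_pM //.
  by apply: hM; rewrite (le_trans hc').
by rewrite -real_normK ?num_real // expr2 ler_wpM2l.
Qed.

Lemma rder_cst_eq f x y : (forall t, rder t f 0) -> f x = f y.
Proof.
move=> hf; have [c _] := MVT_line y (x - y) hf.
by rewrite mul0r [y + _]addrC subrK => /eqP; rewrite subr_eq0 => /eqP.
Qed.

(** Converse of the Taylor estimate. Quadratic remainder bounds survive summation and passage to
    means, so differentiation under a sum goes through them. *)
Lemma quad_rder f x d K e : 0 < e ->
  (forall h, `|h| <= e -> `|f (x + h) - f x - h * d| <= K * h ^+ 2) -> rder x f d.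
Proof.
move=> e0 hq.
have K0 : 0 <= K.
  have /hq h : `|e| <= e by rewrite ger0_norm // ltW.
  by rewrite -(pmulr_lge0 K (exprn_gt0 2 e0)) (le_trans (normr_ge0 _) h).
have cv : (fun h : R => h^-1 *: ((f \o shift x) (h *: (1 : R)) - f x)) @ 0^' --> d.
  apply/cvgrPdist_le => eps eps0; near=> h.
  have h0 : h != 0 by near: h; exact: nbhs_dnbhs_neq.
  have hK : (K + 1) * `|h| <= eps.
    rewrite mulrC -ler_pdivlMr; last by lra.
    by near: h; apply: dnbhs0_le; rewrite divr_gt0 //; lra.
  have he : `|h| <= e by near: h; exact: dnbhs0_le.
  have := hq h he; rewrite /= /GRing.scale /= mulr1 [h + x]addrC => hh.
  have -> : d - h^-1 * (f (x + h) - f x) = - h^-1 * (f (x + h) - f x - h * d) by field.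
  rewrite normrM normrN normfV mulrC ler_pdivrMr ?normr_gt0 //.
  rewrite (le_trans hh) // -real_normK ?num_real // expr2 mulrA ler_wpM2r //.
  by apply: le_trans hK; rewrite ler_wpM2r //; lra.
split; first exact: (cvgP d cv).
exact: (cvg_lim _ cv).
Unshelve. all: by end_near. Qed.

End RealDerivative.

(** * Complex exponentials and componentwise derivatives *)

Section ComplexExp.
Variable R : realType.
Local Notation C := R[i].
Implicit Types (z w : C) (x h : R).

Lemma expcD z w : expc (z + w) = expc z * expc w.
Proof.
case: z w => [a b] [c d]; rewrite /expc /= expRD sinD cosD.
by apply/eqP; rewrite eq_complex /=; apply/andP; split; apply/eqP; ring.
Qed.

Lemma expc0 : expc (0 : C) = 1.
Proof. by rewrite /expc /= expR0 cos0 sin0 mulr1 mulr0. Qed.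

Lemma expc_real x : expc x%:C = (expR x)%:C.
Proof. by rewrite /expc /= cos0 sin0 mulr1 mulr0. Qed.

Lemma cmod_expc z : cmod (expc z) = expR (complex.Re z).
Proof.
by rewrite /expc /cmod /= !exprMn -mulrDr cos2Dsin2 mulr1 sqrtr_sqr ger0_norm.
Qed.

Lemma expcN z : expc (- z) = (expc z)^-1.
Proof.
have h : expc (- z) * expc z = 1 by rewrite -expcD addNr expc0.
have z0 : expc z != 0.
  by apply/eqP => e; move: h; rewrite e mulr0 => /esym/eqP; rewrite oner_eq0.
by apply: (mulIf z0); rewrite h mulVf.
Qed.

Lemma expc_neq0 z : expc z != 0.
Proof.
apply/eqP => e; have /eqP := cmod_expc z; rewrite e cmod0 eq_sym.
by rewrite gt_eqF // expR_gt0.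
Qed.

Lemma eipi2D z w : eipi2 (z + w) = eipi2 z * eipi2 w.
Proof. by rewrite /eipi2 mulrDr expcD. Qed.

Lemma eipi2_0 : eipi2 (0 : C) = 1.
Proof. by rewrite /eipi2 mulr0 expc0. Qed.

Lemma eipi2N z : eipi2 (- z) = (eipi2 z)^-1.
Proof. by rewrite /eipi2 mulrN expcN. Qed.

Lemma eipi2_1 : eipi2 (1 : C) = 1.
Proof.
rewrite /eipi2 mulr1 /expc /= !(mul0r, mulr0, mulr1, addr0, subr0, sub0r, oppr0).
by rewrite expR0 !mul1r mulrC mulr_natr cos2pi sin2pi.
Qed.

Lemma eipi2_nat n : eipi2 (n%:R : C) = 1.
Proof. by elim: n => [|n IH]; rewrite ?eipi2_0 // -natr1 eipi2D IH eipi2_1 mulr1. Qed.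

Lemma eipi2_int (n : int) : eipi2 (n%:~R : C) = 1.
Proof.
by case: n => n; rewrite ?NegzE ?rmorphN /= ?eipi2N eipi2_nat ?invr1.
Qed.

Lemma cmod_eipi2 z : cmod (eipi2 z) = expR (- (2 * pi) * complex.Im z).
Proof.
rewrite /eipi2 cmod_expc; case: z => a b /=; congr expR.
by rewrite !(mul0r, mulr0, mulr1, addr0, subr0, sub0r); ring.
Qed.

Lemma cmod_eipi2_real x : cmod (eipi2 x%:C) = 1.
Proof. by rewrite cmod_eipi2 /= mulr0 expR0. Qed.

(** Taken on real and imaginary parts separately, so that the real mean value theorem is available;
    the factors 2 in [taylor1] and [taylor2] come from adding the two parts. *)
Definition cder x (g : R -> C) (d : C) :=
  rder x (fun t => complex.Re (g t)) (complex.Re d) /\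
  rder x (fun t => complex.Im (g t)) (complex.Im d).

Lemma cder_eq x g d d' : cder x g d -> d = d' -> cder x g d'.
Proof. by move=> h <-. Qed.

Lemma cder_cst x c : cder x (fun=> c) 0.
Proof. by split; exact: rder_cst. Qed.

Lemma cder_real x f d : rder x f d -> cder x (fun t => (f t)%:C) d%:C.
Proof. by move=> h; split=> //=; exact: rder_cst. Qed.

Lemma Re_add z w : complex.Re (z + w) = complex.Re z + complex.Re w.
Proof. by case: z w => [? ?] [? ?]. Qed.

Lemma Im_add z w : complex.Im (z + w) = complex.Im z + complex.Im w.
Proof. by case: z w => [? ?] [? ?]. Qed.

Lemma Re_opp z : complex.Re (- z) = - complex.Re z.
Proof. by case: z. Qed.

Lemma Im_opp z : complex.Im (- z) = - complex.Im z.
Proof. by case: z. Qed.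

Lemma Re_mul z w : complex.Re (z * w) = complex.Re z * complex.Re w - complex.Im z * complex.Im w.
Proof. by case: z w => [? ?] [? ?]. Qed.

Lemma Im_mul z w : complex.Im (z * w) = complex.Re z * complex.Im w + complex.Im z * complex.Re w.
Proof. by case: z w => [? ?] [? ?]. Qed.

Lemma cderD x f g df dg : cder x f df -> cder x g dg ->
  cder x (fun t => f t + g t) (df + dg).
Proof.
move=> [h1 h2] [k1 k2]; split.
  by rewrite Re_add; under eq_fun do rewrite Re_add; exact: rderD.
by rewrite Im_add; under eq_fun do rewrite Im_add; exact: rderD.
Qed.

Lemma cderM x f g df dg : cder x f df -> cder x g dg ->
  cder x (fun t => f t * g t) (df * g x + f x * dg).
Proof.
move=> [h1 h2] [k1 k2]; split.
  under eq_fun do rewrite Re_mul.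
  apply: rder_eq (rderD (rderM h1 k1) (rderN (rderM h2 k2))) _.
  by rewrite Re_add !Re_mul; ring.
under eq_fun do rewrite Im_mul.
apply: rder_eq (rderD (rderM h1 k2) (rderM h2 k1)) _.
by rewrite Im_add !Im_mul; ring.
Qed.

Lemma cderZ x c f df : cder x f df -> cder x (fun t => c * f t) (c * df).
Proof. by move=> h; apply: cder_eq (cderM (cder_cst x c) h) _; rewrite mul0r add0r. Qed.

Lemma cderN x f df : cder x f df -> cder x (fun t => - f t) (- df).
Proof.
by move=> h; have := cderZ (-1) h; rewrite mulN1r; under eq_fun do rewrite mulN1r.
Qed.

Lemma cderB x f g df dg : cder x f df -> cder x g dg ->
  cder x (fun t => f t - g t) (df - dg).
Proof. by move=> h1 h2; apply: cderD => //; exact: cderN. Qed.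

Lemma cder_expc x f df : cder x f df -> cder x (fun t => expc (f t)) (df * expc (f x)).
Proof.
move=> [h1 h2].
have e1 := rder_comp h1 (is_derive_expR (complex.Re (f x))).
have e2 := rder_comp h2 (is_derive_cos (complex.Im (f x))).
have e3 := rder_comp h2 (is_derive_sin (complex.Im (f x))).
split.
  apply: rder_eq (rderM e1 e2) _; rewrite Re_mul /=; ring.
apply: rder_eq (rderM e1 e3) _; rewrite Im_mul /=; ring.
Qed.

Lemma cder_comp x (f : R -> R) g df dg : rder x f df -> cder (f x) g dg ->
  cder x (fun t => g (f t)) (df%:C * dg).
Proof.
move=> h [k1 k2]; split.
  apply: rder_eq (rder_comp h k1) _.
  by rewrite Re_mul /= mul0r subr0 mulrC.
apply: rder_eq (rder_comp h k2) _.
by rewrite Im_mul /= mul0r addr0 mulrC.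
Qed.

Lemma cder_uniq x f d d' : cder x f d -> cder x f d' -> d = d'.
Proof.
move=> [h1 h2] [k1 k2]; apply/eqP; rewrite eq_complex.
by rewrite (rder_uniq h1 k1) (rder_uniq h2 k2) !eqxx.
Qed.

Lemma taylor1 (g g1 : R -> C) x h M : (forall t, cder t g (g1 t)) ->
  (forall t, `|t - x| <= `|h| -> cmod (g1 t) <= M) ->
  cmod (g (x + h) - g x) <= 2 * M * `|h|.
Proof.
move=> hg hM; rewrite (le_trans (cmod_ReIm _)) // !(Re_add, Im_add, Re_opp, Im_opp).
rewrite -mulrA mulr_natl mulr2n lerD //.
  apply: (@taylor1_real _ (fun t => complex.Re (g t)) (fun t => complex.Re (g1 t)) x h M) => t;
  first by case: (hg t).
  by move=> ht; rewrite (le_trans (cmod_Re _)) // hM.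
apply: (@taylor1_real _ (fun t => complex.Im (g t)) (fun t => complex.Im (g1 t)) x h M) => t;
  first by case: (hg t).
by move=> ht; rewrite (le_trans (cmod_Im _)) // hM.
Qed.

Lemma Re_scale (r : R) z : complex.Re (r%:C * z) = r * complex.Re z.
Proof. by rewrite Re_mul /= mul0r subr0. Qed.

Lemma Im_scale (r : R) z : complex.Im (r%:C * z) = r * complex.Im z.
Proof. by rewrite Im_mul /= mul0r addr0. Qed.

Lemma taylor2 (g g1 g2 : R -> C) x h M : (forall t, cder t g (g1 t)) ->
  (forall t, cder t g1 (g2 t)) ->
  (forall t, `|t - x| <= `|h| -> cmod (g2 t) <= M) ->
  cmod (g (x + h) - g x - h%:C * g1 x) <= 2 * M * h ^+ 2.
Proof.
move=> hg hg1 hM; rewrite (le_trans (cmod_ReIm _)) // !(Re_add, Im_add, Re_opp, Im_opp) Re_scale Im_scale.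
rewrite -mulrA mulr_natl mulr2n lerD //.
  apply: (@taylor2_real _ (fun t => complex.Re (g t)) (fun t => complex.Re (g1 t))
  (fun t => complex.Re (g2 t)) x h M) => t.
  - by case: (hg t).
  - by case: (hg1 t).
  - by move=> ht; rewrite (le_trans (cmod_Re _)) // hM.
apply: (@taylor2_real _ (fun t => complex.Im (g t)) (fun t => complex.Im (g1 t))
  (fun t => complex.Im (g2 t)) x h M) => t.
- by case: (hg t).
- by case: (hg1 t).
- by move=> ht; rewrite (le_trans (cmod_Im _)) // hM.
Qed.

Lemma cder_cst_eq g x y : (forall t, cder t g 0) -> g x = g y.
Proof.
move=> hg; apply/eqP; rewrite eq_complex.
rewrite (@rder_cst_eq _ (fun t => complex.Re (g t)) x y); last by move=> t; case: (hg t).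
by rewrite (@rder_cst_eq _ (fun t => complex.Im (g t)) x y) ?eqxx // => t; case: (hg t).
Qed.

Lemma quad_cder g x d K e : 0 < e ->
  (forall h, `|h| <= e -> cmod (g (x + h) - g x - h%:C * d) <= K * h ^+ 2) -> cder x g d.
Proof.
move=> e0 hq; split; apply: (quad_rder (K := K) e0) => h he.
  by have := le_trans (cmod_Re _) (hq h he); rewrite !(Re_add, Re_opp) Re_scale.
by have := le_trans (cmod_Im _) (hq h he); rewrite !(Im_add, Im_opp) Im_scale.
Qed.

End ComplexExp.

(** * Jacobi's identity for complex Gaussians *)

Section Weights.
Variable R : realType.
Local Notation C := R[i].
Implicit Types (x y a : R).

Definition wt x : R := (1 + x ^+ 2)^-1.

Lemma wtD_gt0 x : 0 < 1 + x ^+ 2.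
Proof. by rewrite ltr_pwDl // sqr_ge0. Qed.

Lemma wt_gt0 x : 0 < wt x.
Proof. by rewrite invr_gt0 wtD_gt0. Qed.

Lemma wt_ge0 x : 0 <= wt x.
Proof. exact: ltW (wt_gt0 x). Qed.

Lemma wsum_wt_nat : wsum (fun n : nat => wt n%:R) 4.
Proof.
move=> s us; pose N := (\max_(k <- s) k).+1.
have sN : {subset s <= iota 0 N}.
  move=> k ks; rewrite mem_iota /= add0n ltnS.
  exact: (@leq_bigmax_seq _ s xpredT (fun k => k) k ks isT).
apply: le_trans (sum_subset_le (fun n : nat => wt_ge0 n%:R) us (iota_uniq _ _) sN) _.
have -> : iota 0 N = index_iota 0 N by rewrite /index_iota subn0.
(* Telescoping majorant: 1 / (1 + n^2) <= 4 / (n + 1) - 4 / (n + 2). *)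
have tel (n : nat) : \sum_(0 <= k < n) wt k%:R <= 4 - 4 / n.+1%:R.
  elim: n => [|n IH]; first by rewrite big_geq // divr1 subrr.
  rewrite big_nat_recr //=.
  have h : wt n%:R <= 4 / n.+1%:R - 4 / n.+2%:R.
    rewrite /wt -(natr1 n.+1) -(natr1 n); set x := n%:R.
    have x0 : 0 <= x by rewrite ler0n.
    rewrite -[leLHS]div1r ler_pdivrMr ?wtD_gt0 //.
    have -> : (4 / (x + 1) - 4 / (x + 1 + 1)) * (1 + x ^+ 2) =
        4 * (1 + x ^+ 2) / ((x + 1) * (x + 1 + 1)) by field; apply/andP; split; lra.
    by rewrite ler_pdivlMr ?mulr_gt0; nra.
  by rewrite (le_trans (lerD IH h)) // addrA subrK.
apply: le_trans (tel N) _; rewrite lerBlDr lerDl divr_ge0 ?ler0n //.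
Qed.

Lemma wsum_wt_int : wsum (fun n : int => wt n%:~R) 8.
Proof.
(* An integer is determined by its sign and absolute value, so the total is at most twice the one
   over the naturals. *)
have h : injective (fun n : int => (n < 0, `|n|%N)).
  by move=> m n /= [h1 h2]; lia.
have hb : wsum (fun b : bool => 1 : R) 2.
  move=> s us; rewrite big_const_seq count_predT iter_addr_0 ler_nat.
  by have := uniq_leq_size us (fun b _ => mem_enum predT b); rewrite -cardE card_bool.
have := wsum_inj h (wsum_prod (fun _ => ler01) (fun n => wt_ge0 n%:R) hb wsum_wt_nat).
rewrite (_ : 2 * 4 = 8 :> R); last by ring.
congr wsum; apply/funext => n /=; rewrite mul1r /wt.
by rewrite natr_absz intr_norm real_normK // num_real.
Qed.

(** Peetre's inequality: weights at points a bounded distance apart are comparable. *)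
Lemma wt_shift A a x : `|a| <= A -> wt (a + x) <= 2 * (1 + A ^+ 2) * wt x.
Proof.
move=> aA; have hA : a ^+ 2 <= A ^+ 2.
  by rewrite -real_normK ?num_real // ler_sqr ?nnegrE // (le_trans _ aA).
rewrite /wt -[leLHS]div1r ler_pdivrMr ?wtD_gt0 // mulrAC ler_pdivlMr ?wtD_gt0 // mul1r.
have h1 := sqr_ge0 (2 * a + x); have h2 := sqr_ge0 (a * (a + x)).
have h3 := sqr_ge0 (a + x).
have : A ^+ 2 * (a + x) ^+ 2 >= 0 by rewrite mulr_ge0 // sqr_ge0.
nra.
Qed.

Lemma wsum_wt_shift A a : `|a| <= A ->
  wsum (fun n : int => wt (a + n%:~R)) (16 * (1 + A ^+ 2)).
Proof.
move=> aA s us; apply: (@le_trans _ _ (\sum_(n <- s) 2 * (1 + A ^+ 2) * wt n%:~R)).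
  by apply: ler_sum => n _; exact: wt_shift.
rewrite -big_distrr /=.
have -> : 16 * (1 + A ^+ 2) = 2 * (1 + A ^+ 2) * 8 :> R by ring.
rewrite ler_wpM2l ?wsum_wt_int //.
by rewrite mulr_ge0 // ltW // wtD_gt0.
Qed.

(** For k > 0 and c' = c / k, the inequality 1 + s <= (1 + 1/c') (1 + c' s) <= (1 + 1/c') exp(c' s)
    is raised to the power k. *)
Lemma exp_decay (c : R) k : 0 < c ->
  exists2 K, 0 <= K & forall s, 0 <= s -> (1 + s) ^+ k * expR (- (c * s)) <= K.
Proof.
move=> c0; case: k => [|k].
  exists 1 => // s s0; by rewrite expr0 mul1r -expR0 ler_expR oppr_le0 mulr_ge0 // ltW.
pose c' := c / k.+1%:R; have c'0 : 0 < c' by rewrite divr_gt0.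
pose L := 1 + c'^-1.
have L0 : 0 <= L by rewrite addr_ge0 // invr_ge0 ltW.
exists (L ^+ k.+1); first exact: exprn_ge0.
move=> s s0.
have -> : expR (- (c * s)) = expR (- (c' * s)) ^+ k.+1.
  by rewrite -expRM_natl; congr expR; rewrite /c'; field; rewrite nat1r pnatr_eq0.
rewrite -exprMn ler_pXn2r ?nnegrE ?L0 ?(mulr_ge0, expR_ge0, addr_ge0) //.
rewrite expRN ler_pdivrMr ?expR_gt0 // (@le_trans _ _ (L * (1 + c' * s))) //.
  rewrite /L mulrDl mul1r mulrDr mulr1 mulKf ?gt_eqF //.
  have : 0 <= c'^-1 by rewrite invr_ge0 ltW.
  have : 0 <= c' * s by rewrite mulr_ge0 // ltW.
  lra.
by rewrite ler_wpM2l // expR_ge1Dx.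
Qed.

End Weights.

(** * One-dimensional Gaussians with complex parameters *)

Section Gauss1D.
Variable R : realType.
Local Notation C := R[i].
Implicit Types (x t h : R) (al w : C).

Definition gau al w x : C :=
  expc (- pi%:C * al * (x ^+ 2)%:C + 2%:R * pi%:C * 'i%C * x%:C * w).

(** Uniformity in al and w is what permits differentiation in these parameters under the sum. Half
    of the quadratic decay pays for the linear term in the exponent. *)
Lemma gau_bound (c0 W : R) k : 0 < c0 ->
  exists2 K, 0 <= K & forall al w x, c0 <= complex.Re al -> cmod w <= W ->
    cmod (gau al w x) * (1 + x ^+ 2) ^+ k <= K.
Proof.
move=> c00; have p0 := @pi_gt0 R.
have d0 : 0 < pi * c0 / 2 by rewrite !mulr_gt0.
have [K0 K00 hK] := exp_decay k d0.
(* Cost of completing the square: - 2 pi x Im w <= E + (pi c0 / 2) x^2 when |Im w| <= W. *)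
pose E := 2 * pi * W ^+ 2 / c0.
exists (expR E * K0); first by rewrite mulr_ge0 ?expR_ge0.
move=> al w x hal hw.
have -> : cmod (gau al w x) =
    expR (- (pi * complex.Re al * x ^+ 2) - 2 * pi * x * complex.Im w).
  rewrite /gau cmod_expc; congr expR; case: (al) => a1 a2; case: (w) => w1 w2 /=.
  by rewrite !(mul0r, mulr0, subr0, sub0r, addr0, add0r, mulr1, oppr0); ring.
have h1 : - (pi * complex.Re al * x ^+ 2) - 2 * pi * x * complex.Im w <=
    E - (pi * c0 / 2) * x ^+ 2.
  have hi := le_trans (cmod_Im w) hw.
  have hW : complex.Im w ^+ 2 <= W ^+ 2.
    by rewrite -real_normK ?num_real // ler_sqr ?nnegrE // (le_trans _ hi).
  have h2 : 0 <= pi * (2 * complex.Im w + c0 * x) ^+ 2 / (2 * c0).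
    apply: divr_ge0; last by rewrite mulr_ge0 // ltW.
    by apply: mulr_ge0; [exact: ltW|exact: sqr_ge0].
  have e2 : pi * (2 * complex.Im w + c0 * x) ^+ 2 / (2 * c0) =
      2 * pi * complex.Im w ^+ 2 / c0 + 2 * pi * x * complex.Im w + (pi * c0 / 2) * x ^+ 2.
    by field; rewrite gt_eqF.
  have h3 : 2 * pi * complex.Im w ^+ 2 / c0 <= E.
    by rewrite /E ler_pM2r ?invr_gt0 // ler_pM2l ?mulr_gt0.
  have h4 : pi * c0 * x ^+ 2 <= pi * complex.Re al * x ^+ 2.
    by rewrite ler_wpM2r ?sqr_ge0 // ler_pM2l.
  have e5 : pi * c0 * x ^+ 2 = (pi * c0 / 2) * x ^+ 2 + (pi * c0 / 2) * x ^+ 2 by field.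
  lra.
apply: (@le_trans _ _ (expR (E - pi * c0 / 2 * x ^+ 2) * (1 + x ^+ 2) ^+ k)).
  by rewrite ler_wpM2r ?ler_expR // exprn_ge0 // ltW // wtD_gt0.
rewrite expRD -mulrA ler_wpM2l ?expR_ge0 // mulrC.
exact: hK (sqr_ge0 x).
Qed.

Lemma cder_gau_x al w x :
  cder x (gau al w) ((- 2%:R * pi%:C * al * x%:C + 2%:R * pi%:C * 'i%C * w) * gau al w x).
Proof.
apply: cder_expc; pose dx := cder_real (rder_id x).
have dx2 : cder x (fun t => (t ^+ 2)%:C) (2%:R * x%:C).
  have := cderM dx dx; rewrite mul1r mulr1 -mulr2n mulr_natl.
  by congr cder; apply/funext => t; rewrite -rmorphM.
have h1 := cderZ (- pi%:C * al) dx2.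
have h2 := cderM (cderZ (2%:R * pi%:C * 'i%C) dx) (cder_cst x w).
by apply: cder_eq (cderD h1 h2) _; rewrite /=; ring.
Qed.

Lemma cder_gau_w al w w' x t :
  cder t (fun t => gau al (w + t%:C * w') x)
    (2%:R * pi%:C * 'i%C * x%:C * w' * gau al (w + t%:C * w') x).
Proof.
apply: cder_expc; pose dt := cder_real (rder_id t).
have h1 := cderZ (2%:R * pi%:C * 'i%C * x%:C) (cderD (cder_cst t w) (cderM dt (cder_cst t w'))).
by apply: cder_eq (cderD (cder_cst t (- pi%:C * al * (x ^+ 2)%:C)) h1) _; ring.
Qed.

Lemma gau_sub al w x k : gau al w x * eipi2 (- (k%:C * x%:C)) = gau al (w - k%:C) x.
Proof. by rewrite /gau /eipi2 -expcD; congr expc; rewrite rmorphM; ring. Qed.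

End Gauss1D.

(** * Dominated convergence over growing finite windows *)

Section Tannery.
Variables (R : realType) (T : choiceType).
Local Notation C := R[i].

Lemma wsum_tail (W : T -> R) M (e : R) : (forall t, 0 <= W t) -> wsum W M -> 0 < e ->
  exists A : seq T, uniq A /\ forall B, uniq B -> (forall t, t \in B -> t \notin A) ->
    \sum_(t <- B) W t <= e.
Proof.
move=> W0 hM e0; have [S hS] := ge0_hassum W0 hM.
have e2 : 0 < e / 2 by lra.
have [A hA] := hS _ e2; exists (undup A); split=> [|B uB dB]; first exact: undup_uniq.
have uAB : uniq (undup A ++ B).
  by rewrite cat_uniq undup_uniq uB andbT; apply/hasPn => t /dB.
have sA : {subset A <= undup A} by move=> t; rewrite mem_undup.
have sAB : {subset A <= undup A ++ B} by move=> t tA; rewrite mem_cat mem_undup tA.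
have := hA _ (undup_uniq A) sA; have := hA _ uAB sAB.
rewrite big_cat /= -!rmorph_sum -rmorphD -!rmorphB !cmodR !ler_norml.
by move=> /andP[h1 h2] /andP[h3 h4]; lra.
Qed.

Lemma all_eventually (P : T -> nat -> Prop) (A : seq T) :
  (forall t, exists n0, forall n, (n0 <= n)%N -> P t n) ->
  exists n0, forall n, (n0 <= n)%N -> forall t, t \in A -> P t n.
Proof.
move=> h; elim: A => [|a A [n0 IH]]; first by exists 0%N.
have [n1 h1] := h a; exists (maxn n0 n1) => n; rewrite geq_max => /andP[i0 i1] t.
by rewrite in_cons => /predU1P[->|tA]; [exact: h1|exact: IH].
Qed.

(** On a fixed finite set A the terms converge, and outside A both the window sums and the limit sum
    are below the tail of W. The windows may vary with n as long as they exhaust T. *)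
Lemma tannery (c : nat -> T -> C) (c' : T -> C) (L : nat -> seq T) (W : T -> R) M x :
  wsum W M -> (forall t, 0 <= W t) ->
  (forall n, uniq (L n)) ->
  (forall t, exists n0, forall n, (n0 <= n)%N -> t \in L n) ->
  (forall n t, t \in L n -> cmod (c n t) <= W t) ->
  (forall t e, 0 < e -> exists n0, forall n, (n0 <= n)%N -> cmod (c' t - c n t) <= e) ->
  (forall n, \sum_(t <- L n) c n t = x) ->
  hassum c' x.
Proof.
move=> hW W0 uL hL hc hlim hx.
have hc' t : cmod (c' t) <= W t.
  apply/ler_addgt0Pr => e e0; have [n0 h0] := hlim t e e0; have [n1 h1] := hL t.
  have := h0 _ (leq_maxl n0 n1); have := hc _ _ (h1 _ (leq_maxr n0 n1)).
  by have := cmodD (c' t - c (maxn n0 n1) t) (c (maxn n0 n1) t); rewrite subrK; lra.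
move=> e e0; have e4 : 0 < e / 4 by lra.
have [A [uA hA]] := wsum_tail W0 hW e4.
exists A => B uB sB.
have [n0 h0] := all_eventually A hL.
have [n1 h1] := all_eventually A (fun t => hlim t _ (divr_gt0 e4 (ltr0Sn R (size A)))).
pose n := maxn n0 n1; have sL : {subset A <= L n} by apply: h0; exact: leq_maxl.
have htail (f : T -> C) D : (forall t, t \in D -> cmod (f t) <= W t) -> uniq D ->
    cmod (\sum_(t <- [seq t <- D | t \notin A]) f t) <= e / 4.
  move=> hf uD; apply: le_trans (cmod_sum _ _ _) _.
  apply: (@le_trans _ _ (\sum_(t <- [seq t <- D | t \notin A]) W t)).
    rewrite big_seq [leRHS]big_seq; apply: ler_sum => t.
    by rewrite mem_filter => /andP[_ /hf].
  by apply: hA; [exact: filter_uniq|move=> t; rewrite mem_filter => /andP[]].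
rewrite -(hx n) (sum_subset_split _ uA (uL n) sL) (sum_subset_split _ uA uB sB).
rewrite opprD addrACA -sumrB (le_trans (cmodD _ _)) //.
have -> : e = e / 4 + (e / 4 + e / 4 + e / 4) by lra.
rewrite lerD //.
  apply: le_trans (cmod_sum _ _ _) _.
  apply: le_trans (sum_const_div A e4); rewrite big_seq [leRHS]big_seq.
  by apply: ler_sum => t tA; rewrite cmodBC; apply: h1 => //; exact: leq_maxr.
apply: le_trans (cmodB _ _) _.
have := htail _ _ (hc n) (uL n); have := htail c' B (fun t _ => hc' t) uB; lra.
Qed.

End Tannery.

(** * Means over a period as limits of dyadic Riemann sums *)

Section Mean.
Variable R : realType.
Local Notation C := R[i].
Implicit Types (F G : R -> C) (m : C).

Definition mesh (n : nat) : R := ((2 ^ n)%N%:R)^-1.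

Definition avg n F : C := (mesh n)%:C * \sum_(0 <= j < 2 ^ n) F (j%:R * mesh n).

(* Means of periodic functions are limits of dyadic Riemann sums, which avoids
   integration theory. *)
Definition ismean F m := forall e : R, 0 < e ->
  exists n0, forall n, (n0 <= n)%N -> cmod (m - avg n F) <= e.

Lemma mesh_gt0 n : 0 < mesh n.
Proof. by rewrite invr_gt0 ltr0n expn_gt0. Qed.

Lemma meshE n : (2 ^ n)%N%:R * mesh n = 1.
Proof. by rewrite divff // pnatr_eq0 -lt0n expn_gt0. Qed.

Lemma meshS n : mesh n = 2 * mesh n.+1.
Proof. by rewrite /mesh expnS natrM invfM mulrA divff ?mul1r. Qed.

Lemma mesh_le1 n : mesh n <= 1.
Proof. by rewrite invf_le1 ?ltr0n ?expn_gt0 // ler1n expn_gt0. Qed.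

Lemma mesh_le n k : (n <= k)%N -> mesh k <= mesh n.
Proof. by move=> nk; rewrite lef_pV2 ?posrE ?ltr0n ?expn_gt0 // ler_nat leq_pexp2l. Qed.

Lemma node_itv n j : (j < 2 ^ n)%N -> 0 <= j%:R * mesh n <= 1.
Proof.
move=> h; rewrite mulr_ge0 ?(ltW (mesh_gt0 n)) //= -[leRHS](meshE n).
by rewrite ler_wpM2r ?(ltW (mesh_gt0 n)) // ler_nat ltnW.
Qed.

Lemma mesh_small (K e : R) : 0 < e -> exists n0, forall n, (n0 <= n)%N -> K * mesh n <= e.
Proof.
move=> e0; pose k := Num.bound (`|K| / e).
have hk : `|K| / e < k%:R by apply: archi_boundP; rewrite divr_ge0 // ltW.
exists k => n kn; apply: (@le_trans _ _ (`|K| * mesh n)).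
  by rewrite ler_wpM2r ?(ltW (mesh_gt0 n)) // ler_norm.
rewrite ltr_pdivrMr // in hk; apply: le_trans (ler_wpM2r (ltW (mesh_gt0 n)) (ltW hk)) _.
rewrite mulrAC -[leRHS]mul1r ler_wpM2r ?(ltW e0) //.
rewrite -[leRHS](meshE n) ler_wpM2r ?(ltW (mesh_gt0 n)) // ler_nat.
by rewrite (leq_trans kn) // ltnW // ltn_expl.
Qed.

Lemma avg_le n F K : (forall s, 0 <= s <= 1 -> cmod (F s) <= K) -> cmod (avg n F) <= K.
Proof.
move=> hK; rewrite /avg cmodM cmodR ger0_norm ?(ltW (mesh_gt0 n)) //.
apply: (@le_trans _ _ (mesh n * \sum_(0 <= j < 2 ^ n) K)).
  rewrite ler_wpM2l ?(ltW (mesh_gt0 n)) // (le_trans (cmod_sum _ _ _)) //.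
  rewrite big_nat_cond [leRHS]big_nat_cond; apply: ler_sum => j /andP[/andP[_ hj] _].
  by rewrite hK // node_itv.
by rewrite big_const_nat subn0 iter_addr_0 -mulr_natr mulrCA [mesh n * _]mulrC meshE mulr1.
Qed.

Lemma avgD n F G : avg n (fun s => F s + G s) = avg n F + avg n G.
Proof. by rewrite /avg big_split mulrDr. Qed.

Lemma avgZ n F c : avg n (fun s => c * F s) = c * avg n F.
Proof. by rewrite /avg -big_distrr mulrCA. Qed.

Lemma ismean_uniq F m m' : ismean F m -> ismean F m' -> m = m'.
Proof.
move=> h h'; apply/eqP; rewrite -subr_eq0; apply/eqP/cmod0_eq/le_eps_eq0.
  exact: cmod_ge0.
move=> e e0; have e2 : 0 < e / 2 by lra.
have [n0 h0] := h _ e2; have [n1 h1] := h' _ e2.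
have := h0 _ (leq_maxl n0 n1); have := h1 _ (leq_maxr n0 n1).
rewrite (cmodBC m'); have := cmodBD (avg (maxn n0 n1) F) m m'; lra.
Qed.

Lemma ismeanD F G m m' : ismean F m -> ismean G m' ->
  ismean (fun s => F s + G s) (m + m').
Proof.
move=> h h' e e0; have e2 : 0 < e / 2 by lra.
have [n0 h0] := h _ e2; have [n1 h1] := h' _ e2.
exists (maxn n0 n1) => n; rewrite geq_max => /andP[/h0 i0 /h1 i1].
by rewrite avgD opprD addrACA (le_trans (cmodD _ _)) //; lra.
Qed.

Lemma ismeanZ F m c : ismean F m -> ismean (fun s => c * F s) (c * m).
Proof.
move=> h e e0; have c0 : 0 < cmod c + 1 by have := cmod_ge0 c; lra.
have [n0 h0] := h _ (divr_gt0 e0 c0); exists n0 => n /h0.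
rewrite avgZ -mulrBr cmodM ler_pdivlMr // => h1.
by rewrite (le_trans _ h1) // mulrC ler_wpM2l ?cmod_ge0 //; lra.
Qed.

Lemma ismeanB F G m m' : ismean F m -> ismean G m' ->
  ismean (fun s => F s - G s) (m - m').
Proof.
move=> h h'; have := ismeanD h (ismeanZ (-1) h'); rewrite mulN1r.
by under eq_fun do rewrite mulN1r.
Qed.

Lemma ismean_le F m K : ismean F m -> (forall s, 0 <= s <= 1 -> cmod (F s) <= K) ->
  cmod m <= K.
Proof.
move=> h hK; apply/ler_addgt0Pr => e e0; have [n h0] := h _ e0.
have := h0 n (leqnn n); have := avg_le n hK.
by have := cmodD (m - avg n F) (avg n F); rewrite subrK; lra.
Qed.

(** A dyadic refinement adds exactly the midpoints, so the change of the mean is governed by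
    increments of F over one new mesh width. *)
Lemma avgS n F (L : R) :
  (forall s h, 0 <= s <= 1 -> `|h| <= 1 -> cmod (F (s + h) - F s) <= L * `|h|) ->
  cmod (avg n.+1 F - avg n F) <= L * mesh n.+1.
Proof.
move=> hL.
have dbl (k : nat) (f : nat -> C) :
    \sum_(0 <= j < k.*2) f j = \sum_(0 <= j < k) (f j.*2 + f j.*2.+1).
  elim: k => [|k IH]; first by rewrite !big_geq.
  by rewrite doubleS !big_nat_recr //= IH addrA.
pose h := mesh n.+1; have h0 : 0 < h := mesh_gt0 n.+1.
have -> : avg n.+1 F - avg n F =
    h%:C * \sum_(0 <= j < 2 ^ n) (F (j%:R * mesh n + h) - F (j%:R * mesh n)).
  rewrite /avg expnS mul2n dbl (meshS n) -/h big_split big_split /= sumrN.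
  have e0 j : j.*2%:R * h = j%:R * (2 * h) by rewrite -mul2n natrM; ring.
  have e1 j : j.*2.+1%:R * h = j%:R * (2 * h) + h by rewrite -natr1 mulrDl mul1r e0.
  have -> : \sum_(0 <= j < 2 ^ n) F (j.*2%:R * h) = \sum_(0 <= j < 2 ^ n) F (j%:R * (2 * h)).
    by apply: eq_bigr => j _; rewrite e0.
  have -> : \sum_(0 <= j < 2 ^ n) F (j.*2.+1%:R * h) =
      \sum_(0 <= j < 2 ^ n) F (j%:R * (2 * h) + h) by apply: eq_bigr => j _; rewrite e1.
  by rewrite rmorphM /=; ring.
rewrite cmodM cmodR ger0_norm ?(ltW h0) // [leRHS]mulrC ler_wpM2l ?(ltW h0) //.
apply: le_trans (cmod_sum _ _ _) _.
apply: (@le_trans _ _ (\sum_(0 <= j < 2 ^ n) L * mesh n)).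
  rewrite big_nat_cond [leRHS]big_nat_cond; apply: ler_sum => j /andP[/andP[_ hj] _].
  apply: le_trans (hL _ _ (node_itv hj) _) _; rewrite ger0_norm ?(ltW h0) ?mesh_le1 //.
  rewrite ler_wpM2l ?mesh_le //.
  have := hL 0 1; rewrite normr1 mulr1 !lexx ler01 => /(_ isT isT).
  exact: le_trans (cmod_ge0 _).
by rewrite big_const_nat subn0 iter_addr_0 -mulr_natr -mulrA [mesh n * _]mulrC meshE mulr1.
Qed.

(** Successive dyadic means differ by the terms of a geometric series. *)
Lemma lip_ismean F (L : R) :
  (forall s h, 0 <= s <= 1 -> `|h| <= 1 -> cmod (F (s + h) - F s) <= L * `|h|) ->
  exists m, ismean F m.
Proof.
move=> hL; have L0 : 0 <= L.
  have := hL 0 1; rewrite normr1 mulr1 !lexx ler01 => /(_ isT isT).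
  exact: le_trans (cmod_ge0 _).
pose D r := avg r.+1 F - avg r F.
have tel n k : \sum_(0 <= r < k) mesh (n + r).+1 = mesh n - mesh (n + k).
  elim: k => [|k IH]; first by rewrite big_geq // addn0 subrr.
  by rewrite big_nat_recr //= IH (meshS (n + k)) addnS; ring.
have telD n k : \sum_(0 <= r < k) D (n + r)%N = avg (n + k) F - avg n F.
  elim: k => [|k IH]; first by rewrite big_geq // addn0 subrr.
  by rewrite big_nat_recr //= IH /D addnS; ring.
have hW : wsum (fun r => mesh r.+1) 1.
  move=> s us; pose N := (\max_(k <- s) k).+1.
  have sN : {subset s <= iota 0 N}.
    move=> k ks; rewrite mem_iota /= add0n ltnS.
    exact: (@leq_bigmax_seq _ s xpredT (fun k => k) k ks isT).
  apply: le_trans (sum_subset_le (fun r => ltW (mesh_gt0 r.+1)) us (iota_uniq _ _) sN) _.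
  have -> : iota 0 N = index_iota 0 N by rewrite /index_iota subn0.
  have := tel 0%N N; under eq_bigr do rewrite add0n; move=> ->.
  have := mesh_gt0 (0 + N); have := mesh_le1 0; lra.
have [S hS] : exists S, hassum D S.
  apply/asum_hassum/(wsum_asum hW L0) => r; exact: avgS.
exists (avg 0 F + S) => e e0; have e2 : 0 < e / 2 by lra.
have [A hA] := hS _ e2; pose N := (\max_(k <- A) k).+1.
exists N => n Nn.
have sA : {subset A <= index_iota 0 n}.
  move=> k kA; rewrite mem_index_iota (leq_trans _ Nn) // ltnS.
  exact: (@leq_bigmax_seq _ A xpredT (fun k => k) k kA isT).
have := hA _ (iota_uniq _ _) sA.
have := telD 0%N n; under eq_bigr do rewrite add0n; move=> ->.
rewrite opprB addrA [S + _]addrC => h; rewrite (le_trans h) //; lra.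
Qed.

(** The Riemann sum of F1 is a telescoping sum of increments of F, which vanishes by periodicity, up
    to 2^n errors of order [mesh n] squared. *)
Lemma ismean_deriv F F1 (K : R) : F 1 = F 0 ->
  (forall s h, 0 <= s <= 1 -> `|h| <= 1 ->
     cmod (F (s + h) - F s - h%:C * F1 s) <= K * h ^+ 2) -> ismean F1 0.
Proof.
move=> per hK e e0; have [n0 h0] := mesh_small K e0; exists n0 => n /h0 hn.
rewrite sub0r cmodN (le_trans _ hn) //.
pose h := mesh n; have hp : 0 < h := mesh_gt0 n.
have tel k : \sum_(0 <= j < k) (F (j%:R * h + h) - F (j%:R * h)) = F (k%:R * h) - F 0.
  elim: k => [|k IH]; first by rewrite big_geq // mul0r subrr.
  by rewrite big_nat_recr //= IH -natr1 mulrDl mul1r; ring.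
have -> : avg n F1 = - \sum_(0 <= j < 2 ^ n)
    (F (j%:R * h + h) - F (j%:R * h) - h%:C * F1 (j%:R * h)).
  by rewrite sumrB tel meshE per subrr sub0r opprK -big_distrr.
rewrite cmodN (le_trans (cmod_sum _ _ _)) //.
apply: (@le_trans _ _ (\sum_(0 <= j < 2 ^ n) K * h ^+ 2)).
  rewrite big_nat_cond [leRHS]big_nat_cond; apply: ler_sum => j /andP[/andP[_ hj] _].
  by rewrite hK ?node_itv // ger0_norm ?mesh_le1 // ltW.
rewrite big_const_nat subn0 iter_addr_0 -mulr_natr expr2 mulrA -mulrA.
by rewrite [h * _]mulrC meshE mulr1.
Qed.

End Mean.

(** * Fourier inversion from finite Fourier transforms *)

Section FourierInversion.
Variable R : realType.
Local Notation C := R[i].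

(** A crude Jordan inequality: where cos x >= 1/2 it follows from the mean value theorem, and
    elsewhere the square of sin x exceeds 3/4 while x < 2. *)
Lemma sin_ge_third (x : R) : 0 <= x <= pi / 2 -> x / 3 <= sin x.
Proof.
move=> /andP[x0 x1]; have p2 := @pihalf_lt2 R; have p0 := @pi_gt0 R.
have [hc|hc] := leP (1 / 2) (cos x); last first.
  have s0 : 0 <= sin x by apply: sin_ge0_pi; apply/andP; split; lra.
  have c0 : 0 <= cos x by apply: cos_ge0_pihalf; apply/andP; split; lra.
  have h := cos2Dsin2 x; nra.
have cont : {within `[0, x], continuous (@sin R)}.
  by apply: continuous_subspaceT => t; exact: continuous_sin.
have [c] := MVT_segment x0 (fun t _ => is_derive_sin t) cont.
rewrite in_itv /= sin0 !subr0 => /andP[c0 cx] ->.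
have : cos x <= cos c.
  move: cx; rewrite le_eqVlt => /predU1P[->//|cx].
  rewrite ltW // ltr_cos // in_itv /=; apply/andP; split; lra.
nra.
Qed.

Lemma eipi2_real (x : R) : eipi2 x%:C = cos (2 * pi * x) +i* sin (2 * pi * x).
Proof.
rewrite /eipi2 /expc /= !(mul0r, mulr0, mulr1, addr0, subr0, sub0r, add0r, oppr0).
by rewrite expR0 !mul1r.
Qed.

Lemma cos_double (x : R) : cos (2 * x) = 1 - 2 * sin x ^+ 2.
Proof. by rewrite mulr_natl cos_mulr2n cos2sin2; ring. Qed.

(** The modulus of the multiplier by which a second difference acts on a Fourier coefficient;
    [dft_decay] bounds it from below. *)
Lemma second_difference_symbol (x : R) :
  cmod (eipi2 x%:C + eipi2 (- x)%:C - 2%:R) = 4 * sin (pi * x) ^+ 2.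
Proof.
have -> : eipi2 x%:C + eipi2 (- x)%:C - 2%:R = (- (4 * sin (pi * x) ^+ 2))%:C.
  rewrite !eipi2_real mulrN cosN sinN -mulrA cos_double.
  by apply/eqP; rewrite eq_complex /=; apply/andP; split; apply/eqP; ring.
by rewrite cmodR normrN ger0_norm // mulr_ge0 // sqr_ge0.
Qed.

Lemma eipi2_neq1 (x : R) : 0 < x < 1 -> eipi2 x%:C != 1.
Proof.
move=> /andP[x0 x1]; rewrite eipi2_real eq_complex /= negb_and -mulrA cos_double.
apply/orP; left; have p0 := @pi_gt0 R.
have : 0 < sin (pi * x).
  apply: sin_gt0_pi; rewrite mulr_gt0 //=.
  by rewrite -[ltRHS]mulr1 ltr_pM2l.
by move=> s0; apply/eqP => h; have := exprn_gt0 2 s0; lra.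
Qed.

Lemma cyclic_sum (u : nat -> C) N : u N = u 0%N ->
  \sum_(0 <= j < N) u j.+1 = \sum_(0 <= j < N) u j.
Proof.
case: N => [|N] h; first by rewrite !big_geq.
by rewrite [LHS]big_nat_recr // [RHS]big_nat_recl // h addrC.
Qed.

Variables (F : R -> C) (K : R) (ch : int -> C).
Hypothesis F_per : forall s, F (s + 1) = F s.
Hypothesis F_bnd : forall s, 0 <= s <= 1 -> cmod (F s) <= K.
Hypothesis F_dif : forall s h, 0 <= s <= 1 -> `|h| <= 1 ->
  cmod (F (s + h) + F (s - h) - 2%:R * F s) <= K * h ^+ 2.
Hypothesis F_mean : forall k : int, ismean (fun s => F s * eipi2 (- (k%:~R * s%:C))) (ch k).

Let E (k : int) (s : R) : C := eipi2 (- (k%:~R * s%:C)).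
Let c n k := avg n (fun s => F s * E k s).

Let ED k s t : E k (s + t) = E k s * E k t.
Proof. by rewrite /E -eipi2D rmorphD /=; congr eipi2; ring. Qed.

Let E1 k : E k 1 = 1.
Proof. by rewrite /E mulr1 eipi2N eipi2_int invr1. Qed.

Let E_real k s : E k s = eipi2 (- (k%:~R * s))%:C.
Proof. by rewrite /E rmorphN rmorphM /= rmorph_int. Qed.

Let K0 : 0 <= K.
Proof. by apply: le_trans (cmod_ge0 _) (F_bnd (s := 0) _); rewrite lexx ler01. Qed.

(* Summation by parts twice: the Fourier coefficients of the samples decay like
   1/k^2 uniformly in the mesh, as Tannery's theorem requires. *)
Lemma dft_second_difference n k :
  c n k * (E k (mesh R n) + E k (- mesh R n) - 2%:R) =
  avg n (fun s => (F (s + mesh R n) + F (s - mesh R n) - 2%:R * F s) * E k s).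
Proof.
pose h := mesh R n; rewrite -/h.
have Nh : (2 ^ n)%N%:R * h = 1 := meshE R n.
have jS (j : nat) : j.+1%:R * h = j%:R * h + h by rewrite -natr1 mulrDl mul1r.
have s1 : \sum_(0 <= j < 2 ^ n) F (j%:R * h) * E k (j%:R * h + h) =
    \sum_(0 <= j < 2 ^ n) F (j%:R * h - h) * E k (j%:R * h).
  rewrite -[RHS](cyclic_sum (u := fun j => F (j%:R * h - h) * E k (j%:R * h))).
    by apply: eq_bigr => j _; rewrite jS addrK.
  by rewrite Nh mul0r E1 addrC F_per sub0r -[E k 0]mul1r -(E1 k) -ED addr0 E1.
have s2 : \sum_(0 <= j < 2 ^ n) F (j%:R * h) * E k (j%:R * h - h) =
    \sum_(0 <= j < 2 ^ n) F (j%:R * h + h) * E k (j%:R * h).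
  rewrite -[LHS](cyclic_sum (u := fun j => F (j%:R * h) * E k (j%:R * h - h))).
    by apply: eq_bigr => j _; rewrite jS addrK.
  by rewrite Nh mul0r ED E1 mul1r sub0r -[1]add0r F_per.
rewrite /c /avg -/h -mulrA; congr (_ * _); rewrite mulrDr mulrDr !big_distrl /=.
under eq_bigr do rewrite -mulrA -ED.
under [X in _ + X + _]eq_bigr do rewrite -mulrA -ED.
rewrite s1 s2 -!big_split /=; apply: eq_bigr => j _; ring.
Qed.

(** For |k| h <= 1/2 the angle pi |k| h lies in [0, pi / 2], where the multiplier is at least (k
    h)^2. Second differences of F are at most K h^2, so the coefficient times k^2 is at most K,
    independently of the mesh. *)
Lemma dft_decay n (k : int) : `|k%:~R| * 2 <= (2 ^ n)%N%:R :> R ->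
  cmod (c n k) <= 2 * K * wt (k%:~R).
Proof.
move=> hk; have [->|k0] := eqVneq k 0.
  rewrite /wt expr0n /= addr0 invr1 mulr1 (@le_trans _ _ K) //; last by have := K0; lra.
  apply: avg_le => s hs; rewrite cmodM E_real cmod_eipi2_real mulr1; exact: F_bnd.
pose h := mesh R n; have h0 : 0 < h := mesh_gt0 R n.
have p0 := @pi_gt0 R; have p2 := @pi_ge2 R.
have kR0 : 0 < `|k%:~R| :> R by rewrite normr_gt0 intr_eq0.
have k1 : 1 <= (k%:~R : R) ^+ 2.
  rewrite -real_normK ?num_real // -intr_norm -natr_absz -natrX ler1n expn_gt0.
  by rewrite absz_gt0 k0.
pose x := `|k%:~R| * h; have x0 : 0 < x by rewrite mulr_gt0.
have x1 : x <= 1 / 2.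
  have := ler_wpM2r (ltW h0) hk; rewrite (meshE R n) /x; lra.
have hsym : 4 * sin (pi * x) ^+ 2 = cmod (E k h + E k (- h) - 2%:R).
  rewrite !E_real mulrN opprK [eipi2 _ + _]addrC second_difference_symbol /x.
  have [kp|kp] := ger0P (k%:~R : R) => //.
  by rewrite mulNr mulrN sinN sqrrN.
have hsin : x ^+ 2 <= 4 * sin (pi * x) ^+ 2.
  have : (pi * x) / 3 <= sin (pi * x) by apply: sin_ge_third; apply/andP; split; nra.
  have : 2 * x <= pi * x by nra.
  nra.
have hle : cmod (c n k) * x ^+ 2 <= K * h ^+ 2.
  apply: (@le_trans _ _ (cmod (c n k * (E k h + E k (- h) - 2%:R)))).
    by rewrite cmodM -hsym ler_wpM2l // cmod_ge0.
  rewrite dft_second_difference; apply: avg_le => s hs.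
  rewrite cmodM E_real cmod_eipi2_real mulr1 F_dif // ger0_norm ?mesh_le1 ?(ltW h0) //.
have : cmod (c n k) * (k%:~R) ^+ 2 <= K.
  rewrite -(ler_pM2r (exprn_gt0 2 h0)) (le_trans _ hle) // /x exprMn real_normK ?num_real //.
  by rewrite -[leLHS]mulrA.
rewrite /wt ler_pdivlMr ?wtD_gt0 //; have := cmod_ge0 (c n k); nra.
Qed.

(** Orthogonality of roots of unity of order 2^(n+1): the frequencies from -2^n to 2^n - 1 form a
    full residue system, and every node other than 0 contributes a vanishing geometric sum. *)
Lemma dft_inversion n : \sum_(0 <= i < 2 ^ n.+1) c n.+1 (i%:Z - (2 ^ n)%N%:Z) = F 0.
Proof.
pose N := (2 ^ n.+1)%N; pose h := mesh R n.+1.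
have h0 : 0 < h := mesh_gt0 R n.+1.
have Nh : N%:R * h = 1 := meshE R n.+1.
rewrite /c /avg -/h -big_distrr exchange_big /=.
have N0 : (0 < N)%N by rewrite expn_gt0.
rewrite -/N big_ltn // mul0r.
rewrite [X in _ + X]big1_seq ?addr0.
  rewrite (eq_bigr (fun=> F 0)); last by move=> i _; rewrite /E mulr0 oppr0 eipi2_0 mulr1.
  rewrite big_const_nat subn0 iter_addr_0.
  have -> : h%:C * (F 0 *+ N) = (N%:R * h)%:C * F 0.
    by rewrite rmorphM rmorph_nat /= -mulr_natl; ring.
  by rewrite Nh mul1r.
move=> j /andP[_]; rewrite mem_index_iota => /andP[j1 jN].
rewrite -big_distrr /=.
have Ei i : E (i%:Z - (2 ^ n)%N%:Z) (j%:R * h) =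
    E (- (2 ^ n)%N%:Z) (j%:R * h) * (eipi2 (- (j%:R * h))%:C) ^+ i.
  have -> : eipi2 (- (j%:R * h))%:C ^+ i = E i%:Z (j%:R * h).
    elim: i => [|i IH]; first by rewrite expr0 /E mul0r oppr0 eipi2_0.
    rewrite exprS IH !E_real -eipi2D -rmorphD; congr (eipi2 _%:C).
    by rewrite -[i.+1]addn1 PoszD rmorphD /=; ring.
  by rewrite /E -eipi2D rmorphB /=; congr eipi2; rewrite rmorphN /=; ring.
rewrite (eq_bigr _ (fun i _ => Ei i)) -big_distrr /=.
set r := eipi2 _.
have rN : r ^+ N = 1.
  have -> : r ^+ N = E j%:Z (N%:R * h).
    rewrite /r; elim: (N) => [|i IH]; first by rewrite expr0 mul0r /E mulr0 oppr0 eipi2_0.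
    rewrite exprS IH !E_real -eipi2D -rmorphD; congr (eipi2 _%:C).
    by rewrite -natr1 /=; ring.
  by rewrite Nh E1.
have r1 : r - 1 != 0.
  rewrite subr_eq0 /r rmorphN eipi2N invr_eq1; apply: eipi2_neq1.
  by rewrite mulr_gt0 ?ltr0n //= -[ltRHS]Nh ltr_pM2r // ltr_nat.
have : (r - 1) * \sum_(0 <= i < N) r ^+ i = 0.
  by rewrite big_mkord -subrX1 rN subrr.
by move/eqP; rewrite mulf_eq0 (negPf r1) /= => /eqP ->; rewrite !mulr0.
Qed.

(** The finite inversion formula is exact at every mesh, and [tannery] lets the mesh shrink inside
    the sum over frequencies. *)
Lemma fourier_inversion : hassum ch (F 0).
Proof.
pose L n := [seq i%:Z - (2 ^ n)%N%:Z | i <- index_iota 0 (2 ^ n.+1)].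
have inL n (k : int) : (k \in L n) = (- (2 ^ n)%N%:Z <= k < (2 ^ n)%N%:Z).
  apply/mapP/idP => [ [j] |hk].
    rewrite mem_index_iota expnS mul2n -addnn => /andP[_ hj] ->; lia.
  exists (absz (k + (2 ^ n)%N%:Z)); last by lia.
  by rewrite mem_index_iota expnS mul2n -addnn; lia.
apply: (@tannery _ _ (fun n => c n.+1) ch L (fun k => 2 * K * wt k%:~R) (2 * K * 8)).
- move=> s us; rewrite -big_distrr /= ler_wpM2l ?wsum_wt_int //.
  by rewrite mulr_ge0 // K0.
- by move=> k; rewrite mulr_ge0 ?wt_ge0 // mulr_ge0 // K0.
- by move=> n; rewrite map_inj_uniq ?iota_uniq // => i j; lia.
- move=> k; exists (absz k) => n kn; rewrite inL.
  have := ltn_expl n (isT : 1 < 2)%N; lia.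
- move=> n k; rewrite inL => hk; apply: dft_decay.
  rewrite -intr_norm -natr_absz -natrM ler_nat expnS mulnC leq_mul2l /=; lia.
- move=> k e e0; have [n0 h0] := F_mean k e0.
  by exists n0 => n hn; apply: h0; rewrite (leq_trans hn).
- by move=> n; rewrite big_map dft_inversion.
Qed.

End FourierInversion.

Section TermwiseTaylor.
Variables (R : realType) (T : choiceType).
Local Notation C := R[i].

(** In the applications K contains the factor h^2: termwise Taylor remainders become one for the
    sum. *)
Lemma csum_quad (gh g0 g1 : T -> C) (W : T -> R) M (h K : R) :
  asum gh -> asum g0 -> asum g1 -> wsum W M -> 0 <= K ->
  (forall t, cmod (gh t - g0 t - h%:C * g1 t) <= K * W t) ->
  cmod (csum gh - csum g0 - h%:C * csum g1) <= K * M.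
Proof.
move=> ah a0 a1 hW K0 hq.
rewrite -csumB // -csumZ // -csumB; [|exact: asumB|exact: asumZ].
exact: (wsum_csum hW K0 hq).
Qed.

End TermwiseTaylor.

(** * Periodized functions *)

Section Periodization.
Variable R : realType.
Local Notation C := R[i].
Implicit Types (g : R -> C) (s h x : R).

Definition per g s : C := csum (fun n : int => g (s + n%:~R)).

Definition decay g (K : R) := forall x, cmod (g x) * (1 + x ^+ 2) <= K.

Lemma decay_wt g K x : decay g K -> cmod (g x) <= K * wt x.
Proof. by move=> h; rewrite /wt ler_pdivlMr ?wtD_gt0. Qed.

Lemma decay_ge0 g K : decay g K -> 0 <= K.
Proof. by move=> h; apply: le_trans (h 0); rewrite mulr_ge0 ?cmod_ge0 // ltW // wtD_gt0. Qed.

Lemma asum_per g K s : decay g K -> asum (fun n : int => g (s + n%:~R)).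
Proof.
move=> h; apply: (wsum_asum (wsum_wt_shift (lexx `|s|)) (decay_ge0 h)) => n.
exact: decay_wt.
Qed.

Lemma per_periodic g K s : decay g K -> per g (s + 1) = per g s.
Proof.
move=> h; rewrite /per -(@csum_bij _ _ _ (fun n : int => n + 1) _ _ (asum_per s h)).
  by congr csum; apply/funext => n; rewrite rmorphD /= [n%:~R + _]addrC addrA.
by exists (fun n => n - 1) => n; rewrite ?addrK ?subrK.
Qed.

Lemma per_le g K A s : decay g K -> `|s| <= A -> cmod (per g s) <= K * (16 * (1 + A ^+ 2)).
Proof.
move=> h hs; apply: (wsum_csum (wsum_wt_shift hs) (decay_ge0 h)) => n; exact: decay_wt.
Qed.

Lemma wt_near x t : `|t - x| <= 1 -> wt t <= 4 * wt x.
Proof. by move=> h; rewrite -(subrK x t) (le_trans (wt_shift _ h)) //; lra. Qed.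

Lemma per_taylor g g1 g2 K K1 K2 A s h :
  (forall x, cder x g (g1 x)) -> (forall x, cder x g1 (g2 x)) ->
  decay g K -> decay g1 K1 -> decay g2 K2 -> `|s| <= A -> `|h| <= 1 ->
  cmod (per g (s + h) - per g s - h%:C * per g1 s) <=
    8 * K2 * (16 * (1 + A ^+ 2)) * h ^+ 2.
Proof.
move=> d1 d2 D0 D1 D2 hs hh; rewrite mulrAC.
have K20 := decay_ge0 D2.
apply: csum_quad (asum_per _ D0) (asum_per _ D0) (asum_per _ D1) (wsum_wt_shift hs) _ _.
  by rewrite mulr_ge0 ?sqr_ge0 // mulr_ge0.
move=> n; rewrite [s + h + _]addrAC.
apply: le_trans (@taylor2 _ g g1 g2 _ h (4 * K2 * wt (s + n%:~R)) d1 d2 _) _.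
  move=> t ht; apply: le_trans (decay_wt _ D2) _.
  by rewrite mulrC [4 * _]mulrC -mulrA [_ * K2]mulrC ler_wpM2l // wt_near // (le_trans ht).
by rewrite le_eqVlt; apply/orP; left; apply/eqP; ring.
Qed.

Lemma per_lip g g1 K K1 A s h :
  (forall x, cder x g (g1 x)) -> decay g K -> decay g1 K1 -> `|s| <= A -> `|h| <= 1 ->
  cmod (per g (s + h) - per g s) <= 8 * K1 * (16 * (1 + A ^+ 2)) * `|h|.
Proof.
move=> d1 D0 D1 hs hh; rewrite mulrAC /per -csumB; [|exact: asum_per D0..].
have K10 := decay_ge0 D1.
apply: (wsum_csum (wsum_wt_shift hs)); first by rewrite !mulr_ge0.
move=> n; rewrite [s + h + _]addrAC.
apply: le_trans (@taylor1 _ g g1 _ h (4 * K1 * wt (s + n%:~R)) d1 _) _.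
  move=> t ht; apply: le_trans (decay_wt _ D1) _.
  by rewrite mulrC [4 * _]mulrC -mulrA [_ * K1]mulrC ler_wpM2l // wt_near // (le_trans ht).
by rewrite le_eqVlt; apply/orP; left; apply/eqP; ring.
Qed.

Lemma per_mean g g1 K K1 : (forall x, cder x g (g1 x)) -> decay g K -> decay g1 K1 ->
  exists m, ismean (per g) m.
Proof.
move=> d1 D0 D1; apply: (@lip_ismean _ _ (8 * K1 * (16 * (1 + 1 ^+ 2)))) => s h hs hh.
apply: per_lip d1 D0 D1 _ hh.
by case/andP: hs => h0 h1; rewrite ger0_norm.
Qed.

Lemma per_deriv_mean g g1 g2 K K1 K2 :
  (forall x, cder x g (g1 x)) -> (forall x, cder x g1 (g2 x)) ->
  decay g K -> decay g1 K1 -> decay g2 K2 -> ismean (per g1) 0.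
Proof.
move=> d1 d2 D0 D1 D2.
apply: (@ismean_deriv _ (per g) _ (8 * K2 * (16 * (1 + 1 ^+ 2)))).
  by have := per_periodic 0 D0; rewrite add0r.
move=> s h hs hh; apply: per_taylor d1 d2 D0 D1 D2 _ hh.
by case/andP: hs => h0 h1; rewrite ger0_norm.
Qed.

Lemma perD g g' K K' s : decay g K -> decay g' K' ->
  per (fun x => g x + g' x) s = per g s + per g' s.
Proof. by move=> D0 D1; rewrite /per csumD //; [exact: asum_per D0|exact: asum_per D1]. Qed.

Lemma perZ g K c s : decay g K -> per (fun x => c * g x) s = c * per g s.
Proof. by move=> D0; rewrite /per csumZ //; exact: asum_per D0. Qed.

Lemma decayZ g K c : decay g K -> decay (fun x => c * g x) (cmod c * K).
Proof. by move=> h x; rewrite cmodM -mulrA ler_wpM2l ?cmod_ge0. Qed.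

End Periodization.

(** * Polynomial multiples of Gaussians *)

Section Jacobi.
Variable R : realType.
Local Notation C := R[i].
Implicit Types (al w z : C) (x t s h : R).

Definition polygrowth (p : R -> C) := exists B k, forall x, cmod (p x) <= B * (1 + x ^+ 2) ^+ k.

Lemma one_le_wtD x : 1 <= 1 + x ^+ 2.
Proof. by rewrite lerDl sqr_ge0. Qed.

Lemma polygrowth_cst c : polygrowth (fun=> c).
Proof. by exists (cmod c), 0%N => x; rewrite expr0 mulr1. Qed.

Lemma polygrowth_x : polygrowth (fun x => x%:C).
Proof.
exists 1, 1%N => x; rewrite expr1 mul1r cmodR.
have [x1|x1] := leP `|x| 1; first by rewrite (le_trans x1) // one_le_wtD.
rewrite -[x ^+ 2]real_normK ?num_real //; nra.
Qed.

Lemma polygrowthD p q : polygrowth p -> polygrowth q -> polygrowth (fun x => p x + q x).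
Proof.
move=> [B [k hp]] [B' [k' hq]]; exists (B + B'), (k + k')%N => x.
have B0 : 0 <= B by have := hp 0; rewrite expr0n addr0 expr1n mulr1; exact: le_trans (cmod_ge0 _).
have B'0 : 0 <= B' by have := hq 0; rewrite expr0n addr0 expr1n mulr1; exact: le_trans (cmod_ge0 _).
apply: le_trans (cmodD _ _) _; rewrite mulrDl lerD //.
  by rewrite (le_trans (hp x)) // ler_wpM2l // ler_weXn2l ?one_le_wtD ?leq_addr.
by rewrite (le_trans (hq x)) // ler_wpM2l // ler_weXn2l ?one_le_wtD ?leq_addl.
Qed.

Lemma polygrowthM p q : polygrowth p -> polygrowth q -> polygrowth (fun x => p x * q x).
Proof.
move=> [B [k hp]] [B' [k' hq]]; exists (B * B'), (k + k')%N => x.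
by rewrite cmodM exprD mulrACA ler_pM ?cmod_ge0.
Qed.

Lemma gau_decay p al w : 0 < complex.Re al -> polygrowth p ->
  exists K, decay (fun x => p x * gau al w x) K.
Proof.
move=> hal [B [k hp]]; have [K K0 hK] := gau_bound (cmod w) k.+1 hal.
exists (B * K) => x; rewrite cmodM.
have B0 : 0 <= B by have := hp 0; rewrite expr0n addr0 expr1n mulr1; exact: le_trans (cmod_ge0 _).
have h := ler_wpM2r (mulr_ge0 (cmod_ge0 (gau al w x)) (ltW (wtD_gt0 x))) (hp x).
rewrite -mulrA (le_trans h) //.
have -> : B * (1 + x ^+ 2) ^+ k * (cmod (gau al w x) * (1 + x ^+ 2)) =
    B * (cmod (gau al w x) * (1 + x ^+ 2) ^+ k.+1) by rewrite (exprSr _ k); ring.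
by rewrite ler_wpM2l // hK.
Qed.

Lemma gau_decay0 al w : 0 < complex.Re al -> exists K, decay (gau al w) K.
Proof.
move=> hal; have [K hK] := gau_decay w hal (polygrowth_cst 1).
by exists K => x; have := hK x; rewrite mul1r.
Qed.

(** The logarithmic derivative of [gau al w] in x. *)
Definition lin al w x : C := - 2%:R * pi%:C * al * x%:C + 2%:R * pi%:C * 'i%C * w.

Lemma polygrowth_lin al w : polygrowth (lin al w).
Proof.
apply: polygrowthD; last exact: polygrowth_cst.
by apply: polygrowthM; [exact: polygrowth_cst|exact: polygrowth_x].
Qed.

Lemma cder_x x : cder x (fun t => t%:C) 1.
Proof. exact: cder_real (rder_id x). Qed.

Lemma cder_lin al w x : cder x (lin al w) (- 2%:R * pi%:C * al).
Proof.
apply: cder_eq (cderD (cderZ _ (cder_x x)) (cder_cst x _)) _.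
by rewrite mulr1 addr0.
Qed.

Lemma cder_polygau p dp al w x : cder x p dp ->
  cder x (fun x => p x * gau al w x) ((dp + p x * lin al w x) * gau al w x).
Proof. by move=> hp; apply: cder_eq (cderM hp (cder_gau_x al w x)) _; rewrite /lin; ring. Qed.

Lemma gau_mean al w : 0 < complex.Re al -> exists m, ismean (per (gau al w)) m.
Proof.
move=> hal; have [K hK] := gau_decay0 w hal.
have [K1 hK1] := gau_decay w hal (polygrowth_lin al w).
exact: per_mean (cder_gau_x al w) hK hK1.
Qed.

(** Integration by parts: the function periodized here is the derivative of p times the Gaussian. *)
Lemma polygau_deriv_mean p dp ddp al w : 0 < complex.Re al ->
  (forall x, cder x p (dp x)) -> (forall x, cder x dp (ddp x)) ->
  polygrowth p -> polygrowth dp -> polygrowth ddp ->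
  ismean (per (fun x => (dp x + p x * lin al w x) * gau al w x)) 0.
Proof.
move=> hal d1 d2 gp gdp gddp; have gl := polygrowth_lin al w.
have g1 : polygrowth (fun x => dp x + p x * lin al w x).
  exact: polygrowthD gdp (polygrowthM gp gl).
have [K hK] := gau_decay w hal gp; have [K1 hK1] := gau_decay w hal g1.
pose q x : C := ddp x + (dp x * lin al w x + p x * (- 2%:R * pi%:C * al)).
have hq x : cder x (fun x => dp x + p x * lin al w x) (q x).
  exact: cderD (d2 x) (cderM (d1 x) (cder_lin al w x)).
have gq : polygrowth q.
  apply: polygrowthD gddp (polygrowthD (polygrowthM gdp gl) (polygrowthM gp _)).
  exact: polygrowth_cst.
have [K2 hK2] := gau_decay w hal (polygrowthD gq (polygrowthM g1 gl)).
apply: per_deriv_mean hK hK1 hK2 => x.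
  exact: cder_polygau.
exact: cder_polygau (hq x).
Qed.

End Jacobi.

(** * Fourier transform of the Gaussian and Jacobi's identity *)

Section JacobiFormula.
Variable R : realType.
Local Notation C := R[i].
Implicit Types (al w z : C) (x t s h : R).

(** Differentiation under the mean: the second t-derivative is dominated near t0 by a summable
    weight, so the quadratic remainder of the periodization is uniform in s. *)
Lemma param_mean (f f1 f2 : R -> R -> C) (c : R -> C) t0 m1 K :
  (forall t, exists K0, decay (f t) K0) -> (exists K1, decay (f1 t0) K1) ->
  (forall x t, cder t (f^~ x) (f1 t x)) -> (forall x t, cder t (f1^~ x) (f2 t x)) ->
  (forall t x, `|t - t0| <= 1 -> cmod (f2 t x) <= K * wt x) ->
  (forall t, ismean (per (f t)) (c t)) -> ismean (per (f1 t0)) m1 -> cder t0 c m1.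
Proof.
move=> D0 [K1 D1] d1 d2 hK hc hm1.
have K0 : 0 <= K.
  have := hK t0 0; rewrite subrr normr0 ler01 /wt expr0n addr0 invr1 mulr1.
  by move=> /(_ isT); exact: le_trans (cmod_ge0 _).
apply: (@quad_cder _ _ _ _ (2 * K * (16 * (1 + 1 ^+ 2))) 1) => // h hh.
have hm := ismeanB (ismeanB (hc (t0 + h)) (hc t0)) (ismeanZ h%:C hm1).
have [Ka Da] := D0 (t0 + h); have [Kb Db] := D0 t0.
rewrite mulrAC; apply: (ismean_le hm) => s /andP[s0 s1].
have s1' : `|s| <= 1 by rewrite ger0_norm.
apply: csum_quad (asum_per _ Da) (asum_per _ Db) (asum_per _ D1) (wsum_wt_shift s1') _ _.
  by rewrite mulr_ge0 ?sqr_ge0 // mulr_ge0.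
move=> n; set x := s + n%:~R.
apply: le_trans (@taylor2 _ (f^~ x) (f1^~ x) (f2^~ x) t0 h (K * wt x) (d1 x) (d2 x) _) _.
  by move=> t ht; apply: hK; rewrite (le_trans ht).
by rewrite le_eqVlt; apply/orP; left; apply/eqP; ring.
Qed.

(* The integral of exp(-pi al x^2) over the real line. *)
Definition gmean al : C := xget 0 [set m | ismean (per (gau al 0)) m].

Lemma gmeanP al : 0 < complex.Re al -> ismean (per (gau al 0)) (gmean al).
Proof. by move=> hal; have [m hm] := gau_mean 0 hal; exact: (@xgetPex _ 0 _ (ex_intro _ m hm)). Qed.

Lemma Re_gt0_neq0 al : 0 < complex.Re al -> al != 0.
Proof. by move=> h; apply/eqP => e; rewrite e ltxx in h. Qed.

Lemma lin_gau_mean al w : 0 < complex.Re al ->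
  ismean (per (fun x => lin al w x * gau al w x)) 0.
Proof.
move=> hal; have g1 := @polygrowth_cst R 1; have g0 := @polygrowth_cst R 0.
have := polygau_deriv_mean w hal (fun x => cder_cst x 1) (fun x => cder_cst x 0) g1 g0 g0.
by under [X in per X]eq_fun do rewrite add0r mul1r.
Qed.

Lemma cmod2 : cmod (2%:R : C) = 2.
Proof. by rewrite -(rmorph_nat (real_complex R)) cmodR ger0_norm. Qed.

Lemma cmodpi : cmod (pi%:C : C) = pi.
Proof. by rewrite cmodR ger0_norm // pi_ge0. Qed.

Lemma pi_neq0 : pi%:C != 0 :> C.
Proof. by apply/eqP => -[h]; have := @pi_gt0 R; rewrite h ltxx. Qed.

Lemma sqr_le_wtD x : `|x| ^+ 2 <= 1 + x ^+ 2.
Proof. by rewrite real_normK ?num_real // lerDr. Qed.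

(** An ODE along t w: differentiation brings down 2 pi i x w, and integration by parts trades the
    factor x for a multiple of w. *)
Lemma gau_mean_w al w : 0 < complex.Re al ->
  ismean (per (gau al w)) (gmean al * expc (- (pi%:C * w ^+ 2 / al))).
Proof.
move=> hal; have al0 := Re_gt0_neq0 hal.
have /choice [c hc] : forall w, exists m, ismean (per (gau al w)) m.
  by move=> w'; exact: gau_mean.
pose f (t x : R) := gau al (t%:C * w) x.
pose q (x : R) := 2%:R * pi%:C * 'i%C * x%:C * w.
have gq : polygrowth q.
  apply: polygrowthM (polygrowth_cst w).
  exact: polygrowthM (polygrowth_cst _) (@polygrowth_x R).
have hder x t : cder t (f^~ x) (q x * f t x).
  by have := cder_gau_w al 0 w x t; rewrite add0r; under eq_fun do rewrite add0r.
have hder2 x t : cder t (fun t => q x * f t x) (q x * (q x * f t x)).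
  exact: cderZ (hder x t).
have hmean t : cder t (fun t => c (t%:C * w))
    (- (2%:R * pi%:C * t%:C * w ^+ 2 / al) * c (t%:C * w)).
  have [K K0 hK] := gau_bound ((`|t| + 1) * cmod w) 2 hal.
  pose B := (2 * pi * cmod w) ^+ 2.
  apply: (@param_mean f (fun t x => q x * f t x) (fun t x => q x * (q x * f t x)) _ _ _ (B * K)) => //.
  - by move=> t'; exact: gau_decay0.
  - exact: gau_decay.
  - move=> t' x ht'.
    have hw : cmod (t'%:C * w) <= (`|t| + 1) * cmod w.
      rewrite cmodM cmodR ler_wpM2r ?cmod_ge0 //.
      by rewrite -(subrK t t') addrC (le_trans (ler_normD _ _)) // lerD2l.
    have h := hK al _ x (lexx _) hw.
    rewrite !cmodM cmod2 cmodpi cmodi cmodR mulr1 /wt ler_pdivlMr ?wtD_gt0 //.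
    have -> : 2 * pi * `|x| * cmod w * (2 * pi * `|x| * cmod w * cmod (f t' x)) * (1 + x ^+ 2) =
      B * (cmod (f t' x) * (`|x| ^+ 2 * (1 + x ^+ 2))) by rewrite /B; ring.
    rewrite ler_wpM2l ?sqr_ge0 // (le_trans _ h) // ler_wpM2l ?cmod_ge0 //.
    by rewrite [leRHS]expr2 ler_wpM2r ?sqr_le_wtD // ltW // wtD_gt0.
  - move=> t'; exact: hc.
  set w' := t%:C * w.
  have [Kg Dg] := gau_decay0 w' hal.
  have [Kl Dl] := gau_decay w' hal (polygrowth_lin al w').
  (* 2 pi al x equals 2 pi i w' minus [lin al w'] at x, and the [lin] part has mean zero. *)
  have := ismeanZ (2%:R * pi%:C * 'i%C * w / (2%:R * pi%:C * al))
    (ismeanB (ismeanZ (2%:R * pi%:C * 'i%C * w') (hc w')) (lin_gau_mean w' hal)).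
  congr ismean.
    apply/funext => s; rewrite -(perZ _ _ Dg) -[- _]mulN1r -(perZ _ _ Dl).
    rewrite -(perD _ (decayZ _ Dg) (decayZ _ Dl)).
    rewrite -(perZ _ _ (K := cmod (2%:R * pi%:C * 'i%C * w') * Kg + cmod (-1 : C) * Kl)).
      congr per; apply/funext => x; rewrite /q /lin /f -/w'.
      have := pi_neq0; set P := pi%:C; clearbody P => P0; by field; rewrite al0 P0.
    move=> x; have h1 := decayZ (2%:R * pi%:C * 'i%C * w') Dg x.
    have h2 := decayZ (-1) Dl x.
    apply: le_trans (lerD h1 h2); rewrite -mulrDl ler_wpM2r ?(ltW (wtD_gt0 x)) //.
    exact: cmodD.
  rewrite subr0 /w'.
  have i2 : ('i%C : C) * 'i%C = -1 by rewrite -expr2 sqr_i.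
  transitivity (('i%C * 'i%C) * (2%:R * pi%:C * t%:C * w ^+ 2 / al) * c (t%:C * w)).
    have := pi_neq0; set P := pi%:C; clearbody P => P0; by field; rewrite al0 P0.
  by rewrite i2; ring.
(* The integrating factor of the ODE makes F constant; comparing t = 1 with t = 0 gives the
   formula. *)
pose F t := c (t%:C * w) * expc ((t ^+ 2)%:C * (pi%:C * w ^+ 2 / al)).
have hF t : cder t F 0.
  have dt2 : cder t (fun t => (t ^+ 2)%:C) (2%:R * t%:C).
    have := cderM (cder_x t) (cder_x t); rewrite mul1r mulr1 -mulr2n mulr_natl.
    by congr cder; apply/funext => u; rewrite -rmorphM.
  have de := cder_expc (cderM dt2 (cder_cst t (pi%:C * w ^+ 2 / al))).
  by apply: cder_eq (cderM (hmean t) de) _; ring.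
have := cder_cst_eq 1 0 hF; rewrite /F mul0r expr0n /= mul0r expc0 mulr1 expr1n !mul1r.
move=> h; have := hc w; congr ismean.
have -> : gmean al = c 0 by apply: ismean_uniq (gmeanP hal) (hc 0).
by rewrite -h -mulrA -expcD addrN expc0 mulr1.
Qed.

(** Fourier inversion at 0 for the periodized Gaussian. Its k-th coefficient is the mean with w
    replaced by w - k, because the character is 1 on integer shifts. *)
Lemma jacobi al w : 0 < complex.Re al ->
  hassum (fun k : int => gmean al * expc (- (pi%:C * (w - k%:~R) ^+ 2 / al)))
    (csum (fun n : int => gau al w n%:~R)).
Proof.
move=> hal; have [K0 D0] := gau_decay0 w hal.
have gl := polygrowth_lin al w.
have [K1 D1] := gau_decay w hal gl.
have [K2 D2] := gau_decay w hal (polygrowthD (polygrowth_cst (- 2%:R * pi%:C * al)) (polygrowthM gl gl)).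
have d1 := cder_gau_x al w.
have d2 x : cder x (fun x => lin al w x * gau al w x)
    ((- 2%:R * pi%:C * al + lin al w x * lin al w x) * gau al w x).
  exact: cder_polygau (cder_lin al w x).
pose A := 16 * (1 + 1 ^+ 2) : R.
have itv s : 0 <= s <= 1 -> `|s| <= 1 by move=> /andP[s0 s1]; rewrite ger0_norm.
have -> : csum (fun n : int => gau al w n%:~R) = per (gau al w) 0.
  by congr csum; apply/funext => n; rewrite add0r.
pose KK := K0 * A + 2 * (8 * K2 * A).
have A0 : 0 <= A by rewrite /A; lra.
have KA0 : 0 <= K0 * A by rewrite mulr_ge0 // (decay_ge0 D0).
have KA2 : 0 <= 8 * K2 * A by rewrite mulr_ge0 // mulr_ge0 // (decay_ge0 D2).
apply: (@fourier_inversion _ _ KK) => [s|s hs|s h hs hh|k].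
- exact: per_periodic D0.
- by rewrite (le_trans (per_le D0 (itv _ hs))) // lerDl mulr_ge0.
- have h1 := per_taylor d1 d2 D0 D1 D2 (itv _ hs) hh.
  have hh' : `|- h| <= 1 by rewrite normrN.
  have h2 := per_taylor d1 d2 D0 D1 D2 (itv _ hs) hh'.
  rewrite sqrrN in h2.
  have -> : per (gau al w) (s + h) + per (gau al w) (s - h) - 2%:R * per (gau al w) s =
    (per (gau al w) (s + h) - per (gau al w) s -
      h%:C * per (fun x => lin al w x * gau al w x) s) +
    (per (gau al w) (s + - h) - per (gau al w) s -
      (- h)%:C * per (fun x => lin al w x * gau al w x) s) by rewrite rmorphN /=; ring.
  apply: le_trans (cmodD _ _) _; apply: le_trans (lerD h1 h2) _.
  rewrite -mulrDl ler_wpM2r ?sqr_ge0 // /KK -/A; lra.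
have := gau_mean_w (w - k%:~R) hal; congr ismean; apply/funext => s.
rewrite mulrC -(perZ _ _ D0); congr csum; apply/funext => n.
rewrite mulrC -(rmorph_int (real_complex R)) -gau_sub; congr (_ * _).
have kn : eipi2 (- ((k%:~R : R)%:C * (n%:~R : R)%:C)) = 1.
  by rewrite !rmorph_int -intrM -rmorphN eipi2_int.
by rewrite rmorphD mulrDr opprD eipi2D /= kn mulr1.
Qed.

End JacobiFormula.

(** * The constant in Jacobi's identity *)

Section JacobiConstant.
Variable R : realType.
Local Notation C := R[i].
Implicit Types (al w z : C) (x t s h a : R).

Lemma cmod_expc_le z : cmod (expc z) <= expR (cmod z).
Proof. by rewrite cmod_expc ler_expR (le_trans (ler_norm _)) // cmod_Re. Qed.

Lemma Re_expc z : complex.Re (expc z) = expR (complex.Re z) * cos (complex.Im z).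
Proof. by []. Qed.

Lemma cos_ge_cos_norm x y : `|x| <= `|y| -> `|y| <= pi -> cos y <= cos x.
Proof.
move=> xy yp; rewrite -(cos_norm x) -(cos_norm y); move: xy.
rewrite le_eqVlt => /predU1P[->//|xy]; rewrite ltW // ltr_cos // in_itv /= normr_ge0 //=.
by rewrite (le_trans (ltW xy)).
Qed.

(* The substitution [t -> sin t] keeps the path [expc (sin t * z)] inside the
   half-plane [Re > 0] for every real [t]. *)
Lemma gmean_expc_const z : `|complex.Im z| < pi / 2 ->
  gmean (expc z) * expc (z / 2%:R) = gmean 1.
Proof.
move=> hz; have p0 := @pi_gt0 R.
pose al t := expc ((sin t)%:C * z).
pose a1 t := (cos t)%:C * z.
(* A lower bound for Re (al t) valid for all t, as the domination in [param_mean] needs. *)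
pose c0 := expR (- `|complex.Re z|) * cos (complex.Im z).
have cz : 0 < cos (complex.Im z).
  apply: cos_gt0_pihalf; move: hz; rewrite ltr_norml => /andP[h1 h2]; apply/andP; split; lra.
have c00 : 0 < c0 by rewrite mulr_gt0 ?expR_gt0.
have hal t : c0 <= complex.Re (al t).
  rewrite Re_expc Re_scale Im_scale /c0 ler_pM ?expR_ge0 ?(ltW cz) // ?ler_expR.
    rewrite lerNl (le_trans (ler_norm _)) // normrN normrM -[leRHS]mul1r.
    by rewrite ler_wpM2r // sin_max.
  apply: cos_ge_cos_norm; last by lra.
  by rewrite normrM -[leRHS]mul1r ler_wpM2r // sin_max.
have hal0 t : 0 < complex.Re (al t) := lt_le_trans c00 (hal t).
have dal t : cder t al (a1 t * al t).
  have ds := cder_real (is_derive_sin t).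
  by apply: cder_expc; apply: cder_eq (cderM ds (cder_cst t z)) _; rewrite mulr0 addr0.
pose b1 t := (- sin t)%:C * z.
have da1 t : cder t a1 (b1 t).
  have ds := cder_real (is_derive_cos t).
  by apply: cder_eq (cderM ds (cder_cst t z)) _; rewrite mulr0 addr0.
pose f t x := gau (al t) 0 x.
pose d x t := - pi%:C * (x ^+ 2)%:C * (a1 t * al t).
pose d' x t := - pi%:C * (x ^+ 2)%:C * (b1 t * al t + a1 t * (a1 t * al t)).
have df x t : cder t (f^~ x) (d x t * f t x).
  apply: cder_expc.
  have h1 := cderM (cderZ (- pi%:C) (dal t)) (cder_cst t (x ^+ 2)%:C).
  apply: cder_eq (cderD h1 (cder_cst t (2%:R * pi%:C * 'i%C * x%:C * 0))) _.
  by rewrite /d; ring.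
have dd x t : cder t (d x) (d' x t).
  exact: cderZ (cderM (da1 t) (dal t)).
pose E := expR (cmod z); have E0 : 0 <= E by exact: expR_ge0.
have Z0 := cmod_ge0 z.
have bal t : cmod (al t) <= E.
  rewrite (le_trans (cmod_expc_le _)) // ler_expR cmodM cmodR -[leRHS]mul1r.
  by rewrite ler_wpM2r // sin_max.
have ba1 t : cmod (a1 t) <= cmod z.
  by rewrite cmodM cmodR -[leRHS]mul1r ler_wpM2r // cos_max.
have bb1 t : cmod (b1 t) <= cmod z.
  by rewrite cmodM cmodR normrN -[leRHS]mul1r ler_wpM2r // sin_max.
have P0 : 0 <= pi * (cmod z * E + cmod z * (cmod z * E)).
  by rewrite mulr_ge0 ?(ltW p0) // addr_ge0 // !mulr_ge0.
have [K K0 hK] := gau_bound 0 3 c00.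
pose B := pi * (cmod z * E + cmod z * (cmod z * E)) + (pi * (cmod z * E)) ^+ 2.
have B0 : 0 <= B by exact: addr_ge0 P0 (sqr_ge0 _).
have hmean t : cder t (fun t => gmean (al t)) (- a1 t / 2%:R * gmean (al t)).
  have alt0 := Re_gt0_neq0 (hal0 t).
  have gx := @polygrowth_x R.
  have gx2 := polygrowthM gx gx.
  apply: (@param_mean _ f (fun t x => d x t * f t x)
    (fun t x => d' x t * f t x + d x t * (d x t * f t x)) _ _ _ (B * K)) => //.
  - by move=> t'; exact: gau_decay0.
  - apply: gau_decay => //.
    apply: polygrowthM (polygrowth_cst _); apply: polygrowthM (polygrowth_cst _) _.
    by move: gx2; congr polygrowth; apply/funext => x; rewrite -rmorphM.
  - by move=> x t'; apply: cderM (dd x t') (df x t').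
  - move=> t' x _; rewrite mulrA -mulrDl cmodM.
    have h := hK (al t') 0 x (hal t') _; rewrite cmod0 in h; have {h} := h (lexx _).
    set g := cmod _ => h; have g0 : 0 <= g := cmod_ge0 _.
    have w1 := one_le_wtD x; have x2 := sqr_ge0 x.
    have hd : cmod (d x t') <= pi * (cmod z * E) * (1 + x ^+ 2).
      have hY : cmod (a1 t' * al t') <= cmod z * E by rewrite cmodM ler_pM ?cmod_ge0.
      rewrite /d cmodM [cmod (- _ * _)]cmodM cmodN cmodpi cmodR [`|x ^+ 2|]ger0_norm // mulrAC.
      apply: ler_pM => //; [by rewrite mulr_ge0 ?cmod_ge0 ?(ltW p0)|by rewrite ler_pM2l|lra].
    have hd' : cmod (d' x t') <= pi * (cmod z * E + cmod z * (cmod z * E)) * (1 + x ^+ 2).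
      have hY : cmod (b1 t' * al t' + a1 t' * (a1 t' * al t')) <=
          cmod z * E + cmod z * (cmod z * E).
        apply: le_trans (cmodD _ _) _; apply: lerD; first by rewrite cmodM ler_pM ?cmod_ge0.
        rewrite cmodM; apply: ler_pM; rewrite ?cmod_ge0 //.
        by rewrite cmodM ler_pM ?cmod_ge0.
      rewrite /d' cmodM [cmod (- _ * _)]cmodM cmodN cmodpi cmodR [`|x ^+ 2|]ger0_norm // mulrAC.
      apply: ler_pM => //; [by rewrite mulr_ge0 ?cmod_ge0 ?(ltW p0)|by rewrite ler_pM2l|lra].
    have hq : cmod (d' x t' + d x t' * d x t') <= B * (1 + x ^+ 2) ^+ 2.
      apply: le_trans (cmodD _ _) _; rewrite [X in _ + X]cmodM /B mulrDl; apply: lerD.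
        apply: (le_trans hd'); rewrite ler_wpM2l // expr2 ler_peMl //.
        by rewrite (le_trans ler01).
      by rewrite -exprMn expr2 ler_pM ?cmod_ge0.
    rewrite /wt ler_pdivlMr ?wtD_gt0 //.
    apply: (@le_trans _ _ (B * (1 + x ^+ 2) ^+ 2 * g * (1 + x ^+ 2))).
      by rewrite ler_wpM2r ?(ltW (wtD_gt0 x)) // ler_wpM2r.
    have -> : B * (1 + x ^+ 2) ^+ 2 * g * (1 + x ^+ 2) = B * (g * (1 + x ^+ 2) ^+ 3).
      by rewrite (exprSr _ 2); ring.
    by rewrite ler_wpM2l.
  - move=> t'; exact: gmeanP.
  have [Kg Dg] := gau_decay0 0 (hal0 t).
  pose q x := 1 + x%:C * lin (al t) 0 x.
  have gq : polygrowth q.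
    exact: polygrowthD (polygrowth_cst 1) (polygrowthM gx (polygrowth_lin _ _)).
  have [Kl Dl] := gau_decay 0 (hal0 t) gq.
  have g1 := @polygrowth_cst R 1; have g0 := @polygrowth_cst R 0.
  (* Integration by parts with p = x yields the second moment: at w = 0, x times [lin] is - 2 pi al
     x^2. *)
  have hx := polygau_deriv_mean 0 (hal0 t) (@cder_x R) (fun x => cder_cst x 1) gx g1 g0.
  have := ismeanZ (- a1 t / 2%:R) (ismeanB (gmeanP (hal0 t)) hx).
  rewrite subr0; congr ismean.
  apply/funext => s.
  transitivity (- a1 t / 2%:R * (per (gau (al t) 0) s + (-1) * per (fun x => q x * gau (al t) 0 x) s)).
    by rewrite mulN1r.
  rewrite -(perZ _ _ Dl).
  rewrite -(perD _ Dg (decayZ _ Dl)).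
  rewrite -(perZ _ _ (K := Kg + cmod (-1 : C) * Kl)).
    congr per; apply/funext => x; rewrite /q /lin /d /f rmorphXn /=.
    set P := pi%:C; clearbody P; set I := 'i%C; clearbody I; set A := al t; clearbody A.
    by field.
  move=> x; apply: le_trans (lerD (Dg x) (decayZ (-1) Dl x)); rewrite -mulrDl.
  by rewrite ler_wpM2r ?(ltW (wtD_gt0 x)) // cmodD.
pose F t := gmean (al t) * expc ((sin t)%:C * z / 2%:R).
have hF t : cder t F 0.
  have ds := cder_real (is_derive_sin t).
  have de := cder_expc (cderM (cderM ds (cder_cst t z)) (cder_cst t (2%:R^-1))).
  by apply: cder_eq (cderM (hmean t) de) _; rewrite /a1; ring.
have := cder_cst_eq (pi / 2) 0 hF.
by rewrite /F /al sin_pihalf sin0 !mul1r !mul0r expc0 mulr1.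
Qed.

(* The Jacobi identity at al = 1, w = 0 reads S = gmean 1 * S with S > 0. *)
Lemma gmean1 : gmean 1 = 1 :> C.
Proof.
have h1 : 0 < complex.Re (1 : C) by rewrite /= ltr01.
have h := hassum_csum (jacobi 0 h1); set S := csum (fun n : int => gau _ _ _) in h.
have e (n : int) : expc (- (pi%:C * (0 - n%:~R) ^+ 2 / 1)) = gau 1 0 n%:~R :> C.
  by rewrite /gau rmorphXn /= rmorph_int divr1; congr expc; ring.
have [K DK] := gau_decay0 0 h1.
have aS : asum (fun n : int => gau (1 : C) 0 n%:~R).
  by have := asum_per 0 DK; congr asum; apply/funext => n; rewrite add0r.
have h2 : gmean 1 * S = S.
  rewrite -{2}h -csumZ //; congr csum; apply/funext => n; by rewrite e.
suff S0 : S != 0 by apply: (mulIf S0); rewrite mul1r.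
(* If S were 0, some finite partial sum containing n = 0 would be at most 1/2, but that term equals
   1 and all terms are positive. *)
apply/eqP => S0; have hS := asum_csum aS; rewrite -/S S0 in hS.
have [A hA] := hS (1 / 2) ltac:(lra).
have := hA (undup (0 :: A)) (undup_uniq _) ltac:(by move=> t tA; rewrite mem_undup in_cons tA orbT).
rewrite sub0r cmodN; apply/negP; rewrite -ltNge.
have gr (n : int) : gau (1 : C) 0 n%:~R = (expR (- pi * n%:~R ^+ 2))%:C.
  by rewrite /gau mulr0 addr0 mulr1 -expc_real; congr expc; ring.
under eq_bigr do rewrite gr; rewrite -rmorph_sum cmodR.
rewrite ger0_norm; last by apply: sumr_ge0 => n _; exact: expR_ge0.
rewrite (bigD1_seq 0) ?undup_uniq ?mem_undup ?mem_head //=.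
rewrite expr0n /= mulr0 expR0; have : 0 <= \sum_(i <- undup (0 :: A) | i != 0) expR (- pi * i%:~R ^+ 2) :> R.
  by apply: sumr_ge0 => n _; exact: expR_ge0.
rewrite /=; lra.
Qed.

Lemma gmean_expc z : `|complex.Im z| < pi / 2 -> gmean (expc z) = expc (- (z / 2%:R)).
Proof.
move=> /gmean_expc_const h; apply: (mulIf (expc_neq0 (z / 2%:R))).
by rewrite h gmean1 -expcD addNr expc0.
Qed.

(** The principal logarithm on the right half-plane, with argument atan (b / a). *)
Lemma polar_right al : 0 < complex.Re al ->
  exists2 z, `|complex.Im z| < pi / 2 & al = expc z.
Proof.
case: al => a b /= a0; pose q := b / a.
have hs : 0 < Num.sqrt (1 + q ^+ 2) by rewrite sqrtr_gt0 wtD_gt0.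
exists (ln (a * Num.sqrt (1 + q ^+ 2)) +i* atan q) => /=.
  by rewrite ltr_norml atan_gtNpi2 atan_ltpi2.
have ct := cos_atan q; have c0 : cos (atan q) != 0 by rewrite ct invr_neq0 // gt_eqF.
rewrite /expc /= lnK; last by rewrite posrE mulr_gt0.
have st : sin (atan q) = q * cos (atan q) by have := atanK q; rewrite /tan => h; rewrite -[X in X * _]h divfK.
rewrite st ct; apply/eqP; rewrite eq_complex /=; apply/andP; split; apply/eqP.
  by field; rewrite gt_eqF.
by rewrite /q; field; rewrite !gt_eqF.
Qed.

(** The logarithms of al and r^2 / al add up to 2 ln r. *)
Lemma gmean_pair al (r : R) : 0 < complex.Re al -> 0 < r ->
  gmean al * gmean ((r ^+ 2)%:C / al) = (r^-1)%:C.
Proof.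
move=> /polar_right [z hz ->] r0.
have -> : (r ^+ 2)%:C / expc z = expc ((ln r *+ 2)%:C - z).
  by rewrite expcD expcN expc_real -[ln r *+ 2]mulr_natl expRM_natl lnK.
rewrite !gmean_expc //; last by rewrite Im_add Im_opp /= sub0r normrN.
rewrite -expcD.
have -> : - (z / 2%:R) + - (((ln r *+ 2)%:C - z) / 2%:R) = (- ln r)%:C.
  by rewrite rmorphMn rmorphN /= -mulr_natl; field.
by rewrite expc_real expRN lnK.
Qed.

Lemma Re_inv_gt0 al : 0 < complex.Re al -> 0 < complex.Re al^-1.
Proof.
case: al => a b /= a0; rewrite divr_gt0 //.
by rewrite ltr_pwDl ?exprn_gt0 // sqr_ge0.
Qed.

Lemma sqr_imag : 'i%C * 'i%C = -1 :> C.
Proof. by rewrite -expr2 sqr_i. Qed.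

Lemma dual_gau al w (x : R) : al != 0 ->
  expc (- (pi%:C * (w - x%:C) ^+ 2 / al)) =
  expc (- (pi%:C * w ^+ 2 / al)) * gau al^-1 (- 'i%C * w / al) x.
Proof.
move=> al0; rewrite /gau -expcD; congr expc; rewrite rmorphXn /=.
set P := pi%:C; clearbody P.
(* [field] treats i as an indeterminate, so the identity is corrected by a multiple of i^2 + 1; the
   same device recurs below. *)
transitivity (- (P * w ^+ 2 / al) + (- P / al * x%:C ^+ 2 + 2%:R * P * 'i%C * x%:C * (- 'i%C * w / al))
   + ('i%C * 'i%C + 1) * (2%:R * P * x%:C * w / al)); last by rewrite sqr_imag addNr mul0r addr0.
by field.
Qed.

Lemma asum_dual al w : 0 < complex.Re al ->
  asum (fun k : int => expc (- (pi%:C * (w - k%:~R) ^+ 2 / al))).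
Proof.
move=> hal; have [K D] := gau_decay0 (- 'i%C * w / al) (Re_inv_gt0 hal).
have := asumZ (expc (- (pi%:C * w ^+ 2 / al))) (asum_per 0 D).
congr asum; apply/funext => n.
by rewrite add0r -dual_gau ?rmorph_int ?Re_gt0_neq0.
Qed.

(** Translation by a amounts to replacing w by w + i al a, up to a factor exp S common to both
    sides. *)
Lemma jacobi_shift al w a : 0 < complex.Re al ->
  csum (fun n : int => gau al w (a + n%:~R)) =
  gmean al * csum (fun k : int =>
    expc (- (pi%:C * (k%:~R - w) ^+ 2 / al) + 2%:R * pi%:C * 'i%C * a%:C * k%:~R)).
Proof.
move=> hal; have al0 := Re_gt0_neq0 hal.
pose w' := w + 'i%C * al * a%:C.
pose S := - pi%:C * al * (a ^+ 2)%:C + 2%:R * pi%:C * 'i%C * a%:C * w.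
have eL (n : int) : gau al w (a + n%:~R) = expc S * gau al w' n%:~R.
  rewrite /gau -expcD; congr expc; rewrite /S /w' !rmorphXn rmorphD /= !rmorph_int.
  apply/(addIr (- (('i%C * 'i%C + 1) * (2%:R * pi%:C * n%:~R * al * a%:C)))).
  by rewrite [in LHS]sqr_imag addNr mul0r oppr0 addr0; ring.
have eR (k : int) : expc (- (pi%:C * (k%:~R - w) ^+ 2 / al) + 2%:R * pi%:C * 'i%C * a%:C * k%:~R) =
    expc S * expc (- (pi%:C * (w' - k%:~R) ^+ 2 / al)).
  rewrite -expcD; congr expc; rewrite /S /w' rmorphXn /=.
  apply/(addIr (('i%C * 'i%C + 1) * (pi%:C * al * a%:C ^+ 2))).
  rewrite [in LHS]sqr_imag addNr mul0r addr0.
  by set P := pi%:C; clearbody P; field.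
under eq_fun do rewrite eL; under [X in _ * csum X]eq_fun do rewrite eR.
have [K D] := gau_decay0 w' hal.
have aL : asum (fun n : int => gau al w' n%:~R).
  by have := asum_per 0 D; congr asum; apply/funext => n; rewrite add0r.
have aR := asum_dual w' hal.
rewrite csumZ // -(hassum_csum (jacobi w' hal)) !csumZ //; ring.
Qed.

End JacobiConstant.

(** * Two-dimensional theta series *)

Section Profiles.
Variable R : realType.
Local Notation C := R[i].
Local Notation prof := (R -> R -> C).
Implicit Types (g dg : prof) (x y t h p q : R).

Definition rd g := forall k, exists K, forall x y,
  cmod (g x y) * (1 + x ^+ 2 + y ^+ 2) ^+ k <= K.

Definition pd p q g dg := forall x y, cder 0 (fun t => g (x + t * p) (y + t * q)) (dg x y).

(** Membership in some class stable under directional derivatives is a greatest fixed point, so no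
    tower of iterated derivatives has to be indexed. *)
Definition smooth_class (P : prof -> Prop) := forall g, P g ->
  rd g /\ forall p q, exists2 dg, P dg & pd p q g dg.

(* Rapid decay of the function and of all its iterated directional derivatives. *)
Definition sch g := exists2 P, smooth_class P & P g.

Lemma sch_rd g : sch g -> rd g.
Proof. by case=> P hP /hP []. Qed.

Lemma sch_pd g p q : sch g -> exists2 dg, sch dg & pd p q g dg.
Proof. by case=> P hP gP; have [_ /(_ p q) [dg h1 h2]] := hP g gP; exists dg => //; exists P. Qed.

Lemma pd_uniq p q g dg dg' : pd p q g dg -> pd p q g dg' -> dg = dg'.
Proof. by move=> h h'; apply/funext => x; apply/funext => y; apply: cder_uniq (h x y) (h' x y). Qed.

Lemma pd_line p q g dg x y t : pd p q g dg ->
  cder t (fun t => g (x + t * p) (y + t * q)) (dg (x + t * p) (y + t * q)).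
Proof.
move=> h; have ht : rder t (fun s => s - t) 1.
  by apply: rder_eq (rderD (rder_id t) (rder_cst t (- t))) _; rewrite addr0.
have h0 := h (x + t * p) (y + t * q); rewrite -{1}(subrr t) in h0.
have := cder_comp ht h0; rewrite mul1r; congr cder; apply/funext => s.
by rewrite -!addrA -!mulrDl [t + _]addrC subrK.
Qed.

Lemma pdN p q g dg : pd p q g dg -> pd (- p) (- q) g (fun x y => - dg x y).
Proof.
move=> h x y; have hN : rder (0 : R) (fun s => - s) (- 1) by exact: rderN (rder_id 0).
have h0 := h x y; rewrite -{1}oppr0 in h0.
have := cder_comp hN h0; rewrite rmorphN mulN1r; congr cder.
by apply/funext => s; rewrite !mulrN !mulNr.
Qed.

Lemma pdD p q g g' dg dg' : pd p q g dg -> pd p q g' dg' ->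
  pd p q (fun x y => g x y + g' x y) (fun x y => dg x y + dg' x y).
Proof. by move=> h h' x y; apply: cderD. Qed.

Lemma pdZ p q g dg c : pd p q g dg -> pd p q (fun x y => c * g x y) (fun x y => c * dg x y).
Proof. by move=> h x y; apply: cderZ. Qed.

Lemma pd_affine (u v w p q x y : R) :
  cder 0 (fun t => (u * (x + t * p) + v * (y + t * q) + w)%:C) (u * p + v * q)%:C.
Proof.
apply: cder_real.
have l (z r : R) : rder 0 (fun t => z + t * r) r.
  apply: rder_eq (rderD (rder_cst 0 z) (rderM (rder_id 0) (rder_cst 0 r))) _; ring.
have lu (s z r : R) : rder 0 (fun t => s * (z + t * r)) (s * r).
  apply: rder_eq (rderM (rder_cst 0 s) (l z r)) _; ring.
apply: rder_eq (rderD (rderD (lu u x p) (lu v y q)) (rder_cst 0 w)) _; ring.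
Qed.

Lemma pd_mul_linear (u v : R) p q g dg : pd p q g dg ->
  pd p q (fun x y => (u * x + v * y)%:C * g x y)
    (fun x y => (u * p + v * q)%:C * g x y + (u * x + v * y)%:C * dg x y).
Proof.
move=> h x y; have h1 := pd_affine u v 0 p q x y.
under [X in cder _ X _]eq_fun do rewrite -[_ * _ + _]addr0.
by apply: cder_eq (cderM h1 (h x y)) _; rewrite /= !mul0r !addr0.
Qed.

Lemma base_gt0 x y : 0 < 1 + x ^+ 2 + y ^+ 2.
Proof. by rewrite ltr_pwDl ?wtD_gt0 ?sqr_ge0. Qed.

Lemma base_ge1 x y : 1 <= 1 + x ^+ 2 + y ^+ 2.
Proof. by rewrite -addrA lerDl addr_ge0 ?sqr_ge0. Qed.

Lemma rdD g g' : rd g -> rd g' -> rd (fun x y => g x y + g' x y).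
Proof.
move=> h h' k; have [K hK] := h k; have [K' hK'] := h' k; exists (K + K') => x y.
apply: le_trans (lerD (hK x y) (hK' x y)); rewrite -mulrDl.
by rewrite ler_wpM2r ?cmodD // exprn_ge0 // ltW // base_gt0.
Qed.

Lemma rdZ g c : rd g -> rd (fun x y => c * g x y).
Proof.
move=> h k; have [K hK] := h k; exists (cmod c * K) => x y.
by rewrite cmodM -mulrA ler_wpM2l ?cmod_ge0.
Qed.

Lemma rd_mul_linear (u v : R) g : rd g -> rd (fun x y => (u * x + v * y)%:C * g x y).
Proof.
move=> h k; have [K hK] := h k.+1; exists ((`|u| + `|v|) * K) => x y.
have b0 := base_gt0 x y; have b1 := base_ge1 x y.
have x2 : `|x| ^+ 2 = x ^+ 2 by rewrite real_normK ?num_real.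
have y2 : `|y| ^+ 2 = y ^+ 2 by rewrite real_normK ?num_real.
have hx : `|x| <= 1 + x ^+ 2 + y ^+ 2 by have := sqr_ge0 y; have := sqr_ge0 (`|x| - 1); nra.
have hy : `|y| <= 1 + x ^+ 2 + y ^+ 2 by have := sqr_ge0 x; have := sqr_ge0 (`|y| - 1); nra.
rewrite cmodM cmodR.
apply: (@le_trans _ _ ((`|u| + `|v|) * (1 + x ^+ 2 + y ^+ 2) * cmod (g x y) * (1 + x ^+ 2 + y ^+ 2) ^+ k)).
  rewrite ler_wpM2r ?exprn_ge0 ?(ltW b0) // ler_wpM2r ?cmod_ge0 //.
  by rewrite (le_trans (ler_normD _ _)) // !normrM mulrDl lerD // ler_wpM2l.
have := ler_wpM2l (addr_ge0 (normr_ge0 u) (normr_ge0 v)) (hK x y).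
by rewrite exprS !mulrA [_ * cmod _ * (1 + _ + _)]mulrAC.
Qed.

Lemma rd_wt g : rd g -> exists2 K, 0 <= K & forall x y, cmod (g x y) <= K * (wt x * wt y).
Proof.
move=> h; have [K hK] := h 2; exists K.
  by apply: le_trans (hK 0 0); rewrite mulr_ge0 ?cmod_ge0 ?sqr_ge0.
move=> x y; rewrite /wt -invfM ler_pdivlMr ?mulr_gt0 ?wtD_gt0 //.
apply: le_trans (hK x y); rewrite ler_wpM2l ?cmod_ge0 //.
have := sqr_ge0 x; have := sqr_ge0 y; nra.
Qed.

Lemma wsum_wt2 A a1 a2 : `|a1| <= A -> `|a2| <= A ->
  wsum (R := R) (fun n : int * int => wt (a1 + n.1%:~R) * wt (a2 + n.2%:~R))
    (16 * (1 + A ^+ 2) * (16 * (1 + A ^+ 2))).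
Proof.
move=> h1 h2.
exact: (wsum_prod (fun n : int => wt_ge0 (a1 + n%:~R)) (fun n : int => wt_ge0 (a2 + n%:~R))
  (wsum_wt_shift h1) (wsum_wt_shift h2)).
Qed.

Lemma wsum_wt2' a1 a2 : exists M : R,
  wsum (R := R) (fun n : int * int => wt (a1 + n.1%:~R) * wt (a2 + n.2%:~R)) M.
Proof.
exists (16 * (1 + (`|a1| + `|a2|) ^+ 2) * (16 * (1 + (`|a1| + `|a2|) ^+ 2))).
by apply: wsum_wt2; rewrite ?lerDl ?lerDr.
Qed.

Definition chi x y b1 b2 : C := eipi2 (x * b1 - y * b2)%:C.

Lemma cmod_chi x y b1 b2 : cmod (chi x y b1 b2) = 1.
Proof. exact: cmod_eipi2_real. Qed.

Definition thterm g a1 a2 b1 b2 (n : int * int) : C :=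
  g (a1 + n.1%:~R) (a2 + n.2%:~R) * chi (a1 + n.1%:~R) (a2 + n.2%:~R) b1 b2.

Definition Th g a1 a2 b1 b2 : C := csum (thterm g a1 a2 b1 b2).

Lemma asum_thterm g a1 a2 b1 b2 : rd g -> asum (thterm g a1 a2 b1 b2).
Proof.
move=> /rd_wt [K K0 hK]; have [M hM] := wsum_wt2' a1 a2.
apply: (wsum_asum hM K0) => n; rewrite cmodM cmod_chi mulr1; exact: hK.
Qed.

Lemma ThD g g' a1 a2 b1 b2 : rd g -> rd g' ->
  Th (fun x y => g x y + g' x y) a1 a2 b1 b2 = Th g a1 a2 b1 b2 + Th g' a1 a2 b1 b2.
Proof.
move=> h h'; rewrite /Th -csumD; [|exact: asum_thterm..].
by congr csum; apply/funext => n; rewrite /thterm mulrDl.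
Qed.

Lemma ThZ g c a1 a2 b1 b2 : rd g ->
  Th (fun x y => c * g x y) a1 a2 b1 b2 = c * Th g a1 a2 b1 b2.
Proof.
move=> h; rewrite /Th -csumZ; last exact: asum_thterm.
by congr csum; apply/funext => n; rewrite /thterm mulrA.
Qed.

(** Locked, so that it stays an atom under simplification and for [ring]. *)
Definition twopii : C := locked (2%:R * pi%:C * 'i%C).

Lemma twopiiE : twopii = 2%:R * pi%:C * 'i%C.
Proof. by rewrite /twopii -lock. Qed.

Lemma cmod_twopii : cmod twopii = 2 * pi.
Proof. by rewrite twopiiE !cmodM cmod2 cmodpi cmodi mulr1. Qed.

Lemma cmod_twopiiM (z : C) : cmod (twopii * z) = 2 * pi * cmod z.
Proof. by rewrite cmodM cmod_twopii. Qed.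

Lemma cder_eipi2 (f : R -> R) df t : rder t f df ->
  cder t (fun s => eipi2 (f s)%:C) (twopii * df%:C * eipi2 (f t)%:C).
Proof.
move=> h; apply: cder_expc; apply: cder_eq (cderZ _ (cder_real h)) _.
by rewrite twopiiE rmorphM /= rmorph_nat.
Qed.

(** Moving b changes only the character, whose Taylor remainder is at most a constant times L^2 h^2;
    the rapid decay of g absorbs L^2. *)
Lemma Th_cder_b g a1 a2 b1 b2 p q : rd g ->
  cder 0 (fun h => Th g a1 a2 (b1 + h * p) (b2 + h * q))
    (Th (fun x y => twopii * ((p * x + - q * y)%:C * g x y)) a1 a2 b1 b2).
Proof.
move=> hg; pose L x y := p * x + - q * y.
have hXg := rd_mul_linear p (- q) hg.
have c20 : 0 <= 2 * (2 * pi) ^+ 2 :> R by rewrite mulr_ge0 ?sqr_ge0.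
have [K K0 hK] := rd_wt (rd_mul_linear p (- q) hXg).
have [M hM] := wsum_wt2' a1 a2.
apply: (@quad_cder _ _ _ _ (2 * (2 * pi) ^+ 2 * K * M) 1) => // h _.
rewrite !mul0r !addr0 add0r mulrAC.
apply: csum_quad (asum_thterm _ _ _ _ hg) (asum_thterm _ _ _ _ hg)
  (asum_thterm _ _ _ _ (rdZ _ hXg)) hM _ _.
  by rewrite mulr_ge0 ?sqr_ge0 // mulr_ge0.
move=> n; rewrite /thterm; set x := a1 + _; set y := a2 + _.
have chiE s : chi x y (b1 + s * p) (b2 + s * q) = chi x y b1 b2 * eipi2 (s * L x y)%:C.
  by rewrite /chi -eipi2D -rmorphD; congr (eipi2 _%:C); rewrite /L; ring.
rewrite chiE.
have d1 (t : R) : cder t (fun s => eipi2 (s * L x y)%:C)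
    (twopii * (L x y)%:C * eipi2 (t * L x y)%:C).
  apply: cder_eipi2; apply: rder_eq (rderM (rder_id t) (rder_cst t (L x y))) _.
  by rewrite mul1r mulr0 addr0.
have d2 (t : R) := cderZ (twopii * (L x y)%:C) (d1 t).
have ht : cmod (eipi2 (h * L x y)%:C - 1 - h%:C * (twopii * (L x y)%:C)) <=
    2 * (2 * pi * `|L x y|) ^+ 2 * h ^+ 2.
  have := @taylor2 _ _ _ _ 0 h ((2 * pi * `|L x y|) ^+ 2) d1 d2.
  rewrite add0r mul0r eipi2_0 mulr1; apply => t _.
  rewrite -!mulrA cmod_twopiiM cmodM cmod_twopiiM cmodM cmodR cmod_eipi2_real.
  by rewrite le_eqVlt; apply/orP; left; apply/eqP; ring.
have -> : g x y * (chi x y b1 b2 * eipi2 (h * L x y)%:C) - g x y * chi x y b1 b2 -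
   h%:C * (twopii * ((p * x + - q * y)%:C * g x y) * chi x y b1 b2) =
   g x y * chi x y b1 b2 * (eipi2 (h * L x y)%:C - 1 - h%:C * (twopii * (L x y)%:C)).
  by rewrite /L; ring.
rewrite !cmodM cmod_chi mulr1.
apply: (@le_trans _ _ (cmod (g x y) * (2 * (2 * pi * `|L x y|) ^+ 2 * h ^+ 2))).
  by rewrite ler_wpM2l ?cmod_ge0.
have := hK x y; rewrite !cmodM cmodR -/(L x y) => hk.
have -> : cmod (g x y) * (2 * (2 * pi * `|L x y|) ^+ 2 * h ^+ 2) =
  2 * (2 * pi) ^+ 2 * h ^+ 2 * (`|L x y| * (`|L x y| * cmod (g x y))) by ring.
have -> : 2 * (2 * pi) ^+ 2 * K * h ^+ 2 * (wt x * wt y) =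
  2 * (2 * pi) ^+ 2 * h ^+ 2 * (K * (wt x * wt y)) by ring.
by rewrite ler_wpM2l // mulr_ge0 ?sqr_ge0.
Qed.

(** Profile and character both move. The second derivative is needed at intermediate points, and
    Peetre's inequality compares the weight there with the weight at the lattice point. *)
Lemma Th_cder_a g dg ddg a1 a2 b1 b2 p q : rd g -> rd dg -> rd ddg ->
  pd p q g dg -> pd p q dg ddg ->
  cder 0 (fun h => Th g (a1 + h * p) (a2 + h * q) b1 b2)
    (Th dg a1 a2 b1 b2 + twopii * (p * b1 - q * b2)%:C * Th g a1 a2 b1 b2).
Proof.
move=> hg hdg hddg d1 d2; set be := twopii * _.
pose g1 x y := dg x y + be * g x y.
pose g2 x y := ddg x y + be * dg x y + be * g1 x y.
have hg1 : rd g1 by exact: rdD hdg (rdZ _ hg).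
have hg2 : rd g2 by exact: rdD (rdD hddg (rdZ _ hdg)) (rdZ _ hg1).
have [K K0 hK] := rd_wt hg2.
have [M hM] := wsum_wt2' a1 a2.
pose A := 2 * (1 + `|p| ^+ 2) * (2 * (1 + `|q| ^+ 2)).
have A0 : 0 <= A by rewrite !mulr_ge0 // ltW // wtD_gt0.
rewrite -ThZ // -ThD //; last exact: rdZ.
apply: (@quad_cder _ _ _ _ (2 * (K * A) * M) 1) => // h hh.
rewrite !mul0r !addr0 add0r mulrAC.
apply: csum_quad (asum_thterm _ _ _ _ hg) (asum_thterm _ _ _ _ hg)
  (asum_thterm _ _ _ _ hg1) hM _ _.
  by rewrite mulr_ge0 ?sqr_ge0 // mulr_ge0 // mulr_ge0.
move=> n; rewrite /thterm; set x := a1 + n.1%:~R; set y := a2 + n.2%:~R.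
rewrite ![_ + h * _ + _]addrAC -/x -/y.
have dchi (t : R) : cder t (fun s => chi (x + s * p) (y + s * q) b1 b2)
    (be * chi (x + t * p) (y + t * q) b1 b2).
  apply: cder_eipi2.
  have l (z r b : R) : rder t (fun s => (z + s * r) * b) (r * b).
    apply: rder_eq (rderM (rderD (rder_cst t z) (rderM (rder_id t) (rder_cst t r))) (rder_cst t b)) _; ring.
  exact: rderD (l x p b1) (rderN (l y q b2)).
have e1 (t : R) := cderM (pd_line x y t d1) (dchi t).
have e2 (t : R) : cder t (fun t => g1 (x + t * p) (y + t * q) * chi (x + t * p) (y + t * q) b1 b2)
    (g2 (x + t * p) (y + t * q) * chi (x + t * p) (y + t * q) b1 b2).
  have d3 : pd p q g1 (fun x y => ddg x y + be * dg x y) by exact: pdD d2 (pdZ _ d1).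
  by apply: cder_eq (cderM (pd_line x y t d3) (dchi t)) _; rewrite /g2; ring.
have e1' (t : R) : cder t (fun t => g (x + t * p) (y + t * q) * chi (x + t * p) (y + t * q) b1 b2)
    (g1 (x + t * p) (y + t * q) * chi (x + t * p) (y + t * q) b1 b2).
  by apply: cder_eq (e1 t) _; rewrite /g1; ring.
have := @taylor2 _ _ _ _ 0 h (K * A * (wt x * wt y)) e1' e2 _.
rewrite add0r !mul0r !addr0 => ht; apply: le_trans (ht _) _; last first.
  by rewrite le_eqVlt; apply/orP; left; apply/eqP; ring.
move=> t; rewrite subr0 => th; rewrite cmodM cmod_chi mulr1.
have t1 : `|t| <= 1 by rewrite (le_trans th).
apply: le_trans (hK _ _) _; rewrite -mulrA ler_wpM2l // /A mulrACA.
apply: ler_pM; rewrite ?wt_ge0 // addrC; apply: wt_shift.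
  by rewrite normrM -[leRHS]mul1r ler_wpM2r.
by rewrite normrM -[leRHS]mul1r ler_wpM2r.
Qed.

End Profiles.

(** * The error function and its derivatives *)

Section ErrorFunction.
Variable R : realType.
Implicit Types (x y z : R).

Let f (u : R) := expR (- (pi * u ^+ 2)).

Lemma rder_gauss z : rder z f (- (2 * pi * z) * f z).
Proof.
have h2 : rder z (fun u : R => - (pi * (u * u))) (- (2 * pi * z)).
  apply: rder_eq (rderN (rderM (rder_cst z pi) (rderM (rder_id z) (rder_id z)))) _.
  by rewrite /=; ring.
by apply: rder_eq (rder_comp h2 (is_derive_expR _)) _; rewrite /f expr2; ring.
Qed.

Lemma continuous_gauss : continuous f.
Proof.
move=> z; apply: differentiable_continuous.
by apply/derivable1_diffP; case: (rder_gauss z).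
Qed.

(** Both integrals in [Efun] are referred to one lower limit a below 0 and y, the form to which the
    fundamental theorem of calculus applies. *)
Lemma Efun_near (a y : R) : a < 0 -> a < y ->
  Efun y = 2 * (\int[@lebesgue_measure R]_(u in `[a, y]) f u
              - \int[@lebesgue_measure R]_(u in `[a, 0]) f u).
Proof.
move=> a0 ay; have int b c : lebesgue_measure.-integrable `[b, c] (EFin \o f).
  apply: continuous_compact_integrable => //; first exact: segment_compact.
  by apply: continuous_subspaceT; exact: continuous_gauss.
have shift_itv b c : b <= c -> a < b ->
    \int[@lebesgue_measure R]_(u in `[a, c]) f u
    - \int[@lebesgue_measure R]_(u in `[a, b]) f u =
    \int[@lebesgue_measure R]_(u in `[b, c]) f u.
  move=> bc ab; rewrite Rintegral_itvB ?bnd_simp ?(ltW ab) //.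
  rewrite Rintegral_itv_obnd_cbnd //.
  by apply: integrableS (int b c) => //; apply: subset_itvr; rewrite bnd_simp.
have empty b c : c <= b -> \int[@lebesgue_measure R]_(u in `[b, c]) f u = 0.
  rewrite le_eqVlt => /predU1P[->|cb]; first by rewrite set_itv1 Rintegral_set1.
  by rewrite set_itv_ge ?Rintegral_set0 // bnd_simp -ltNge.
rewrite /Efun -/f; congr (2 * _); have [y0|y0] := leP 0 y.
  by rewrite (empty y 0) // subr0 -shift_itv.
by rewrite (empty 0 y) ?ltW // sub0r -(shift_itv y 0) ?ltW // opprB.
Qed.

Lemma rder_Efun z : rder z (@Efun R) (2 * f z).
Proof.
pose a := - (`|z| + 1); pose u := `|z| + 1.
have n0 := normr_ge0 z.
have az : a < z by rewrite ltrNl (le_lt_trans (ler_norm _)) // normrN ltrDl.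
have zu : z < u by rewrite (le_lt_trans (ler_norm _)) // ltrDl.
have a0 : a < 0 by rewrite /a; lra.
have [d1 d2] : derivable (fun y => \int[@lebesgue_measure R]_(t in `[a, y]) f t) z 1 /\
    ((fun y => \int[@lebesgue_measure R]_(t in `[a, y]) f t)^`())%classic z = f z.
  apply: (@continuous_FTC1_closed R f a z u) => //; last exact: continuous_gauss.
  apply: continuous_compact_integrable => //; first exact: segment_compact.
  by apply: continuous_subspaceT; exact: continuous_gauss.
have hd : rder z (fun y => \int[@lebesgue_measure R]_(t in `[a, y]) f t) (f z).
  by split; [exact: d1|rewrite -derive1E; exact: d2].
have hE : rder z (fun y => 2 * (\int[@lebesgue_measure R]_(t in `[a, y]) f t
    - \int[@lebesgue_measure R]_(t in `[a, 0]) f t)) (2 * f z).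
  apply: rder_eq (rderM (rder_cst z 2) (rderD hd (rder_cst z _))) _.
  by rewrite mul0r add0r addr0.
apply: near_eq_is_derive hE; near=> y; rewrite (@Efun_near a) //.
by near: y; exact: lt_nbhsr.
Unshelve. all: by end_near. Qed.

(** Only the shape polynomial times Gaussian matters: it makes every derivative differentiable
    again. *)
Lemma Efun_deriveS k : exists p : {poly R}, forall z,
  ((@Efun R)^`(k.+1))%classic z = p.[z] * f z.
Proof.
elim: k => [|k [p hp]].
  exists 2%:P => z; rewrite hornerC derive1nS derive1n0 derive1E.
  by have [_ ->] := rder_Efun z.
exists (p^`() - p * (2 * pi)%:P * 'X) => z.
rewrite derive1nS derive1E.
have -> : ((@Efun R)^`(k.+1))%classic = (fun z => p.[z] * f z) by apply/funext.
have [_ ->] := rderM (is_derive_poly p z) (rder_gauss z).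
by rewrite hornerD hornerN hornerMX hornerM hornerC; ring.
Qed.

Lemma rder_Efun_n k z : rder z ((@Efun R)^`(k))%classic (((@Efun R)^`(k.+1))%classic z).
Proof.
suff h : derivable ((@Efun R)^`(k))%classic z 1 by rewrite derive1nS derive1E; exact: derivableP h.
case: k => [|k]; first by rewrite derive1n0; case: (rder_Efun z).
have [p hp] := Efun_deriveS k.
have -> : ((@Efun R)^`(k.+1))%classic = (fun z => p.[z] * f z) by apply/funext.
by case: (rderM (is_derive_poly p z) (rder_gauss z)).
Qed.

End ErrorFunction.

(** * Fourier pairs under multiplication and differentiation *)

Section FourierPairs.
Variable R : realType.
Local Notation C := R[i].
Local Notation prof := (R -> R -> C).
Implicit Types (g dg gh : prof) (x y t h p q : R).
Local Notation twopii := (@twopii R).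

Inductive pspan (B : prof -> Prop) : prof -> Prop :=
| pspan_base g : B g -> pspan B g
| pspan_lin u v g : pspan B g -> pspan B (fun x y => (u * x + v * y)%:C * g x y)
| pspan_add g g' : pspan B g -> pspan B g' -> pspan B (fun x y => g x y + g' x y)
| pspan_scale c g : pspan B g -> pspan B (fun x y => c * g x y).

(** Decay and stability under derivatives need checking on generators only; the Leibniz rule keeps
    derivatives of linear multiples in the span. *)
Lemma pspan_smooth (B : prof -> Prop) : (forall g, B g -> rd g) ->
  (forall g, B g -> forall p q, exists2 dg, pspan B dg & pd p q g dg) ->
  smooth_class (pspan B).
Proof.
move=> hrd hpd g.
elim=> {g} [g /[dup] /hrd h1 /hpd h2|u v g hg [h1 h2]|g g' hg [h1 h2] hg' [h1' h2']|c g hg [h1 h2]].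
- by [].
- split=> [|p q]; first exact: rd_mul_linear.
  have [dg h3 h4] := h2 p q.
  exists (fun x y => (u * p + v * q)%:C * g x y + (u * x + v * y)%:C * dg x y).
    by apply: pspan_add; [exact: pspan_scale|exact: pspan_lin].
  exact: pd_mul_linear.
- split=> [|p q]; first exact: rdD.
  have [dg h3 h4] := h2 p q; have [dg' h3' h4'] := h2' p q.
  by exists (fun x y => dg x y + dg' x y); [exact: pspan_add|exact: pdD].
- split=> [|p q]; first exact: rdZ.
  have [dg h3 h4] := h2 p q.
  by exists (fun x y => c * dg x y); [exact: pspan_scale|exact: pdZ].
Qed.

Lemma pspan_sch g : pspan (@sch R) g -> sch g.
Proof.
move=> h; exists (pspan (@sch R)) => //; apply: pspan_smooth => [g' /sch_rd//|g' hg p q].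
by have [dg h1 h2] := sch_pd p q hg; exists dg => //; exact: pspan_base.
Qed.

Lemma sch_lin u v g : sch g -> sch (fun x y => (u * x + v * y)%:C * g x y).
Proof. by move=> h; apply/pspan_sch/pspan_lin/pspan_base. Qed.

Lemma sch_add g g' : sch g -> sch g' -> sch (fun x y => g x y + g' x y).
Proof. by move=> h h'; apply/pspan_sch/pspan_add; exact: pspan_base. Qed.

Lemma sch_scale c g : sch g -> sch (fun x y => c * g x y).
Proof. by move=> h; apply/pspan_sch/pspan_scale/pspan_base. Qed.

Definition FT g gh := forall a1 a2 b1 b2,
  Th g a1 a2 b1 b2 = chi a1 a2 b1 b2 * Th gh (- b1) (- b2) a1 a2.

Lemma FT_add g g' gh gh' : rd g -> rd g' -> rd gh -> rd gh' -> FT g gh -> FT g' gh' ->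
  FT (fun x y => g x y + g' x y) (fun x y => gh x y + gh' x y).
Proof. by move=> r1 r2 r3 r4 h h' a1 a2 b1 b2; rewrite !ThD // h h' mulrDr. Qed.

Lemma FT_scale c g gh : rd g -> rd gh -> FT g gh ->
  FT (fun x y => c * g x y) (fun x y => c * gh x y).
Proof. by move=> h1 h2 h a1 a2 b1 b2; rewrite !ThZ // h mulrCA. Qed.

(** Both sides are differentiated in b along (p, q); the derivative of the prefactor [chi] cancels
    the term that [Th_cder_a] takes from the character inside the dual sum. *)
Lemma FT_mul g gh dgh p q : sch g -> sch gh -> pd p q gh dgh ->
  FT g gh -> FT (fun x y => twopii * ((p * x + - q * y)%:C * g x y)) (fun x y => - dgh x y).
Proof.
move=> hg hgh hd h a1 a2 b1 b2.
have [dgh' s1 e1] := sch_pd p q hgh; rewrite -(pd_uniq hd e1) in s1 => {dgh' e1}.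
have [ddgh s2 e2] := sch_pd p q s1.
have hN : rd (fun x y => - dgh x y).
  have := rdZ (-1) (sch_rd s1); congr rd.
  by apply/funext => x; apply/funext => y; rewrite mulN1r.
have hNN : pd (- p) (- q) (fun x y => - dgh x y) ddgh.
  move=> x y; have := cderN (pdN e2 x y); by rewrite opprK.
have l1 := Th_cder_b a1 a2 b1 b2 p q (sch_rd hg).
have l2 := Th_cder_a (- b1) (- b2) a1 a2 (sch_rd hgh) hN (sch_rd s2) (pdN hd) hNN.
have l (s z r : R) : rder 0 (fun t => s * (z + t * r)) (s * r).
  apply: rder_eq (rderM (rder_cst 0 s) (rderD (rder_cst 0 z) (rderM (rder_id 0) (rder_cst 0 r)))) _.
  by ring.
have l3 := cder_eipi2 (rderD (l a1 b1 p) (rderN (l a2 b2 q))).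
apply: (cder_uniq l1).
have -> : (fun t => Th g a1 a2 (b1 + t * p) (b2 + t * q)) =
    (fun t => eipi2 (a1 * (b1 + t * p) - a2 * (b2 + t * q))%:C *
      Th gh (- b1 + t * - p) (- b2 + t * - q) a1 a2).
  by apply/funext => t; rewrite h !opprD !mulrN.
apply: cder_eq (cderM l3 l2) _.
rewrite !mul0r !addr0 /chi; set e := eipi2 _.
have -> : (- p * a1 - - q * a2) = - (a1 * p - a2 * q) by ring.
by rewrite rmorphN; ring.
Qed.

(** Both sides are differentiated in a; the multiples of the series of g coming from the characters
    on the two sides agree and cancel. *)
Lemma FT_deriv g gh dg p q : sch g -> sch gh -> pd p q g dg ->
  FT g gh -> FT dg (fun x y => twopii * ((p * x + - q * y)%:C * gh x y)).
Proof.
move=> hg hgh hd h a1 a2 b1 b2.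
have [dg' s1 e1] := sch_pd p q hg; rewrite -(pd_uniq hd e1) in s1 => {dg' e1}.
have [ddg s2 e2] := sch_pd p q s1.
have l1 := Th_cder_a a1 a2 b1 b2 (sch_rd hg) (sch_rd s1) (sch_rd s2) hd e2.
have l2 := Th_cder_b (- b1) (- b2) a1 a2 p q (sch_rd hgh).
have l (s z r : R) : rder 0 (fun t => (z + t * r) * s) (r * s).
  apply: rder_eq (rderM (rderD (rder_cst 0 z) (rderM (rder_id 0) (rder_cst 0 r))) (rder_cst 0 s)) _.
  by ring.
have l3 := cder_eipi2 (rderD (l b1 a1 p) (rderN (l b2 a2 q))).
apply: (addIr (twopii * (p * b1 - q * b2)%:C * Th g a1 a2 b1 b2)).
apply: (cder_uniq l1).
have -> : (fun t => Th g (a1 + t * p) (a2 + t * q) b1 b2) =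
    (fun t => eipi2 ((a1 + t * p) * b1 - (a2 + t * q) * b2)%:C *
      Th gh (- b1) (- b2) (a1 + t * p) (a2 + t * q)).
  by apply/funext => t; rewrite h.
apply: cder_eq (cderM l3 l2) _.
by rewrite h !mul0r !addr0 /chi; set e := eipi2 _; ring.
Qed.

End FourierPairs.

(** * Hyperbolic Gaussians *)

Section GaussianPair.
Variable R : realType.
Local Notation C := R[i].
Implicit Types (x y a b t u v p q : R).
Local Notation twopii := (@twopii R).

(** For the symmetric matrix M of the form, Cayley-Hamilton gives trace times form = det |z|^2 + |M
    z|^2, so determinant over trace bounds the form from below. *)
Lemma form_ge (a h b x y : R) : 0 < a -> 0 < b ->
  (a * b - h ^+ 2) / (a + b) * (x ^+ 2 + y ^+ 2) <= a * x ^+ 2 + 2 * h * x * y + b * y ^+ 2.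
Proof.
move=> a0 b0; have ab0 : 0 < a + b by exact: addr_gt0.
rewrite mulrAC ler_pdivrMr //.
have h1 := sqr_ge0 (a * x + h * y); have h2 := sqr_ge0 (h * x + b * y).
have -> : (a * x ^+ 2 + 2 * h * x * y + b * y ^+ 2) * (a + b) =
  (a * b - h ^+ 2) * (x ^+ 2 + y ^+ 2) + (a * x + h * y) ^+ 2 + (h * x + b * y) ^+ 2 by ring.
lra.
Qed.

Lemma gauss2_decay (e : R) k : 0 < e -> exists2 K, 0 <= K & forall x y,
  (1 + x ^+ 2 + y ^+ 2) ^+ k * expR (- (e * (x ^+ 2 + y ^+ 2))) <= K * (wt x * wt y).
Proof.
move=> e0; have [K K0 hK] := exp_decay k.+2 e0; exists K => // x y.
have s0 : 0 <= x ^+ 2 + y ^+ 2 by rewrite addr_ge0 ?sqr_ge0.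
rewrite /wt -invfM ler_pdivlMr ?mulr_gt0 ?wtD_gt0 //.
apply: le_trans (hK _ s0); rewrite addrA.
have -> : (1 + x ^+ 2 + y ^+ 2) ^+ k.+2 * expR (- (e * (x ^+ 2 + y ^+ 2))) =
  (1 + x ^+ 2 + y ^+ 2) ^+ k * expR (- (e * (x ^+ 2 + y ^+ 2))) * (1 + x ^+ 2 + y ^+ 2) ^+ 2.
  by rewrite -[k.+2]addn2 (exprD _ k 2); ring.
rewrite ler_wpM2l ?mulr_ge0 ?expR_ge0 ?exprn_ge0 ?(ltW (base_gt0 x y)) //.
have := sqr_ge0 x; have := sqr_ge0 y; nra.
Qed.

Definition ch t : R := (expR t + expR (- t)) / 2.
Definition sh t : R := (expR t - expR (- t)) / 2.

Lemma chDsh t : ch t + sh t = expR t.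
Proof. by rewrite /ch /sh; lra. Qed.

Lemma chBsh t : ch t - sh t = expR (- t).
Proof. by rewrite /ch /sh; lra. Qed.

Lemma ch2Bsh2 t : ch t ^+ 2 - sh t ^+ 2 = 1.
Proof. by rewrite subr_sqr chDsh chBsh -expRD addNr expR0. Qed.

Lemma rder_expN t : rder t (fun t => expR (- t)) (- expR (- t)).
Proof.
apply: rder_eq (rder_comp (rderN (rder_id t)) (is_derive_expR (- t))) _.
by rewrite mulrN1.
Qed.

Lemma rder_ch t : rder t ch (sh t).
Proof.
apply: rder_eq (rderM (rderD (is_derive_expR t) (rder_expN t)) (rder_cst t 2^-1)) _.
by rewrite /sh; ring.
Qed.

Lemma rder_sh t : rder t sh (ch t).
Proof.
apply: rder_eq (rderM (rderD (is_derive_expR t) (rderN (rder_expN t))) (rder_cst t 2^-1)) _.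
by rewrite /ch; ring.
Qed.

(** [Zt] and [Wt] pair a point under B_1 with the cone vector (sh t, ch t) and with its orthogonal
    vector (ch t, sh t); thus Wt^2 - Zt^2 = x^2 - y^2. *)
Definition Zt t x y : R := sh t * x - ch t * y.
Definition Wt t x y : R := ch t * x - sh t * y.

(* v ((Wt t)^2 + (Zt t)^2) = kap x^2 - 2 bet x y + kap y^2. *)
Definition kap t v : R := v * (ch t ^+ 2 + sh t ^+ 2).
Definition bet t v : R := v * (2 * ch t * sh t).
(** Coefficients of x^2 and y^2 once q^Q is combined with the Gaussian in [Zt]: the real part is
    definite, while u enters with opposite signs because Q has signature (1, 1). *)
Definition cA t u v : C := kap t v +i* - u.
Definition cD t u v : C := kap t v +i* u.

Lemma kapBbet t v : kap t v - bet t v = v * expR (- t) ^+ 2.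
Proof. by rewrite -chBsh /kap /bet; ring. Qed.

Lemma kapDbet t v : kap t v + bet t v = v * expR t ^+ 2.
Proof. by rewrite -chDsh /kap /bet; ring. Qed.

Lemma kap2Bbet2 t v : kap t v ^+ 2 - bet t v ^+ 2 = v ^+ 2.
Proof.
rewrite subr_sqr kapBbet kapDbet mulrACA -exprMn -expRD addNr expR0; ring.
Qed.

Lemma kap_gt0 t v : 0 < v -> 0 < kap t v.
Proof.
move=> v0; rewrite mulr_gt0 // ltr_wpDr ?sqr_ge0 // exprn_gt0 // divr_gt0 //.
by rewrite addr_gt0 ?expR_gt0.
Qed.

Lemma cA_cD t u v : cA t u v * cD t u v = (u ^+ 2 + v ^+ 2)%:C + (bet t v)%:C ^+ 2.
Proof.
rewrite -rmorphXn -rmorphD /= -(kap2Bbet2 t v) /cA /cD.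
by apply/eqP; rewrite eq_complex /=; apply/andP; split; apply/eqP; ring.
Qed.

Definition Gq (A D be : C) x y : C :=
  expc (- pi%:C * (A * x%:C ^+ 2 - 2%:R * be * x%:C * y%:C + D * y%:C ^+ 2)).

Definition G t u v := Gq (cA t u v) (cD t u v) (bet t v)%:C.

Lemma cmod_G t u v x y : cmod (G t u v x y) =
  expR (- (pi * (kap t v * x ^+ 2 - 2 * bet t v * x * y + kap t v * y ^+ 2))).
Proof.
rewrite cmod_expc !expr2 /=; congr expR.
by rewrite !(mul0r, mulr0, subr0, sub0r, addr0, add0r, mulr1, oppr0); ring.
Qed.

(** The eigenvalues kap - bet = v exp(-2 t) and kap + bet = v exp(2 t) are both at least v exp(-2
    L). *)
Lemma G_form_ge L t v x y : 0 < v -> `|t| <= L ->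
  v * expR (- L) ^+ 2 * (x ^+ 2 + y ^+ 2) <=
  kap t v * x ^+ 2 - 2 * bet t v * x * y + kap t v * y ^+ 2.
Proof.
move=> v0; rewrite ler_norml => /andP[t1 t2].
have e0 := expR_gt0 (- L).
have h1 : v * expR (- L) ^+ 2 <= kap t v - bet t v.
  rewrite kapBbet ler_pM2l // ler_sqr ?nnegrE ?expR_ge0 // ler_expR; lra.
have h2 : v * expR (- L) ^+ 2 <= kap t v + bet t v.
  by rewrite kapDbet ler_pM2l // ler_sqr ?nnegrE ?expR_ge0 // ler_expR.
have h3 := ler_wpM2r (sqr_ge0 (x + y)) h1; have h4 := ler_wpM2r (sqr_ge0 (x - y)) h2.
nra.
Qed.

Lemma cmod_G_le L t u v x y : 0 < v -> `|t| <= L ->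
  cmod (G t u v x y) <= expR (- (pi * (v * expR (- L) ^+ 2) * (x ^+ 2 + y ^+ 2))).
Proof.
move=> v0 tL; rewrite cmod_G ler_expR lerN2 -mulrA ler_pM2l ?pi_gt0 //.
exact: G_form_ge.
Qed.

Lemma G_coef_gt0 (L v : R) : 0 < v -> 0 < pi * (v * expR (- L) ^+ 2).
Proof. by move=> v0; rewrite mulr_gt0 ?pi_gt0 // mulr_gt0 // exprn_gt0 // expR_gt0. Qed.

Lemma rd_G t u v : 0 < v -> rd (G t u v).
Proof.
move=> v0 k; have [K K0 hK] := gauss2_decay k (G_coef_gt0 `|t| v0).
exists K => x y; apply: le_trans (_ : K * (wt x * wt y) <= _).
  apply: le_trans (hK x y); rewrite mulrC ler_wpM2l ?exprn_ge0 ?(ltW (base_gt0 x y)) //.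
  exact: cmod_G_le.
rewrite -[leRHS]mulr1 ler_wpM2l // mulr_ile1 ?wt_ge0 // /wt invf_le1 ?wtD_gt0 //.
  by rewrite lerDl sqr_ge0.
by rewrite lerDl sqr_ge0.
Qed.

Lemma pd_G t u v p q : pd p q (G t u v) (fun x y =>
  - pi%:C * (2%:R * (cA t u v) * p%:C - 2%:R * (bet t v)%:C * q%:C) * ((1 * x + 0 * y)%:C * G t u v x y)
  + - pi%:C * (2%:R * (cD t u v) * q%:C - 2%:R * (bet t v)%:C * p%:C) * ((0 * x + 1 * y)%:C * G t u v x y)).
Proof.
move=> x y; rewrite /G; move: (cA t u v) (cD t u v) (bet t v)%:C => A D be.
have hx : cder 0 (fun t => (x + t * p)%:C) p%:C.
  by have := pd_affine 1 0 0 p q x y; under eq_fun do rewrite mul1r mul0r !addr0;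
     rewrite mul1r mul0r addr0.
have hy : cder 0 (fun t => (y + t * q)%:C) q%:C.
  by have := pd_affine 0 1 0 p q x y; under eq_fun do rewrite mul1r mul0r add0r addr0;
     rewrite mul1r mul0r add0r.
have h1 := cderZ A (cderM hx hx); have h2 := cderM (cderZ (2%:R * be) hx) hy.
have h3 := cderZ D (cderM hy hy).
have h4 := cder_expc (cderZ (- pi%:C) (cderD (cderB h1 h2) h3)).
have -> : (fun t0 => Gq A D be (x + t0 * p) (y + t0 * q)) =
  (fun t0 => expc (- pi%:C * (A * ((x + t0 * p)%:C * (x + t0 * p)%:C) -
     2 * be * (x + t0 * p)%:C * (y + t0 * q)%:C + D * ((y + t0 * q)%:C * (y + t0 * q)%:C)))).
  by apply/funext => s; rewrite /Gq !expr2.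
apply: cder_eq h4 _; rewrite /= !mul0r !addr0 !mul1r !add0r /Gq !expr2; ring.
Qed.

Lemma Re_mixed_form (k u bx c x : R) : 0 < k ->
  complex.Re ((k +i* - u) * (x * x)%:C + (c%:C + 'i%C * bx%:C) * (c%:C + 'i%C * bx%:C) / (k +i* u)) =
  k * x ^+ 2 + (k * c ^+ 2 - k * bx ^+ 2 + 2 * u * bx * c) / (k ^+ 2 + u ^+ 2).
Proof.
move=> k0; rewrite /= !(mul0r, mulr0, subr0, sub0r, addr0, add0r, mul1r, mulr1, oppr0).
by field; rewrite gt_eqF // ltr_pwDl ?exprn_gt0 ?sqr_ge0.
Qed.

End GaussianPair.

(** * Definiteness of the quadratic form after one Jacobi step *)

Section MixedForm.
Variables (R : realType) (k b u v : R).
Hypotheses (k0 : 0 < k) (kb : k ^+ 2 - b ^+ 2 = v ^+ 2).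

Let den := k ^+ 2 + u ^+ 2.

Let den0 : den != 0.
Proof. by rewrite gt_eqF // ltr_pwDl ?exprn_gt0 ?sqr_ge0. Qed.

(** Positivity of this determinant makes the half-transformed double series absolutely convergent,
    which justifies exchanging its sums. *)
Lemma mixed_form_disc :
  (k * (u ^+ 2 + v ^+ 2) / den) * (k / den) - (u * b / den) ^+ 2 = v ^+ 2 / den.
Proof. by have := den0; rewrite -kb /den => d0; field. Qed.

Lemma mixed_formE (x c : R) :
  k * (u ^+ 2 + v ^+ 2) / den * x ^+ 2 + 2 * (u * b / den) * x * c + k / den * c ^+ 2 =
  k * x ^+ 2 + (k * c ^+ 2 - k * (b * x) ^+ 2 + 2 * u * (b * x) * c) / den.
Proof. by have := den0; rewrite -kb /den => d0; field. Qed.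

End MixedForm.

(** * Two Jacobi steps for the hyperbolic Gaussian *)

Section GaussianFourierPair.
Variable R : realType.
Local Notation C := R[i].
Implicit Types (x y a b t u v : R).
Local Notation twopii := (@twopii R).

Variables (t u v : R).
Hypothesis v0 : 0 < v.

Let r2 := u ^+ 2 + v ^+ 2.
Let A := cA t u v.
Let D := cD t u v.
Let be := bet t v.
Let ga := r2%:C / D.

Let r20 : 0 < r2.
Proof. by rewrite ltr_wpDl ?sqr_ge0 // exprn_gt0. Qed.

Let D0 : D != 0.
Proof. by apply: Re_gt0_neq0; exact: kap_gt0. Qed.

Let ReD : 0 < complex.Re D.
Proof. exact: kap_gt0. Qed.

Let Rega : 0 < complex.Re ga.
Proof. by rewrite /ga Re_scale mulr_gt0 // Re_inv_gt0. Qed.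

Let A_eq : A = (r2%:C + be%:C ^+ 2) / D.
Proof. by rewrite -cA_cD mulfK. Qed.

(** Terms after the Jacobi identity in y alone: p.1 is still the lattice variable of x, p.2 already
    the dual variable of y. *)
Let H a1 a2 b1 b2 (p : int * int) : C :=
  expc (- pi%:C * A * (a1 + p.1%:~R)%:C ^+ 2 + 2%:R * pi%:C * 'i%C * (a1 + p.1%:~R)%:C * b1%:C) *
  expc (- (pi%:C * (p.2%:~R - (- b2%:C - 'i%C * be%:C * (a1 + p.1%:~R)%:C)) ^+ 2 / D)
        + 2%:R * pi%:C * 'i%C * a2%:C * p.2%:~R).

Let cmod_expc_phase (z : C) s : cmod (expc (z + 'i%C * s%:C)) = cmod (expc z).
Proof.
rewrite expcD cmodM [X in _ * X]cmod_expc /= !(mul0r, mulr0, subr0, sub0r, mul1r).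
by rewrite oppr0 expR0 mulr1.
Qed.

Let asum_H a1 a2 b1 b2 : asum (H a1 a2 b1 b2).
Proof.
have k0 := kap_gt0 t v0; set k := kap t v in k0.
pose den := k ^+ 2 + u ^+ 2; have den0 : 0 < den by rewrite ltr_pwDl ?exprn_gt0 ?sqr_ge0.
have kb : k ^+ 2 - be ^+ 2 = v ^+ 2 := kap2Bbet2 t v.
pose ca := k * r2 / den; pose cb := k / den; pose cc := u * be / den.
have ca0 : 0 < ca by rewrite divr_gt0 // mulr_gt0.
have cb0 : 0 < cb by rewrite divr_gt0.
have disc : 0 < ca * cb - cc ^+ 2.
  rewrite /ca /cb /cc /r2 (mixed_form_disc u k0 kb).
  by rewrite divr_gt0 // exprn_gt0.
pose e := pi * ((ca * cb - cc ^+ 2) / (ca + cb)).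
have e0 : 0 < e by rewrite mulr_gt0 ?pi_gt0 // divr_gt0 // addr_gt0.
have [K K0 hK] := gauss2_decay 0 e0.
have [M hM] := wsum_wt2' a1 b2.
apply: (wsum_asum hM K0) => -[n k']; rewrite /H ![(n, k').1]/= ![(n, k').2]/=.
set x := a1 + n%:~R; set c := b2 + k'%:~R.
apply: le_trans (hK x c); rewrite expr0 mul1r.
rewrite -expcD.
have -> : - pi%:C * A * x%:C ^+ 2 + 2%:R * pi%:C * 'i%C * x%:C * b1%:C +
   (- (pi%:C * (k'%:~R - (- b2%:C - 'i%C * be%:C * x%:C)) ^+ 2 / D) + 2%:R * pi%:C * 'i%C * a2%:C * k'%:~R)
   = (- pi)%:C * ((k +i* - u) * (x * x)%:C +
       (c%:C + 'i%C * (be * x)%:C) * (c%:C + 'i%C * (be * x)%:C) / (k +i* u))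
     + 'i%C * (2 * pi * (x * b1 + a2 * k'%:~R))%:C.
  have hc : c%:C = b2%:C + k'%:~R by rewrite /c rmorphD /= rmorph_int.
  have hs : (2 * pi * (x * b1 + a2 * k'%:~R))%:C =
      2%:R * pi%:C * (x%:C * b1%:C + a2%:C * k'%:~R) :> C.
    by rewrite -(rmorph_int (real_complex R)); ring.
  rewrite hs hc rmorphN !rmorphM /= -/(cA t u v) -/(cD t u v) -/A -/D.
  by set P := pi%:C; clearbody P; field.
rewrite cmod_expc_phase cmod_expc Re_scale Re_mixed_form // ler_expR mulNr lerN2.
rewrite /e -mulrA ler_pM2l ?pi_gt0 //; apply: le_trans (form_ge cc x c ca0 cb0) _.
by rewrite /ca /cb /cc /r2 (mixed_formE u k0 kb).
Qed.

Let step1 a1 a2 b1 b2 : Th (G t u v) a1 a2 b1 b2 =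
  gmean D * csum (fun n => csum (fun k => H a1 a2 b1 b2 (n, k))).
Proof.
rewrite /Th csum_pair; last exact: asum_thterm (rd_G _ _ v0).
rewrite -csumZ; last exact: asum_inner (asum_H _ _ _ _).
congr csum; apply/funext => n; set x := a1 + n%:~R.
pose w : C := - b2%:C - 'i%C * be%:C * x%:C.
pose c := expc (- pi%:C * A * x%:C ^+ 2 + 2%:R * pi%:C * 'i%C * x%:C * b1%:C).
have e1 (k : int) : thterm (G t u v) a1 a2 b1 b2 (n, k) = c * gau D w (a2 + k%:~R).
  rewrite /thterm /G /Gq /chi /eipi2 /gau /c -!expcD; congr expc.
  rewrite /= -/x -/A -/D -/be; set y := a2 + _.
  apply/(addIr (('i%C * 'i%C + 1) * (2%:R * pi%:C * be%:C * x%:C * y%:C))).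
  rewrite [in LHS]sqr_imag addNr mul0r addr0 /w !rmorphXn rmorphB !rmorphM /=.
  by ring.
under eq_fun do rewrite e1.
have [K DK] := gau_decay0 w ReD.
rewrite csumZ; last exact: asum_per DK.
rewrite jacobi_shift // mulrCA; congr (_ * _); rewrite -csumZ //.
have := asum_slice (asum_H a1 a2 b1 b2) n; rewrite /H /= -/x -/w -/c => aH.
have := asumZ c^-1 aH; congr asum; apply/funext => k.
by rewrite mulrA mulVf ?mul1r // expc_neq0.
Qed.

Let om b1 b2 (k : int) : C := b1%:C - be%:C * (k%:~R + b2%:C) / D.

Let ck a2 b2 (k : int) : C :=
  expc (- (pi%:C * (k%:~R + b2%:C) ^+ 2 / D) + 2%:R * pi%:C * 'i%C * a2%:C * k%:~R).

(** Completing the square in x: as A D = r2 + be^2, the coefficient of x^2 becomes ga = r2 / D,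
    again of positive real part. *)
Let H_gau a1 a2 b1 b2 n k :
  H a1 a2 b1 b2 (n, k) = ck a2 b2 k * gau ga (om b1 b2 k) (a1 + n%:~R).
Proof.
rewrite /H /ck /gau -!expcD; congr expc => /=; set x := a1 + _.
rewrite /om /ga A_eq !rmorphXn /=; set P := pi%:C; clearbody P.
apply/(addIr (('i%C * 'i%C + 1) * (P * be%:C ^+ 2 * x%:C ^+ 2 / D))).
rewrite [in RHS]sqr_imag addNr mul0r addr0.
by field.
Qed.

Let Phi a1 a2 b1 b2 (k l : int) : C := ck a2 b2 k *
  expc (- (pi%:C * (l%:~R - om b1 b2 k) ^+ 2 / ga) + 2%:R * pi%:C * 'i%C * a1%:C * l%:~R).

(** Both steps together lead to the same kind of Gaussian at -1/tau with t unchanged. The dual index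
    k enters as -k because y has a minus sign in B_1. *)
Let Phi_G a1 a2 b1 b2 (k l : int) : Phi a1 a2 b1 b2 k l =
  chi a1 a2 b1 b2 * thterm (G t (- u / r2) (v / r2)) (- b1) (- b2) a1 a2 (l, - k).
Proof.
rewrite /Phi /ck /thterm /chi /eipi2 /G /Gq -!expcD; congr expc.
have rc : r2%:C != 0 :> C by rewrite (inj_eq (@complexI R)) gt_eqF.
have eA : cA t (- u / r2) (v / r2) = D / r2%:C.
  apply: (mulIf rc); rewrite divfK // /cA /D /cD /kap.
  apply/eqP; rewrite eq_complex /=; apply/andP.
  by split; apply/eqP; field; rewrite gt_eqF.
have eD : cD t (- u / r2) (v / r2) = A / r2%:C.
  apply: (mulIf rc); rewrite divfK // /A /cA /cD /kap.
  apply/eqP; rewrite eq_complex /=; apply/andP.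
  by split; apply/eqP; field; rewrite gt_eqF.
have eb : (bet t (v / r2))%:C = be%:C / r2%:C :> C.
  by rewrite -fmorphV -rmorphM /be /bet; congr _%:C; rewrite mulrAC.
rewrite eA eD eb A_eq /om /ga.
rewrite /fst /snd mulrNz -!(rmorph_int (real_complex R)).
move: rc; move: (r2%:C : C) => r2c rc; move: (be%:C : C) => bec.
move: (l%:~R : R) (k%:~R : R) => l' k'; move: (pi : R) => P.
by field; rewrite D0 rc.
Qed.

(** The x-sum and the dual y-sum are exchanged between the two Jacobi steps, and [gmean_pair]
    evaluates the product of their constants. *)
Lemma FT_gauss : FT (G t u v)
  (fun x y => (Num.sqrt r2)^-1%:C * G t (- u / r2) (v / r2) x y).
Proof.
move=> a1 a2 b1 b2; have vr : 0 < v / r2 by rewrite divr_gt0.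
have aT := @asum_thterm R (G t (- u / r2) (v / r2)) (- b1) (- b2) a1 a2 (rd_G _ _ vr).
have swb : bijective (fun p : int * int => (p.2, - p.1)).
  by exists (fun p : int * int => (- p.2, p.1)) => -[? ?] /=; rewrite opprK.
have aP : asum (fun p : int * int => Phi a1 a2 b1 b2 p.1 p.2).
  have := asumZ (chi a1 a2 b1 b2) (asum_inj (bij_inj swb) aT).
  by congr asum; apply/funext => -[k l]; rewrite Phi_G.
rewrite step1 csum_exchange; last exact: asum_H.
have e1 (k : int) : csum (fun n : int => H a1 a2 b1 b2 (n, k)) =
    gmean ga * csum (fun l => Phi a1 a2 b1 b2 k l).
  under eq_fun do rewrite H_gau.
  have [K DK] := gau_decay0 (om b1 b2 k) Rega.
  rewrite csumZ; last exact: asum_per DK.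
  rewrite jacobi_shift // mulrCA; congr (_ * _); rewrite -csumZ //.
  have := asumZ (ck a2 b2 k)^-1 (asum_slice aP k); congr asum; apply/funext => l.
  by rewrite /Phi /= mulrA mulVf ?mul1r // expc_neq0.
under [X in _ * csum X]eq_fun do rewrite e1.
rewrite csumZ; last exact: asum_inner aP.
rewrite mulrA; have -> : gmean D * gmean ga = (Num.sqrt r2)^-1%:C.
  rewrite -(gmean_pair ReD); last by rewrite sqrtr_gt0.
  by rewrite sqr_sqrtr // ltW.
rewrite ThZ; last exact: rd_G.
rewrite mulrCA; congr (_ * _); rewrite /Th -csumZ // -(csum_pair aP).
rewrite -[RHS](csum_bij swb); last exact: asumZ aT.
by congr csum; apply/funext => -[k l]; rewrite Phi_G.
Qed.

End GaussianFourierPair.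

(** * Differences of error functions *)

Section ErrorPair.
Variable R : realType.
Local Notation C := R[i].
Implicit Types (x y a b t u v p q s r h L : R).
Local Notation twopii := (@twopii R).

Definition qf u v x y : C := expc (pi%:C * 'i%C * (u +i* v) * (x ^+ 2 - y ^+ 2)%:C).

(** The sqrt 2 in z_t = sqrt 2 Zt merged with sqrt v. *)
Definition amp v : R := Num.sqrt (2 * v).

Definition Rho s t u v x y : C :=
  (Efun (amp v * Zt s x y) - Efun (amp v * Zt t x y))%:C * qf u v x y.

Lemma amp_gt0 v : 0 < v -> 0 < amp v.
Proof. by move=> v0; rewrite sqrtr_gt0 mulr_gt0. Qed.

Lemma amp_sqr v : 0 < v -> amp v ^+ 2 = 2 * v.
Proof. by move=> v0; rewrite sqr_sqrtr // mulr_ge0 // ltW. Qed.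

Lemma G_split t u v x y : 0 < v ->
  G t u v x y = (expR (- (pi * (amp v * Zt t x y) ^+ 2)))%:C * qf u v x y.
Proof.
move=> v0; rewrite -expc_real /qf -expcD; congr expc.
rewrite exprMn (amp_sqr v0) /cA /cD /kap /bet /Zt.
have e := ch2Bsh2 t.
have -> : x ^+ 2 - y ^+ 2 = (ch t ^+ 2 - sh t ^+ 2) * (x ^+ 2 - y ^+ 2) by rewrite e mul1r.
have {e} e1 : u = u * (ch t ^+ 2 - sh t ^+ 2) by rewrite e mulr1.
rewrite {1 2}e1; move: (ch t) (sh t) => c d.
apply/eqP; rewrite eq_complex !expr2 /=; apply/andP; split; apply/eqP.
  by rewrite !(mul0r, mulr0, subr0, sub0r, addr0, add0r, mulr1, oppr0); ring.
by rewrite !(mul0r, mulr0, subr0, sub0r, addr0, add0r, mulr1, oppr0); ring.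
Qed.

Lemma qf_neq0 u v x y : qf u v x y != 0. Proof. exact: expc_neq0. Qed.

Lemma rder_Zt t x y : rder t (fun t => Zt t x y) (Wt t x y).
Proof.
apply: rder_eq (rderD (rderM (rder_sh t) (rder_cst t x)) (rderN (rderM (rder_ch t) (rder_cst t y)))) _.
by rewrite /Wt; ring.
Qed.

Lemma rder_Wt t x y : rder t (fun t => Wt t x y) (Zt t x y).
Proof.
apply: rder_eq (rderD (rderM (rder_ch t) (rder_cst t x)) (rderN (rderM (rder_sh t) (rder_cst t y)))) _.
by rewrite /Zt; ring.
Qed.

Definition Eder1 v x y t := 2 * amp v * Wt t x y * expR (- (pi * (amp v * Zt t x y) ^+ 2)).

Definition Eder2 v x y t := 2 * amp v * Zt t x y *
  (1 - 2 * pi * amp v ^+ 2 * Wt t x y ^+ 2) * expR (- (pi * (amp v * Zt t x y) ^+ 2)).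

Lemma rder_Earg v x y t : rder t (fun t => Efun (amp v * Zt t x y)) (Eder1 v x y t).
Proof.
have h := rderM (rder_cst t (amp v)) (rder_Zt t x y).
apply: rder_eq (rder_comp h (rder_Efun _)) _.
by rewrite /Eder1; ring.
Qed.

Lemma rder_Eder1 v x y t : rder t (Eder1 v x y) (Eder2 v x y t).
Proof.
have h := rderM (rder_cst t (amp v)) (rder_Zt t x y).
have h1 := rder_comp h (rder_gauss (amp v * Zt t x y)).
have h2 := rderM (rder_cst t (2 * amp v)) (rder_Wt t x y).
by apply: rder_eq (rderM h2 h1) _; rewrite /Eder2; ring.
Qed.

Lemma norm_le_base x y : `|x| + `|y| <= 1 + x ^+ 2 + y ^+ 2.
Proof.
have := sqr_ge0 (`|x| - 1); have := sqr_ge0 (`|y| - 1).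
have x2 : `|x| ^+ 2 = x ^+ 2 by rewrite real_normK ?num_real.
have y2 : `|y| ^+ 2 = y ^+ 2 by rewrite real_normK ?num_real.
nra.
Qed.

Lemma ch_sh_le L t : `|t| <= L -> `|ch t| <= expR L /\ `|sh t| <= expR L.
Proof.
rewrite ler_norml => /andP[t1 t2].
have h1 : expR t <= expR L by rewrite ler_expR.
have h2 : expR (- t) <= expR L by rewrite ler_expR; lra.
have := expR_gt0 t; have := expR_gt0 (- t).
by rewrite /ch /sh => h3 h4; split; rewrite ler_norml; apply/andP; split; lra.
Qed.

Lemma Wt_le L t x y : `|t| <= L -> `|Wt t x y| <= expR L * (1 + x ^+ 2 + y ^+ 2).
Proof.
move=> /ch_sh_le [h1 h2]; apply: le_trans (ler_wpM2l (expR_ge0 L) (norm_le_base x y)).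
by rewrite (le_trans (ler_normB _ _)) // (normrM (ch t)) (normrM (sh t)) mulrDr; apply: lerD; rewrite ler_wpM2r.
Qed.

Lemma Zt_le L t x y : `|t| <= L -> `|Zt t x y| <= expR L * (1 + x ^+ 2 + y ^+ 2).
Proof.
move=> /ch_sh_le [h1 h2]; apply: le_trans (ler_wpM2l (expR_ge0 L) (norm_le_base x y)).
by rewrite (le_trans (ler_normB _ _)) // (normrM (sh t)) (normrM (ch t)) mulrDr; apply: lerD; rewrite ler_wpM2r.
Qed.

(** Times q^Q, the parameter derivative of E is 2 [amp v] [Wt] G, hence decays like a definite
    Gaussian, uniformly for |t| <= L. *)
Lemma Eder1_le L v k : 0 < v -> exists2 K, 0 <= K & forall u t x y, `|t| <= L ->
  (1 + x ^+ 2 + y ^+ 2) ^+ k * (`|Eder1 v x y t| * cmod (qf u v x y)) <= K * (wt x * wt y).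
Proof.
move=> v0; have [K K0 hK] := gauss2_decay k.+1 (G_coef_gt0 L v0).
have a0 := amp_gt0 v0; have e0 := expR_ge0 L.
exists (2 * amp v * expR L * K); first by rewrite !mulr_ge0 // ltW.
move=> u t x y tL; have b0 := ltW (base_gt0 x y).
have hG := cmod_G_le u x y v0 tL.
have hW := Wt_le x y tL.
have -> : `|Eder1 v x y t| * cmod (qf u v x y) = 2 * amp v * `|Wt t x y| * cmod (G t u v x y).
  rewrite (G_split _ _ _ _ v0) cmodM cmodR /Eder1 !normrM (ger0_norm (ltW a0)).
  by rewrite ger0_norm //; ring.
set b := 1 + x ^+ 2 + y ^+ 2 in b0 hW *; set ex := expR _ in hG *.
have h2 : `|Wt t x y| * cmod (G t u v x y) <= expR L * b * ex by rewrite ler_pM ?cmod_ge0.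
have -> : b ^+ k * (2 * amp v * `|Wt t x y| * cmod (G t u v x y)) =
  2 * amp v * (b ^+ k * (`|Wt t x y| * cmod (G t u v x y))) by ring.
apply: (@le_trans _ _ (2 * amp v * (b ^+ k * (expR L * b * ex)))).
  by rewrite ler_wpM2l ?mulr_ge0 ?(ltW a0) // ler_wpM2l ?exprn_ge0.
have -> : 2 * amp v * (b ^+ k * (expR L * b * ex)) = 2 * amp v * expR L * (b ^+ k.+1 * ex).
  by rewrite (exprSr _ k); ring.
by rewrite -[leRHS]mulrA ler_wpM2l ?mulr_ge0 ?(ltW a0) // hK.
Qed.

Lemma Eder2_le L v : 0 < v -> exists2 K, 0 <= K & forall u t x y, `|t| <= L ->
  `|Eder2 v x y t| * cmod (qf u v x y) <= K * (wt x * wt y).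
Proof.
move=> v0; have [K K0 hK] := gauss2_decay 3 (G_coef_gt0 L v0).
have a0 := amp_gt0 v0; have e0 := expR_ge0 L; have p0 := @pi_ge0 R.
pose B := 2 * amp v * expR L * (1 + 2 * pi * amp v ^+ 2 * expR L ^+ 2).
have a20 : 0 <= 2 * amp v by rewrite mulr_ge0 // ltW.
have c0 : 0 <= 2 * pi * amp v ^+ 2 by rewrite mulr_ge0 ?sqr_ge0 // mulr_ge0.
have c1 : 0 <= 2 * pi * amp v ^+ 2 * expR L ^+ 2 by rewrite mulr_ge0 ?sqr_ge0.
have B0 : 0 <= B by apply: mulr_ge0; [exact: mulr_ge0|exact: addr_ge0].
exists (B * K) => [|u t x y tL]; first exact: mulr_ge0.
have b1 := base_ge1 x y; set b := 1 + x ^+ 2 + y ^+ 2 in hK b1 *.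
have b0 : 0 <= b by rewrite (le_trans ler01).
have hG := cmod_G_le u x y v0 tL.
have hW := Wt_le x y tL; have hZ := Zt_le x y tL; rewrite -/b in hW hZ.
have -> : `|Eder2 v x y t| * cmod (qf u v x y) = 2 * amp v * `|Zt t x y| *
    `|1 - 2 * pi * amp v ^+ 2 * Wt t x y ^+ 2| * cmod (G t u v x y).
  rewrite (G_split _ _ _ _ v0) cmodM cmodR /Eder2 [LHS]mulrC !normrM (ger0_norm (ltW a0)).
  by rewrite ger0_norm //; ring.
have hW2 : Wt t x y ^+ 2 <= expR L ^+ 2 * b ^+ 2.
  by rewrite -exprMn -real_normK ?num_real // ler_sqr ?nnegrE ?mulr_ge0.
have b2 : 1 <= b ^+ 2 by rewrite expr_ge1.
have h1 : `|1 - 2 * pi * amp v ^+ 2 * Wt t x y ^+ 2| <=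
    (1 + 2 * pi * amp v ^+ 2 * expR L ^+ 2) * b ^+ 2.
  rewrite (le_trans (ler_normB _ _)) // normr1 [leRHS]mulrDl mul1r; apply: lerD => //.
  rewrite ger0_norm; last by rewrite mulr_ge0 ?sqr_ge0.
  by rewrite -[leRHS]mulrA ler_wpM2l.
rewrite -mulrA.
apply: (@le_trans _ _ (2 * amp v * (expR L * b) * (((1 + 2 * pi * amp v ^+ 2 * expR L ^+ 2) * b ^+ 2) *
  expR (- (pi * (v * expR (- L) ^+ 2) * (x ^+ 2 + y ^+ 2)))))).
  apply: ler_pM; [by rewrite mulr_ge0|by rewrite mulr_ge0 ?cmod_ge0|exact: ler_wpM2l|].
  by apply: ler_pM => //; exact: cmod_ge0.
have -> : 2 * amp v * (expR L * b) * (((1 + 2 * pi * amp v ^+ 2 * expR L ^+ 2) * b ^+ 2) *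
  expR (- (pi * (v * expR (- L) ^+ 2) * (x ^+ 2 + y ^+ 2)))) =
  B * (b ^+ 3 * expR (- (pi * (v * expR (- L) ^+ 2) * (x ^+ 2 + y ^+ 2)))).
  by rewrite (exprS b 2) /B; ring.
by rewrite -[leRHS]mulrA ler_wpM2l // hK.
Qed.

Lemma cmod_Rho_first s t u v x y N : (forall r, `|r - t| <= `|s - t| ->
    `|Eder1 v x y r| * cmod (qf u v x y) <= N) ->
  cmod (Rho s t u v x y) <= N * `|s - t|.
Proof.
move=> hN; have q0 := cmod_gt0 (qf_neq0 u v x y).
have := @taylor1_real _ (fun r => Efun (amp v * Zt r x y)) (Eder1 v x y) t (s - t)
  (N / cmod (qf u v x y)) (rder_Earg v x y).
rewrite [t + _]addrC subrK => h.
rewrite /Rho cmodM cmodR -ler_pdivlMr // mulrAC; apply: h => r hr.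
by rewrite ler_pdivlMr // hN.
Qed.

Lemma cmod_Rho_second s t u v x y N : 0 < v -> (forall r, `|r - t| <= `|s - t| ->
    `|Eder2 v x y r| * cmod (qf u v x y) <= N) ->
  cmod (Rho s t u v x y - (s - t)%:C * ((2 * amp v * Wt t x y)%:C * G t u v x y))
    <= N * (s - t) ^+ 2.
Proof.
move=> v0 hN; have q0 := cmod_gt0 (qf_neq0 u v x y).
have := @taylor2_real _ (fun r => Efun (amp v * Zt r x y)) (Eder1 v x y) (Eder2 v x y) t (s - t)
  (N / cmod (qf u v x y)) (rder_Earg v x y) (rder_Eder1 v x y).
rewrite [t + _]addrC subrK => h.
rewrite (G_split _ _ _ _ v0).
have -> : Rho s t u v x y - (s - t)%:C * ((2 * amp v * Wt t x y)%:C *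
   ((expR (- (pi * (amp v * Zt t x y) ^+ 2)))%:C * qf u v x y)) =
   (Efun (amp v * Zt s x y) - Efun (amp v * Zt t x y) - (s - t) * Eder1 v x y t)%:C * qf u v x y.
  have K (A B d W a E : R) (Q : C) : (A - B)%:C * Q - d%:C * ((2 * a * W)%:C * (E%:C * Q)) =
    (A - B - d * (2 * a * W * E))%:C * Q by rewrite !(rmorphB, rmorphM) /=; ring.
  exact: K.
rewrite cmodM cmodR -ler_pdivlMr // mulrAC; apply: h => r hr.
by rewrite ler_pdivlMr // hN.
Qed.

Lemma rd_Rho s t u v : 0 < v -> rd (Rho s t u v).
Proof.
move=> v0 k; pose L := `|t| + `|s - t|.
have [K K0 hK] := Eder1_le L k v0; exists (K * `|s - t|) => x y.
have b0 := base_gt0 x y; have bk : 0 < (1 + x ^+ 2 + y ^+ 2) ^+ k by rewrite exprn_gt0.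
rewrite -ler_pdivlMr // mulrAC; apply: cmod_Rho_first => r hr.
rewrite ler_pdivlMr // mulrC.
apply: le_trans (hK u r x y _) _.
  rewrite -(subrK t r) (le_trans (ler_normD _ _)) // addrC lerD //.
rewrite -[leRHS]mulr1 ler_wpM2l // mulr_ile1 ?wt_ge0 // /wt invf_le1 ?wtD_gt0 //.
  by rewrite lerDl sqr_ge0.
by rewrite lerDl sqr_ge0.
Qed.

Lemma pd_qf u v p q : pd p q (qf u v)
  (fun x y => twopii * (u +i* v) * (p * x + - q * y)%:C * qf u v x y).
Proof.
move=> x y.
have hx : cder 0 (fun t => (x + t * p)%:C) p%:C.
  by have := pd_affine 1 0 0 p q x y; under eq_fun do rewrite mul1r mul0r !addr0;
     rewrite mul1r mul0r addr0.
have hy : cder 0 (fun t => (y + t * q)%:C) q%:C.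
  by have := pd_affine 0 1 0 p q x y; under eq_fun do rewrite mul1r mul0r add0r addr0;
     rewrite mul1r mul0r add0r.
have h4 := cder_expc (cderZ (pi%:C * 'i%C * (u +i* v)) (cderB (cderM hx hx) (cderM hy hy))).
have -> : (fun h => qf u v (x + h * p) (y + h * q)) = (fun h => expc (pi%:C * 'i%C * (u +i* v) *
   ((x + h * p)%:C * (x + h * p)%:C - (y + h * q)%:C * (y + h * q)%:C))).
  by apply/funext => h; rewrite /qf rmorphB !rmorphXn /= !expr2.
apply: cder_eq h4 _; rewrite /qf !mul0r !addr0 twopiiE rmorphB !rmorphXn /= !expr2.
set E := expc _; move: (u +i* v) => tau; ring.
Qed.

Lemma pd_Rho s t u v p q : 0 < v -> pd p q (Rho s t u v) (fun x y =>
  ((2 * amp v * Zt s p q)%:C * G s u v x y + (- (2 * amp v * Zt t p q))%:C * G t u v x y)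
  + (twopii * (u +i* v)) * ((p * x + - q * y)%:C * Rho s t u v x y)).
Proof.
move=> v0 x y; rewrite !(G_split _ _ _ _ v0).
have hE (r : R) : cder 0 (fun h => (Efun (amp v * Zt r (x + h * p) (y + h * q)))%:C)
    (2 * amp v * Zt r p q * expR (- (pi * (amp v * Zt r x y) ^+ 2)))%:C.
  apply: cder_real.
  have l (z w : R) : rder 0 (fun h => z + h * w) w.
    apply: rder_eq (rderD (rder_cst 0 z) (rderM (rder_id 0) (rder_cst 0 w))) _; ring.
  have lz : rder 0 (fun h => amp v * Zt r (x + h * p) (y + h * q)) (amp v * Zt r p q).
    apply: rder_eq (rderM (rder_cst 0 (amp v)) (rderD (rderM (rder_cst 0 (sh r)) (l x p))
      (rderN (rderM (rder_cst 0 (ch r)) (l y q))))) _.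
    by rewrite /Zt; ring.
  apply: rder_eq (rder_comp lz (rder_Efun _)) _.
  by rewrite !mul0r !addr0; ring.
have hq := pd_qf u v p q x y.
have hd := cderM (cderB (hE s) (hE t)) hq.
have -> : (fun h => Rho s t u v (x + h * p) (y + h * q)) =
  (fun h => ((Efun (amp v * Zt s (x + h * p) (y + h * q)))%:C -
     (Efun (amp v * Zt t (x + h * p) (y + h * q)))%:C) * qf u v (x + h * p) (y + h * q)).
  by apply/funext => h; rewrite /Rho rmorphB.
apply: cder_eq hd _; rewrite !mul0r !addr0 /Rho.
have K (z z' e e' A B : R) (Q T L : C) : ((z * e)%:C - (z' * e')%:C) * Q +
  (A%:C - B%:C) * (T * L * Q) = z%:C * (e%:C * Q) + (- z')%:C * (e'%:C * Q) +
  T * (L * ((A - B)%:C * Q)) by rewrite !(rmorphB, rmorphM, rmorphN) /=; ring.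
exact: K.
Qed.

End ErrorPair.

(** * The Fourier pair of a difference of error functions *)

Section ErrorFourierPair.
Variable R : realType.
Local Notation C := R[i].
Local Notation prof := (R -> R -> C).
Implicit Types (x y a b t p q s r h L : R).
Local Notation twopii := (@twopii R).

(** G is among the generators because differentiating [Rho] produces it. *)
Inductive kernel u v : prof -> Prop :=
| kernel_G t : kernel u v (G t u v)
| kernel_Rho s t : kernel u v (Rho s t u v).

Lemma kernel_smooth u v : 0 < v -> smooth_class (pspan (kernel u v)).
Proof.
move=> v0; apply: pspan_smooth => [g [t|s t]|g [t|s t] p q].
- exact: rd_G.
- exact: rd_Rho.
- have := @pd_G R t u v p q.
  set dg := (X in pd _ _ _ X) => hd; exists dg => //.
  by apply: pspan_add; apply/pspan_scale/pspan_lin/pspan_base; exact: kernel_G.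
- have := pd_Rho s t u p q v0.
  set dg := (X in pd _ _ _ X) => hd; exists dg => //.
  apply: pspan_add; last by apply/pspan_scale/pspan_lin/pspan_base; exact: kernel_Rho.
  by apply: pspan_add; apply/pspan_scale/pspan_base; exact: kernel_G.
Qed.

Lemma sch_G t u v : 0 < v -> sch (G t u v).
Proof.
by move=> v0; exists (pspan (kernel u v)); [exact: kernel_smooth|apply/pspan_base/kernel_G].
Qed.

Lemma sch_Rho s t u v : 0 < v -> sch (Rho s t u v).
Proof.
by move=> v0; exists (pspan (kernel u v)); [exact: kernel_smooth|apply/pspan_base/kernel_Rho].
Qed.

Lemma RhoD s t r u v x y : Rho s t u v x y + Rho t r u v x y = Rho s r u v x y.
Proof. by rewrite /Rho -mulrDl -rmorphD /= addrA subrK. Qed.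

(** Along (ch t, sh t) the coordinate [Zt] is constant, so the derivative falls on q^Q only. *)
Lemma pd_G_orth t u v : pd (ch t) (sh t) (G t u v)
  (fun x y => twopii * (u +i* v) * ((Wt t x y)%:C * G t u v x y)).
Proof.
have := @pd_G R t u v (ch t) (sh t); congr pd.
apply/funext => x; apply/funext => y; rewrite mul1r mul0r addr0 mul0r mul1r add0r.
rewrite !mulrA -mulrDl; congr (_ * _).
rewrite twopiiE /cA /cD /kap /bet /Wt; have e := ch2Bsh2 t.
apply/eqP; rewrite eq_complex /=.
rewrite !(mul0r, mulr0, subr0, sub0r, addr0, add0r, mulr1, oppr0).
apply/andP; split; apply/eqP; last by ring.
by rewrite -[RHS]mulr1 -[X in _ = _ * X]e; ring.
Qed.

Variables (u v : R).
Hypothesis v0 : 0 < v.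

Let r2 := u ^+ 2 + v ^+ 2.
Let u' := - u / r2.
Let v' := v / r2.
Let tau : C := u +i* v.

Let r20 : 0 < r2.
Proof. by rewrite ltr_wpDl ?sqr_ge0 // exprn_gt0. Qed.

Let v'0 : 0 < v'.
Proof. by rewrite divr_gt0. Qed.

Let tau0 : tau != 0.
Proof. by rewrite eq_complex /= negb_and (gt_eqF v0) orbT. Qed.

Let tau' : - tau^-1 = u' +i* v'.
Proof. by apply/eqP; rewrite eq_complex /= /u' /v' mulNr -mulrN opprK !eqxx. Qed.

Lemma amp_dual : amp v' = amp v / Num.sqrt r2.
Proof. by rewrite /amp /v' mulrA sqrtrM ?sqrtrV ?mulr_ge0 // ?invr_ge0 ltW. Qed.

(** [FT_mul] in the direction (ch t, sh t) produces [Wt] on the left and, by [pd_G_orth], 2 pi i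
    (-1/tau) [Wt] on the right; the sign in [FT_mul] turns -1/tau into tau^-1. *)
Lemma FT_WG t : FT (fun x y => (Wt t x y)%:C * G t u v x y)
  (fun x y => ((Num.sqrt r2)^-1%:C * tau^-1) * ((Wt t x y)%:C * G t u' v' x y)).
Proof.
have sG := sch_G t u v0; have sG' := sch_G t u' v'0.
have tp0 : twopii != 0.
  by apply/eqP => h; have := cmod_twopii R; rewrite h cmod0 => /esym/eqP; rewrite gt_eqF ?mulr_gt0 ?pi_gt0.
have sGh : sch (fun x y => (Num.sqrt r2)^-1%:C * G t u' v' x y) by exact: sch_scale.
have hd := pdZ (Num.sqrt r2)^-1%:C (pd_G_orth t u' v').
have wE x y : ch t * x + - sh t * y = Wt t x y by rewrite /Wt mulNr.
have sW u1 v1 : 0 < v1 -> sch (fun x y => (Wt t x y)%:C * G t u1 v1 x y).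
  move=> v10; have := sch_lin (ch t) (- sh t) (sch_G t u1 v10).
  by congr sch; apply/funext => x; apply/funext => y; rewrite wE.
have h := FT_mul sG sGh hd (FT_gauss t u v0).
have r1 : rd (fun x y => twopii * ((ch t * x + - sh t * y)%:C * G t u v x y)).
  by have := rdZ twopii (sch_rd (sW u v v0)); congr rd;
     apply/funext => x; apply/funext => y; rewrite wE.
have r3 : rd (fun x y => - ((Num.sqrt r2)^-1%:C * (twopii * (u' +i* v') *
   ((Wt t x y)%:C * G t u' v' x y)))).
  have := rdZ (- ((Num.sqrt r2)^-1%:C * (twopii * (u' +i* v')))) (sch_rd (sW u' v' v'0)).
  by congr rd; apply/funext => x; apply/funext => y; ring.
have := FT_scale twopii^-1 r1 r3 h.
rewrite -tau'; congr FT; apply/funext => x; apply/funext => y.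
  by rewrite wE mulKf.
move: tau tau0 twopii tp0 => T T0 P P0.
set Q := (Num.sqrt r2)^-1%:C; set X := (_ * G _ _ _ _ _); clearbody Q X.
by field; rewrite T0 P0.
Qed.

(** In [FT_Rho], T and T' are the series of Wt G at tau and at -1/tau, U is tau^-1 and q is 1/|tau|.
    The linear terms cancel by hT and a quadratic defect remains. *)
Lemma quad_combine (P P' T T' X U : C) (h c q K K' : R) :
  T = X * ((q%:C * U) * T') -> cmod X = 1 ->
  cmod (P - h%:C * (c%:C * T)) <= K * h ^+ 2 ->
  cmod (P' - h%:C * ((c * q)%:C * T')) <= K' * h ^+ 2 ->
  cmod (P - X * (U * P')) <= (K + cmod U * K') * h ^+ 2.
Proof.
move=> hT hX h1 h2.
have -> : P - X * (U * P') = (P - h%:C * (c%:C * T)) - X * U * (P' - h%:C * ((c * q)%:C * T')).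
  by rewrite hT rmorphM /=; ring.
apply: le_trans (cmodB _ _) _; rewrite mulrDl; apply: lerD => //.
by rewrite !cmodM hX mul1r -mulrA ler_wpM2l ?cmod_ge0.
Qed.

Lemma FT_Rho s t : FT (Rho s t u v) (fun x y => tau^-1 * Rho s t u' v' x y).
Proof.
move=> a1 a2 b1 b2.
pose Psi s t := Th (Rho s t u v) a1 a2 b1 b2 -
  chi a1 a2 b1 b2 * (tau^-1 * Th (Rho s t u' v') (- b1) (- b2) a1 a2).
have rR s1 t1 := rd_Rho s1 t1 u v0; have rR' s1 t1 := rd_Rho s1 t1 u' v'0.
suff : Psi s t = 0.
  by move/eqP; rewrite subr_eq0 => /eqP ->; rewrite ThZ.
(* Additivity in the parameters reduces an increment of [Psi] in its first argument to its value on
   a short segment. *)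
have PsiD p q r : Psi p q + Psi q r = Psi p r.
  rewrite /Psi.
  have -> : Rho p r u v = (fun x y => Rho p q u v x y + Rho q r u v x y).
    by apply/funext => x; apply/funext => y; rewrite RhoD.
  have -> : Rho p r u' v' = (fun x y => Rho p q u' v' x y + Rho q r u' v' x y).
    by apply/funext => x; apply/funext => y; rewrite RhoD.
  rewrite (ThD _ _ _ _ (rR p q) (rR q r)) (ThD _ _ _ _ (rR' p q) (rR' q r)).
  have e (P P' Q Q' X T : C) : P - X * (T * P') + (Q - X * (T * Q')) = P + Q - X * (T * (P' + Q')).
    by ring.
  exact: e.
have Psi0 p : Psi p p = 0 by apply: (addIr (Psi p p)); rewrite PsiD add0r.
have quad (w1 w2 c1 c2 d1 d2 : R) r : 0 < w2 -> exists K, forall h, `|h| <= 1 ->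
    cmod (Th (Rho (r + h) r w1 w2) c1 c2 d1 d2 -
      h%:C * ((2 * amp w2)%:C * Th (fun x y => (Wt r x y)%:C * G r w1 w2 x y) c1 c2 d1 d2))
      <= K * h ^+ 2.
  move=> w20; have [K K0 hK] := Eder2_le (`|r| + 1) w20.
  have [M hM] := wsum_wt2' c1 c2; exists (K * M) => h hh.
  have rG : rd (fun x y => (Wt r x y)%:C * G r w1 w2 x y).
    have := rd_mul_linear (ch r) (- sh r) (rd_G r w1 w20).
    by congr rd; apply/funext => x; apply/funext => y; rewrite /Wt mulNr.
  rewrite -ThZ // /Th -csumZ; last exact: asum_thterm (rdZ _ rG).
  rewrite -csumB; first last.
  - exact/asumZ/asum_thterm/rdZ.
  - exact/asum_thterm/rd_Rho.
  rewrite mulrAC; apply: (wsum_csum hM); first by rewrite mulr_ge0 ?sqr_ge0.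
  move=> n; rewrite /thterm; set x := c1 + _; set y := c2 + _.
  rewrite mulrA -mulrBl cmodM cmod_chi mulr1.
  have hs := @cmod_Rho_second R (r + h) r w1 w2 x y (K * (wt x * wt y)) w20.
  rewrite [r + h - r]addrAC subrr add0r in hs.
  have -> : h%:C * ((2 * amp w2)%:C * ((Wt r x y)%:C * G r w1 w2 x y)) =
      h%:C * ((2 * amp w2 * Wt r x y)%:C * G r w1 w2 x y).
    by rewrite [in RHS](rmorphM _ (2 * amp w2)) /= !mulrA.
  rewrite [K * _ * _]mulrAC; apply: hs => r' hr'; apply: hK.
  rewrite -(subrK r r') (le_trans (ler_normD _ _)) // addrC lerD //.
  exact: le_trans hr' hh.
have dPsi r : cder r (fun p => Psi p t) 0.
  have [K hK] := quad u v a1 a2 b1 b2 r v0.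
  have [K' hK'] := quad u' v' (- b1) (- b2) a1 a2 r v'0.
  apply: (@quad_cder _ _ _ _ (K + cmod tau^-1 * K') 1) => // h hh.
  rewrite mulr0 subr0 -(PsiD (r + h) r t) addrK /Psi.
  have rW : rd (fun x y => (Wt r x y)%:C * G r u' v' x y).
    have := rd_mul_linear (ch r) (- sh r) (rd_G r u' v'0).
    by congr rd; apply/funext => x; apply/funext => y; rewrite /Wt mulNr.
  have hT := FT_WG r a1 a2 b1 b2; rewrite (ThZ _ _ _ _ _ rW) in hT.
  have h2 := hK' h hh; rewrite amp_dual [2 * (amp v / _)]mulrA in h2.
  exact: quad_combine hT (cmod_chi _ _ _ _) (hK h hh) h2.
by rewrite (cder_cst_eq s t dPsi) Psi0.
Qed.

End ErrorFourierPair.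

(** * Raising operators *)

Section Raising.
Variable R : realType.
Local Notation C := R[i].
Local Notation prof := (R -> R -> C).
Implicit Types (x y a b p q s t u v : R) (g gh : prof) (i : bool) (w : seq bool).
Local Notation twopii := (@twopii R).

(* [true] is the second coordinate: the pairing of [(dirx i, diry i)] with a point
   under [B1] is its [i]-th coordinate. *)
Definition dirx i : R := if i then 0 else 1.
Definition diry i : R := if i then -1 else 0.

(** A total choice of the derivative, with default 0; by [pd_uniq] it is the derivative on [sch]. *)
Definition pderiv p q g : prof := xget (fun _ _ => 0) [set dg | pd p q g dg].

Lemma pderivP p q g : sch g -> pd p q g (pderiv p q g) /\ sch (pderiv p q g).
Proof.
move=> /(sch_pd p q) [dg sdg hdg].
have h : pd p q g (pderiv p q g) by exact: (@xgetPex _ _ [set dg | pd p q g dg] (ex_intro _ dg hdg)).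
by split=> //; rewrite (pd_uniq h hdg).
Qed.

Lemma pderivZ p q g c : sch g ->
  pderiv p q (fun x y => c * g x y) = (fun x y => c * pderiv p q g x y).
Proof.
move=> sg; have [h _] := pderivP p q (sch_scale c sg); have [h' _] := pderivP p q sg.
exact: pd_uniq h (pdZ c h').
Qed.

Definition Rop u v i g : prof := fun x y => (4 * pi * v)^-1%:C *
  (twopii * (u +i* - v) * ((dirx i * x + - diry i * y)%:C * g x y) + (-1) * pderiv (dirx i) (diry i) g x y).

Definition raise u v w g := foldr (Rop u v) g w.

Lemma sch_Rop u v i g : sch g -> sch (Rop u v i g).
Proof.
move=> sg; have [_ h] := pderivP (dirx i) (diry i) sg.
apply: sch_scale; apply: sch_add; last exact: sch_scale.
by apply: sch_scale; exact: sch_lin.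
Qed.

Lemma sch_raise u v w g : sch g -> sch (raise u v w g).
Proof. by move=> sg; elim: w => //= i w IH; exact: sch_Rop. Qed.

Lemma RopZ u v i g c : sch g ->
  Rop u v i (fun x y => c * g x y) = (fun x y => c * Rop u v i g x y).
Proof.
by move=> sg; apply/funext => x; apply/funext => y; rewrite /Rop pderivZ //; ring.
Qed.

Section Dual.
Variables (u v : R).
Hypothesis v0 : 0 < v.
Let r2 := u ^+ 2 + v ^+ 2.
Let u' := - u / r2.
Let v' := v / r2.
Let tau : C := u +i* v.

Let r20 : 0 < r2.
Proof. by rewrite ltr_wpDl ?sqr_ge0 // exprn_gt0. Qed.

(** [FT_mul] and [FT_deriv] exchange the linear form with the derivative. Since conj(-1/tau) = -
    1/conj(tau) and v' = v/|tau|^2, the image is again a raising operator, times tau^-1. *)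
Lemma FT_Rop i g gh : sch g -> sch gh -> FT g gh ->
  FT (Rop u v i g) (fun x y => tau^-1 * Rop u' v' i gh x y).
Proof.
move=> sg sgh h.
have [hd sd] := pderivP (dirx i) (diry i) sg; have [hdh sdh] := pderivP (dirx i) (diry i) sgh.
have h1 := FT_mul sg sgh hdh h; have h2 := FT_deriv sg sgh hd h.
have s1 : sch (fun x y => twopii * ((dirx i * x + - diry i * y)%:C * g x y)).
  by apply: sch_scale; exact: sch_lin.
have s2 : sch (fun x y => twopii * ((dirx i * x + - diry i * y)%:C * gh x y)).
  by apply: sch_scale; exact: sch_lin.
have s3 : sch (fun x y => - pderiv (dirx i) (diry i) gh x y).
  have := sch_scale (-1) sdh; congr sch.
  by apply/funext => x; apply/funext => y; rewrite mulN1r.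
have h3 := FT_scale (u +i* - v) (sch_rd s1) (sch_rd s3) h1.
have h4 := FT_scale (-1) (sch_rd sd) (sch_rd s2) h2.
have s4 := sch_scale (u +i* - v) s1; have s5 := sch_scale (-1) sd.
have s6 := sch_scale (u +i* - v) s3; have s7 := sch_scale (-1) s2.
have h5 := FT_add (sch_rd s4) (sch_rd s5) (sch_rd s6) (sch_rd s7) h3 h4.
have := FT_scale (4 * pi * v)^-1%:C (sch_rd (sch_add s4 s5)) (sch_rd (sch_add s6 s7)) h5.
congr FT; apply/funext => x; apply/funext => y.
  by rewrite /Rop; move: (pderiv _ _ _ _ _) => d; ring.
rewrite /Rop; set X := (_ * gh x y); move: (pderiv _ _ _ _ _) => d.
have pv : (pi%:C : C) != 0 := pi_neq0 R.
have e1 : (4 * pi * v)^-1%:C = tau^-1 * (4 * pi * v')^-1%:C * (u +i* - v)^-1 :> C.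
  have c0 : (u +i* - v : C) != 0 by rewrite eq_complex /= negb_and oppr_eq0 (gt_eqF v0) orbT.
  have t0 : tau != 0 by rewrite eq_complex /= negb_and (gt_eqF v0) orbT.
  have tt : tau * (u +i* - v) = r2%:C.
    by apply/eqP; rewrite eq_complex /=; apply/andP; split; apply/eqP; rewrite /r2; ring.
  suff -> : (4 * pi * v')^-1%:C = r2%:C * (4 * pi * v)^-1%:C :> C.
    rewrite -tt; have K (T W V : C) (T0 : T != 0) (W0 : W != 0) : V = T^-1 * (T * W * V) * W^-1.
      by field; rewrite T0 W0.
    exact: K.
  rewrite -rmorphM; congr _%:C; rewrite /v'; move: (@pi R) (pi_gt0 R) => P P0.
  by field; rewrite (gt_eqF v0) (gt_eqF r20) (gt_eqF P0).
have e2 : (u' +i* - v') = - (u +i* - v)^-1 :> C.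
  apply/eqP; rewrite eq_complex /= /u' /v' /r2 sqrrN; apply/andP; split; apply/eqP; ring.
have c0 : (u +i* - v : C) != 0 by rewrite eq_complex /= negb_and oppr_eq0 (gt_eqF v0) orbT.
rewrite e1 e2; move: (u +i* - v) c0 => tb c0; move: tau^-1 (4 * pi * v')^-1%:C twopii => T V P.
by field.
Qed.

Lemma FT_raise s t w : FT (raise u v w (Rho s t u v))
  (fun x y => tau^-1 ^+ (size w).+1 * raise u' v' w (Rho s t u' v') x y).
Proof.
have v'0 : 0 < v' by rewrite divr_gt0.
have sR := sch_Rho s t u v0; have sR' := sch_Rho s t u' v'0.
elim: w => [|i w IH]; first by rewrite expr1; exact: FT_Rho.
have s1 := sch_raise u v w sR; have s2 := sch_raise u' v' w sR'.
have := FT_Rop i s1 (sch_scale _ s2) IH; rewrite RopZ // /=.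
by congr FT; apply/funext => x; apply/funext => y; rewrite mulrA -exprS.
Qed.

End Dual.
End Raising.

(** * Polynomials and the kernel p[f] *)

Section Cone.
Variable R : realType.
Implicit Types (c x : 'rV[R]_2).

Definition cn c b : R := c 0 (if b then 1 else 0) / Num.sqrt (- Q1 c).

Lemma cone_param c : coneC c -> exists s, forall x,
  B1 c x / Num.sqrt (- Q1 c) = Num.sqrt 2 * Zt s (x 0 0) (x 0 1).
Proof.
rewrite /coneC /= /Q1 => -[h0 h1]; set x := c 0 0 in h0 *; set y := c 0 1 in h0 h1 *.
set q := Num.sqrt _; have e0 : 0 < - ((x ^+ 2 - y ^+ 2) / 2) by lra.
have q0 : 0 < q by rewrite sqrtr_gt0.
have qq : q ^+ 2 = - ((x ^+ 2 - y ^+ 2) / 2) by rewrite sqr_sqrtr // ltW.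
set r := Num.sqrt 2; have rr : r ^+ 2 = 2 :> R by rewrite sqr_sqrtr.
have r0 : 0 < r :> R by rewrite sqrtr_gt0.
have xy : `|x| < y by rewrite -(ltr_pXn2r (ltn0Sn 1)) ?nnegrE ?(ltW h1) // real_normK ?num_real //; lra.
have [yx yx'] : 0 < y + x /\ 0 < y - x by move: xy; rewrite ltr_norml => /andP[]; split; lra.
have rq : 0 < r * q by rewrite mulr_gt0.
(* Since ch s + sh s = exp s, the number exp s has to be the sum of the components of c divided by
   sqrt 2 q. *)
pose w := (y + x) / (r * q); have w0 : 0 < w by rewrite divr_gt0.
have wi : w^-1 = (y - x) / (r * q).
  rewrite /w invf_div; apply/eqP; rewrite eqr_div ?(gt_eqF rq) ?(gt_eqF yx) //; apply/eqP.
  have K (Y X T Q : R) : T ^+ 2 = 2 -> Q ^+ 2 = - ((X ^+ 2 - Y ^+ 2) / 2) ->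
      (T * Q) * (T * Q) = (Y - X) * (Y + X).
    by move=> h h'; rewrite -expr2 exprMn h h'; lra.
  by rewrite (K _ _ _ _ rr qq).
exists (ln w); rewrite /Zt /sh /ch expRN lnK ?posrE // wi /w => z.
rewrite /B1 -/x -/y -/r.
have -> : x = r * (r * x) / 2 by rewrite mulrA -expr2 rr; lra.
have K (X Y A B T Q : R) : T != 0 -> Q != 0 -> T ^+ 2 = 2 ->
  (T * (T * X) / 2 * A - Y * B) / Q =
  T * (((Y + T * (T * X) / 2) / (T * Q) - (Y - T * (T * X) / 2) / (T * Q)) / 2 * A -
   ((Y + T * (T * X) / 2) / (T * Q) + (Y - T * (T * X) / 2) / (T * Q)) / 2 * B).
  by move=> T0 Q0 _; field; rewrite T0 Q0.
by apply: K; rewrite ?gt_eqF.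
Qed.

End Cone.

(** * Raising operators on polynomials *)

Section RowPolynomials.
Variables (R : realType) (m : nat).
Local Notation C := R[i].
Local Notation n := (m * 2)%N.
Local Notation P := (mpoly n C).
Implicit Types (j : 'I_m) (b : bool) (f g h : P) (c : 'rV[R]_2) (p : 'I_m * bool).

Definition vix p : 'I_n := mxvec_index p.1 (if p.2 then 1 else 0).
Definition Xvar (i : 'I_n) : P := mpolyX C (mnm1 i).

Lemma vixP (i : 'I_n) : exists p, i = vix p.
Proof.
case/mxvec_indexP: i => j l; exists (j, l == 1); rewrite /vix /=; congr mxvec_index.
by case: l => [[|[|]]] // hl; apply/val_inj.
Qed.

Lemma vix_inj : injective vix.
Proof.
move=> [j b] [j' b']; rewrite /vix /= => h.
have := mxvecE (\matrix_(k < m, l < 2) (k, l)) j (if b then 1 else 0).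
rewrite h mxvecE !mxE.
by case=> -> hb; congr pair; case: b b' hb {h} => -[].
Qed.

Lemma mderivXU (i k : 'I_n) : mderiv i (Xvar k) = mpolyC n (i == k)%:R.
Proof.
rewrite /Xvar mderivX mnm1E eq_sym; case: eqP => [->|_]; last by rewrite scale0r mpolyC0.
rewrite scale1r (mpolyC1 n C) -mpolyX0; congr (mpolyX _ _); apply/mnmP => l.
by rewrite mnmBE mnm0E subnn.
Qed.

Lemma mderivXM (i k : 'I_n) g :
  mderiv i (Xvar k * g) = Xvar k * mderiv i g + (i == k)%:R *: g.
Proof. by rewrite mderivM mderivXU addrC mul_mpolyC. Qed.

Definition eps b : R := if b then -1 else 1.

(* The factor -1/(4 pi) of the definition of [pfun]. *)
Definition lower : C := - (4 * pi)^-1%:C.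

(** The polynomial counterpart of [Rop]; [eps] turns the derivative along ([dirx], [diry]) into a
    partial derivative. *)
Definition raisep p g := Xvar (vix p) * g + (lower * (eps p.2)%:C) *: mderiv (vix p) g.

Lemma raisepD p g h : raisep p (g + h) = raisep p g + raisep p h.
Proof. by rewrite /raisep mderivD mulrDr scalerDr addrACA. Qed.

Lemma raisepZ p (z : C) g : raisep p (z *: g) = z *: raisep p g.
Proof. by rewrite /raisep mderivZ -scalerAr !scalerA scalerDr scalerA [_ * z]mulrC. Qed.

Lemma mderiv_raisep i p g :
  mderiv i (raisep p g) = raisep p (mderiv i g) + (i == vix p)%:R *: g.
Proof. by rewrite /raisep mderivD mderivXM mderivZ mderiv_comm addrAC. Qed.

Lemma dirderivE c j g : dirderiv c j g =
  (cn c false)%:C *: mderiv (vix (j, false)) g + (cn c true)%:C *: mderiv (vix (j, true)) g.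
Proof.
by rewrite /dirderiv /cn scalerDr !scalerA -!rmorphM /= !(mulrC (Num.sqrt _)^-1).
Qed.

Lemma dirderivD c j g h : dirderiv c j (g + h) = dirderiv c j g + dirderiv c j h.
Proof.
have K (V : lmodType C) (x y : C) (a b a' b' : V) :
  x *: (a + a') + y *: (b + b') = (x *: a + y *: b) + (x *: a' + y *: b').
  by rewrite !scalerDr addrACA.
by rewrite !dirderivE !mderivD; exact: K.
Qed.

Lemma dirderivZ c j (z : C) g : dirderiv c j (z *: g) = z *: dirderiv c j g.
Proof.
have K (V : lmodType C) (x y : C) (a b : V) :
  x *: (z *: a) + y *: (z *: b) = z *: (x *: a + y *: b).
  by rewrite scalerDr !scalerA (mulrC z x) (mulrC z y).
by rewrite !dirderivE !mderivZ; exact: K.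
Qed.

Lemma dirderivM c j g h : dirderiv c j (g * h) = dirderiv c j g * h + g * dirderiv c j h.
Proof.
have K (V : algType C) (x y : C) (a b a' b' a1 b1 : V) :
  x *: (a * b + a1 * b') + y *: (a' * b + a1 * b1) =
  (x *: a + y *: a') * b + a1 * (x *: b' + y *: b1).
  by rewrite !scalerDr mulrDl mulrDr -!scalerAl -!scalerAr addrACA.
by rewrite !dirderivE !mderivM; exact: K.
Qed.

Lemma dirderiv0 c j : dirderiv c j 0 = 0.
Proof. by rewrite -(scale0r 0) dirderivZ !scale0r. Qed.

Lemma dirderiv1 c j : dirderiv c j 1 = 0.
Proof. by rewrite dirderivE -mpolyC1 !mderivC !scaler0 addr0. Qed.

Lemma dirderiv_raisep c j b g :
  dirderiv c j (raisep (j, b) g) = raisep (j, b) (dirderiv c j g) + (cn c b)%:C *: g.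
Proof.
rewrite !dirderivE !mderiv_raisep !raisepD !raisepZ !scalerDr addrACA; congr (_ + _).
rewrite !(inj_eq vix_inj) !xpair_eqE !eqxx /=.
by case: b; rewrite /= scale1r scale0r scaler0 ?addr0 ?add0r.
Qed.

(** The commutator of [dirderiv] with [raisep] is the scalar [cn c b], so k derivatives give k
    copies. At k = 0 the truncated predecessor has coefficient 0. *)
Lemma iter_dirderiv_raisep c j b k g :
  iter k (dirderiv c j) (raisep (j, b) g) = raisep (j, b) (iter k (dirderiv c j) g)
   + (k%:R * (cn c b)%:C) *: iter k.-1 (dirderiv c j) g.
Proof.
elim: k => [|k IH]; first by rewrite /= mul0r scale0r addr0.
rewrite !iterS IH dirderivD dirderiv_raisep dirderivZ -addrA; congr (_ + _).
case: k {IH} => [|k]; first by rewrite /= mul0r scale0r addr0 mul1r.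
by rewrite -iterS /= -scalerDl -[X in X + _]mul1r -mulrDl -(natrD _ 1).
Qed.

Lemma iter_dirderiv0 c j k : iter k (dirderiv c j) 0 = 0.
Proof. by elim: k => //= k ->; exact: dirderiv0. Qed.

Definition rowp j (w : seq bool) : P := foldr (fun b g => raisep (j, b) g) 1 w.

Lemma raisep0 p : raisep p 0 = 0.
Proof. by rewrite -(scale0r 0) raisepZ !scale0r. Qed.

(** Each letter raises the degree by at most one; this vanishing makes the truncated sums below
    exact. *)
Lemma iter_dirderiv_rowp c j w k : (size w < k)%N ->
  iter k (dirderiv c j) (rowp j w) = 0.
Proof.
elim: w k => [|b w IH] [] //= k hk.
  by rewrite -iterS iterSr dirderiv1 iter_dirderiv0.
rewrite -iterS iter_dirderiv_raisep IH; last exact: ltnW.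
by rewrite IH // scaler0 raisep0 addr0.
Qed.

Lemma mderiv_rowp j p w : p.1 != j -> mderiv (vix p) (rowp j w) = 0.
Proof.
move=> hp; elim: w => [|b w IH] /=; first by rewrite -mpolyC1 mderivC.
rewrite mderiv_raisep IH raisep0 add0r (inj_eq vix_inj).
by case: p hp {IH} => j' b' /= /negbTE hp; rewrite xpair_eqE hp scale0r.
Qed.

Lemma mderiv_prod0 (I : Type) (s : seq I) (Q : pred I) (F : I -> P) i :
  (forall k, Q k -> mderiv i (F k) = 0) -> mderiv i (\prod_(k <- s | Q k) F k) = 0.
Proof.
move=> h; elim/big_rec: _ => [|k x Qk hx]; first by rewrite -mpolyC1 mderivC.
by rewrite mderivM hx h // mul0r mulr0 addr0.
Qed.

Lemma raisep_prod p (F : 'I_m -> P) : (forall j, j != p.1 -> mderiv (vix p) (F j) = 0) ->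
  raisep p (\prod_j F j) = \prod_j (if j == p.1 then raisep p (F j) else F j).
Proof.
move=> h; rewrite (bigD1 p.1) //= [RHS](bigD1 p.1) //= eqxx.
rewrite [in RHS](eq_bigr F) => [|j /negbTE -> //].
rewrite /raisep mderivM mderiv_prod0 // mulr0 addr0 mulrDl mulrA.
by rewrite scalerAl.
Qed.

Definition hword (w : seq ('I_m * bool)) : P := foldr raisep 1 w.

Definition wrow (w : seq ('I_m * bool)) j := [seq p.2 | p <- w & p.1 == j].

(** Letters of different rows involve disjoint variables, so each acts on its own row factor
    only. *)
Lemma hword_prod w : hword w = \prod_j rowp j (wrow w j).
Proof.
elim: w => [|p w IH] /=; first by rewrite big1.
rewrite IH raisep_prod => [|j jp]; last by rewrite mderiv_rowp // eq_sym.
apply: eq_bigr => j _; rewrite /wrow [seq.filter _ _ in RHS]/= eq_sym.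
by case: eqP => [<-|//]; case: (p).
Qed.

Lemma size_wrow w : (\sum_j size (wrow w j))%N = size w.
Proof.
elim: w => [|p w IH]; first by rewrite big1.
rewrite /= -IH (bigD1 p.1) //= [in RHS](bigD1 p.1) //= /wrow /= eqxx /= -addSn; congr (_ + _)%N.
by apply: eq_bigr => j /negbTE jp; rewrite eq_sym jp.
Qed.

End RowPolynomials.

(** * The kernel in one row *)

Section RowProfiles.
Variables (R : realType) (m : nat).
Local Notation C := R[i].
Local Notation n := (m * 2)%N.
Local Notation P := (mpoly n C).
Local Notation twopii := (@twopii R).
Local Notation lower := (@lower R).
Implicit Types (j : 'I_m) (b : bool) (g h : P) (c : 'rV[R]_2) (X : 'M[R]_(m, 2)).

Lemma cder_meval (nu : R -> 'I_n -> C) (k : C) (i0 : 'I_n) h :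
  (forall i, cder 0 (nu^~ i) (k * (i0 == i)%:R)) ->
  cder 0 (fun t => meval (nu t) h) (k * meval (nu 0) (mderiv i0 h)).
Proof.
move=> hnu.
have hP (A B : P) : cder 0 (fun t => meval (nu t) A) (k * meval (nu 0) (mderiv i0 A)) ->
    cder 0 (fun t => meval (nu t) B) (k * meval (nu 0) (mderiv i0 B)) ->
    cder 0 (fun t => meval (nu t) (A * B)) (k * meval (nu 0) (mderiv i0 (A * B))).
  move=> hA hB; have := cderM hA hB; under eq_fun do rewrite -mevalM.
  by move/cder_eq; apply; rewrite mderivM mevalD !mevalM; ring.
have h1 : cder 0 (fun t => meval (nu t) 1) (k * meval (nu 0) (mderiv i0 1)).
  rewrite -mpolyC1 mderivC meval0 mulr0; under eq_fun do rewrite mevalC.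
  exact: cder_cst.
elim/mpolyind: h => [|c mon p _ _ hp].
  rewrite mderiv0 meval0 mulr0; under eq_fun do rewrite meval0; exact: cder_cst.
suff hm : cder 0 (fun t => meval (nu t) (mpolyX C mon))
    (k * meval (nu 0) (mderiv i0 (mpolyX C mon))).
  under eq_fun do rewrite mevalD mevalZ.
  apply: cder_eq (cderD (cderZ c hm) hp) _.
  by rewrite mderivD mderivZ mevalD mevalZ; ring.
rewrite mpolyXE_id; elim/big_rec: _ => [|i A _ hA]; first exact: h1.
apply: (hP _ _ _ hA); elim: (mon i) => [|e IH]; first by rewrite expr0; exact: h1.
rewrite exprS; apply: (hP _ _ _ IH); rewrite -/(Xvar R i) mderivXU mevalC.
by under eq_fun do rewrite mevalXU; apply: hnu.
Qed.

(* Only row j of the point varies; the other rows stay at X, on which the result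
   does not depend. *)
Definition setrow X j (x y : R) : 'M[R]_(m, 2) :=
  \matrix_(k, l) if k == j then if l == 0 then x else y else X k l.

Lemma setrow_id X j : setrow X j (X j 0) (X j 1) = X.
Proof.
apply/matrixP => k l; rewrite mxE; case: eqP => // ->.
by case: l => [[|[|]]] //= hl; congr (X _ _); apply/val_inj.
Qed.

Section Point.
Variables (v : R) (X : 'M[R]_(m, 2)) (j : 'I_m).

Definition rowev h (x y : R) : C := evalat h (Num.sqrt v *: setrow X j x y).

Lemma rowevD g h x y : rowev (g + h) x y = rowev g x y + rowev h x y.
Proof. exact: mevalD. Qed.

Lemma rowevZ z h x y : rowev (z *: h) x y = z * rowev h x y.
Proof. exact: mevalZ. Qed.

Lemma rowev_X b h x y : rowev (Xvar R (vix (j, b)) * h) x y =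
  (Num.sqrt v)%:C * (dirx R b * x + - diry R b * y)%:C * rowev h x y.
Proof.
rewrite /rowev /evalat mevalM mevalXU mxvecE !mxE eqxx -rmorphM; congr (_%:C * _).
by case: b; rewrite /dirx /diry /=; ring.
Qed.

Lemma pd_rowev b h : pd (dirx R b) (diry R b) (rowev h)
  (fun x y => (Num.sqrt v * eps R b)%:C * rowev (mderiv (vix (j, b)) h) x y).
Proof.
move=> x y; have := @cder_meval (fun t i => (mxvec (Num.sqrt v *: setrow X j (x + t * dirx R b)
  (y + t * diry R b)) 0 i)%:C) (Num.sqrt v * eps R b)%:C (vix (j, b)) h.
rewrite !mul0r !addr0; apply => i.
have [[k d] ->] := vixP i; rewrite (inj_eq (@vix_inj m)) xpair_eqE.
under eq_fun do rewrite mxvecE !mxE.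
rewrite /= eq_sym; case: eqP => [_|_] /=; last by rewrite mulr0; exact: cder_cst.
have l (s z r : R) : cder 0 (fun t => (s * (z + t * r))%:C) (s * r)%:C.
  have := pd_affine s 0 0 r 0 z 0; under eq_fun do rewrite mul0r !addr0.
  by rewrite mul0r addr0.
by case: d; rewrite /=; apply: cder_eq (l _ _ _) _; case: b;
  rewrite /dirx /diry /eps /= ?mulr0 ?mulr1.
Qed.

Definition Earg c (x y : R) : R :=
  Num.sqrt v * (cn c false * x - cn c true * y).

Definition Ek k c (x y : R) : C := (((@Efun R)^`(k))%classic (Earg c x y))%:C.

Lemma pd_Ek k c b : pd (dirx R b) (diry R b) (Ek k c)
  (fun x y => (Num.sqrt v * cn c b)%:C * Ek k.+1 c x y).
Proof.
move=> x y.
have h : rder 0 (fun t => Earg c (x + t * dirx R b) (y + t * diry R b)) (Num.sqrt v * cn c b).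
  have l (z r : R) : rder 0 (fun t => z + t * r) r.
    apply: rder_eq (rderD (rder_cst 0 z) (rderM (rder_id 0) (rder_cst 0 r))) _; ring.
  apply: rder_eq (rderM (rder_cst 0 (Num.sqrt v)) (rderD
    (rderM (rder_cst 0 (cn c false)) (l x (dirx R b)))
    (rderN (rderM (rder_cst 0 (cn c true)) (l y (diry R b)))))) _.
  by rewrite /dirx /diry; case: b; ring.
have := cder_real (rder_comp h (rder_Efun_n k _)).
rewrite !mul0r !addr0; move/cder_eq; apply.
by rewrite rmorphM mulrC.
Qed.

(** Formally exp(lower d_z d_c) applied to E(z) g, with d_z acting on E and d_c on g. *)
Definition rowterm N c g (x y : R) : C := \sum_(k < N)
  lower ^+ k / (k`!%:R) * (Ek k c x y * rowev (iter k (dirderiv c j) g) x y).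

Lemma cder_sum (I : Type) (s : seq I) (F : I -> R -> C) (dF : I -> C) t :
  (forall i, cder t (F i) (dF i)) ->
  cder t (fun r => \sum_(i <- s) F i r) (\sum_(i <- s) dF i).
Proof.
move=> h; elim: s => [|i s IH].
  by rewrite big_nil; under eq_fun do rewrite big_nil; exact: cder_cst.
by rewrite big_cons; under eq_fun do rewrite big_cons; exact: cderD.
Qed.

Lemma pd_rowterm N c b g : pd (dirx R b) (diry R b) (rowterm N c g) (fun x y =>
  \sum_(k < N) lower ^+ k / (k`!%:R) * (
    (Num.sqrt v * cn c b)%:C * Ek k.+1 c x y * rowev (iter k (dirderiv c j) g) x y +
    Ek k c x y * ((Num.sqrt v * eps R b)%:C *
      rowev (mderiv (vix (j, b)) (iter k (dirderiv c j) g)) x y))).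
Proof.
move=> x y; apply: cder_sum => k; apply: cderZ.
apply: cder_eq (cderM (pd_Ek k c b x y) (pd_rowev b _ x y)) _.
by rewrite !mul0r !addr0.
Qed.

(** The commutator terms carry k / k! and match the derivatives E^(k+1) after the shift of k by one.
    The term k = N of the shifted sum has no partner, and the hypothesis removes it. *)
Lemma rowterm_raisep N c b g x y : iter N (dirderiv c j) g = 0 ->
  rowterm N.+1 c (raisep (j, b) g) x y =
  (Num.sqrt v)%:C * (dirx R b * x + - diry R b * y)%:C * rowterm N.+1 c g x y +
  lower * \sum_(k < N.+1) lower ^+ k / (k`!%:R) * (
    (cn c b)%:C * Ek k.+1 c x y * rowev (iter k (dirderiv c j) g) x y +
    Ek k c x y * ((eps R b)%:C *
      rowev (mderiv (vix (j, b)) (iter k (dirderiv c j) g)) x y)).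
Proof.
move=> hN; set D := dirderiv c j; rewrite /rowterm.
under eq_bigr do rewrite iter_dirderiv_raisep rowevD rowevZ {1}/raisep rowevD rowevZ rowev_X.
under [X in _ = _ + lower * X]eq_bigr do rewrite mulrDr.
rewrite big_split mulrDr [X in lower * X + _]big_ord_recr -/D /= -/D hN.
rewrite -(scale0r (0 : P)) rowevZ mul0r !mulr0 addr0.
have -> : lower * (\sum_(k < N) lower ^+ k / (k`!%:R) * ((cn c b)%:C * Ek k.+1 c x y *
    rowev (iter k D g) x y)) = \sum_(k < N.+1) lower ^+ k / (k`!%:R) * (Ek k c x y *
    (k%:R * (cn c b)%:C * rowev (iter k.-1 D g) x y)).
  rewrite big_ord_recl /= !(mul0r, mulr0) add0r mulr_sumr; apply: eq_bigr => k _.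
  rewrite /bump add1n factS natrM exprS.
  have f0 : (k`!%:R : C) != 0 by rewrite pnatr_eq0 -lt0n fact_gt0.
  have s0 : (k.+1%:R : C) != 0 by rewrite pnatr_eq0.
  rewrite /=; move: (k.+1%:R) s0 (k`!%:R) f0 => S s0 F f0; by field; rewrite f0 s0.
rewrite !mulr_sumr addrCA -!big_split; apply: eq_bigr => k _ /=.
move: (rowev _ _ _) (rowev _ _ _) (rowev _ _ _) (Ek _ _ _ _) (k`!%:R^-1) => A B E F G.
by move: (lower) ((eps R b)%:C) => L e; ring.
Qed.

End Point.
End RowProfiles.

(** * Matching the two kinds of raising operators *)

Section RowIdentity.
Variables (R : realType) (m : nat).
Local Notation C := R[i].
Local Notation twopii := (@twopii R).
Local Notation lower := (@lower R).
Variables (u v : R) (X : 'M[R]_(m, 2)) (j : 'I_m).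
Hypothesis v0 : 0 < v.

Lemma pderivE p q (g dg : R -> R -> C) : pd p q g dg -> pderiv p q g = dg.
Proof.
move=> h; have h' := @xgetPex _ (fun _ _ => 0) [set dg | pd p q g dg] (ex_intro _ dg h).
exact: pd_uniq h' h.
Qed.

Definition rowshift b N c g (x y : R) : C := \sum_(k < N) lower ^+ k / (k`!%:R) * (
    (cn c b)%:C * Ek v k.+1 c x y * rowev v X j (iter k (dirderiv c j) g) x y +
    Ek v k c x y * ((eps R b)%:C *
      rowev v X j (mderiv (vix (j, b)) (iter k (dirderiv c j) g)) x y)).

Lemma pd_rowterm_shift N c b g : pd (dirx R b) (diry R b) (rowterm v X j N c g)
  (fun x y => (Num.sqrt v)%:C * rowshift b N c g x y).
Proof.
move=> x y; apply: cder_eq (pd_rowterm v X j N c b g x y) _.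
rewrite /rowshift mulr_sumr; apply: eq_bigr => k _; rewrite !rmorphM /=.
move: (Num.sqrt v)%:C (_ / _) (Ek v _ _ _ _) (Ek v _ _ _ _) => S F A B.
move: (rowev _ _ _ _ _ _) (rowev _ _ _ _ _ _) => D E.
by move: (cn c b)%:C (eps R b)%:C => a e; ring.
Qed.

(** The identity 2 pi i (conj(tau) - tau) = 4 pi v. Here F includes q^Q, xb is the linear form, and
    S D is the part of the derivative of F that does not fall on q^Q. *)
Lemma raise_factor (S xb F D : C) : S * S = v%:C ->
  S * xb * F + lower * D =
  S * ((4 * pi * v)^-1%:C * (twopii * (u +i* - v) * (xb * F) +
     -1 * (S * D + F * (twopii * (u +i* v) * xb)))).
Proof.
move=> SS; rewrite /lower.
have -> : twopii * (u +i* - v) * (xb * F) + -1 * (S * D + F * (twopii * (u +i* v) * xb)) =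
  twopii * (u +i* - v - u +i* v) * xb * F - S * D by move: twopii (u +i* - v) (u +i* v) => T a b; ring.
have -> : twopii * (u +i* - v - u +i* v) = (4 * pi * v)%:C.
  rewrite twopiiE; move: (@pi R) => q.
  by apply/eqP; rewrite eq_complex /=; apply/andP; split; apply/eqP; ring.
rewrite mulrBr mulrBr -!mulrA [X in _ = S * X - _]mulrA -rmorphM mulVf; last first.
  by rewrite gt_eqF // !mulr_gt0 // pi_gt0.
rewrite mul1r; congr (_ + _); rewrite mulNr; congr (- _).
rewrite mulrCA [S * (S * D)]mulrA SS [RHS]mulrA -rmorphM; congr (_%:C * _).
by move: (@pi R) (pi_gt0 R) => q q0; field; rewrite (gt_eqF v0) (gt_eqF q0).
Qed.

(* Each letter of w acts on the left by [raisep] and on the right, up to sqrt v, by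
   [Rop]: after the shift k -> k+1 the derivatives of E cancel the commutators of
   the directional derivatives with the variables. *)
Lemma rowterm_raise N c c' s t w : (size w < N)%N ->
  (forall x y, Earg v c x y = amp v * Zt s x y) ->
  (forall x y, Earg v c' x y = amp v * Zt t x y) ->
  (fun x y => (rowterm v X j N c (rowp R j w) x y - rowterm v X j N c' (rowp R j w) x y) * qf u v x y) =
  (fun x y => (Num.sqrt v)%:C ^+ size w * raise u v w (Rho s t u v) x y).
Proof.
move=> hN hs ht.
have SS : (Num.sqrt v)%:C * (Num.sqrt v)%:C = v%:C :> C.
  by rewrite -rmorphM -expr2 sqr_sqrtr // ltW.
elim: w hN => [|b w IH] hN.
  apply/funext => x; apply/funext => y; rewrite expr0 mul1r /= /Rho -hs -ht rmorphB /=.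
  (* The empty word is the constant 1, so only k = 0 survives. *)
  have h d : rowterm v X j N d 1 x y = (Efun (Earg v d x y))%:C.
    case: N hN => // N _; rewrite /rowterm big_ord_recl big1 ?addr0.
      by rewrite expr0 fact0 divr1 mul1r /rowev /evalat /= meval1 mulr1.
    move=> k _; rewrite (@iter_dirderiv_rowp _ _ d j [::]) //.
    by rewrite -(scale0r 0) rowevZ mul0r !mulr0.
  by rewrite !h.
have hw : (size w < N)%N by apply: ltn_trans hN.
have {}IH := IH hw; set F := (fun x y => _) in IH.
have hF : pd (dirx R b) (diry R b) F (fun x y =>
   (Num.sqrt v)%:C * (rowshift b N c (rowp R j w) x y - rowshift b N c' (rowp R j w) x y) * qf u v x y
   + F x y * (twopii * (u +i* v) * (dirx R b * x + - diry R b * y)%:C)).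
  move=> x y; have h := cderM (cderB (pd_rowterm_shift N c b (rowp R j w) x y)
    (pd_rowterm_shift N c' b (rowp R j w) x y)) (pd_qf u v (dirx R b) (diry R b) x y).
  apply: cder_eq h _; rewrite !mul0r !addr0 /F.
  move: (rowshift _ _ _ _ _ _) (rowshift _ _ _ _ _ _) (qf _ _ _ _) (twopii * _) => A B Q T.
  by move: (rowterm _ _ _ _ c _ _ _) (rowterm _ _ _ _ c' _ _ _) (Num.sqrt v)%:C
    (dirx R b * x + _)%:C => U U' S Y; ring.
have -> : (fun x y => (Num.sqrt v)%:C ^+ size (b :: w) * raise u v (b :: w) (Rho s t u v) x y) =
   (fun x y => (Num.sqrt v)%:C * Rop u v b F x y).
  rewrite IH RopZ; last by apply: sch_raise; exact: sch_Rho.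
  by apply/funext => x; apply/funext => y; rewrite [size _]/= exprS -mulrA.
apply/funext => x; apply/funext => y; rewrite /Rop (pderivE hF).
have [M hM] : exists M, N = M.+1 by case: N hw {hN IH hF F} => // M _; exists M.
have h0 d : iter M (dirderiv d j) (rowp R j w) = 0.
  by apply: iter_dirderiv_rowp; move: hN; rewrite hM.
set S := (Num.sqrt v)%:C.
have e d : rowterm v X j N d (raisep (j, b) (rowp R j w)) x y =
  S * (dirx R b * x + - diry R b * y)%:C * rowterm v X j N d (rowp R j w) x y +
  lower * rowshift b N d (rowp R j w) x y by rewrite hM; exact: rowterm_raisep (h0 d).
rewrite [rowp R j (b :: w)]/(raisep (j, b) (rowp R j w)) !e.
have := @raise_factor S (dirx R b * x + - diry R b * y)%:C (F x y)
  ((rowshift b N c (rowp R j w) x y - rowshift b N c' (rowp R j w) x y) * qf u v x y) SS.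
rewrite [S * (_ * qf u v x y)]mulrA => <-; rewrite /F.
move: (rowshift _ _ _ _ _ _) (rowshift _ _ _ _ _ _) (qf _ _ _ _) (lower) => A B Q T.
by move: (rowterm _ _ _ _ _ _ _ _) (rowterm _ _ _ _ _ _ _ _) (_ + _)%:C => U U' Y; ring.
Qed.

End RowIdentity.

(** * Spherical polynomials and the heat operator *)

Section Spherical.
Variables (R : realType) (m : nat).
Local Notation C := R[i].
Local Notation n := (m * 2)%N.
Local Notation P := (mpoly n C).
Local Notation lower := (@lower R).
Implicit Types (p : 'I_m * bool) (w : seq ('I_m * bool)) (f g h : P).

Lemma laplacianE f : laplacian f = \sum_(p : 'I_m * bool)
  (eps R p.2)%:C *: mderiv (vix p) (mderiv (vix p) f).
Proof.
rewrite -(pair_big predT predT (fun j b => (eps R b)%:C *: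
  mderiv (vix (j, b)) (mderiv (vix (j, b)) f))) /=.
apply: eq_bigr => j _; rewrite big_bool /= addrC /eps.
by rewrite rmorphN1 scaleN1r scale1r.
Qed.

Lemma laplacianD f g : laplacian (f + g) = laplacian f + laplacian g.
Proof.
rewrite !laplacianE -big_split; apply: eq_bigr => p _.
by rewrite !mderivD scalerDr.
Qed.

Lemma laplacianZ (z : C) f : laplacian (z *: f) = z *: laplacian f.
Proof.
rewrite !laplacianE scaler_sumr; apply: eq_bigr => p _.
by rewrite !mderivZ scalerA mulrC -scalerA.
Qed.

Lemma laplacian0 : laplacian (0 : P) = 0.
Proof. by rewrite -(scale0r (0 : P)) laplacianZ !scale0r. Qed.

Lemma iter_laplacian0 k : iter k (@laplacian R m) 0 = 0.
Proof. by elim: k => // k IH; rewrite iterS IH laplacian0. Qed.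

Lemma mderiv_laplacian i f : mderiv i (laplacian f) = laplacian (mderiv i f).
Proof.
rewrite !laplacianE raddf_sum; apply: eq_bigr => p _.
by rewrite /= mderivZ !(mderiv_comm (vix p) i).
Qed.

Lemma laplacian_XM p f : laplacian (Xvar R (vix p) * f) =
  Xvar R (vix p) * laplacian f + (2 * (eps R p.2)%:C) *: mderiv (vix p) f.
Proof.
have K (q : 'I_m * bool) : (eps R q.2)%:C *: mderiv (vix q) (mderiv (vix q) (Xvar R (vix p) * f)) =
  (eps R q.2)%:C *: (Xvar R (vix p) * mderiv (vix q) (mderiv (vix q) f)) +
  (if q == p then (2 * (eps R p.2)%:C) *: mderiv (vix p) f else 0).
  rewrite mderivXM mderivD mderivXM mderivZ (inj_eq (@vix_inj m)) -addrA scalerDr; congr (_ + _).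
  case: eqP => [->|_]; last by rewrite !scale0r addr0 scaler0.
  by rewrite !scale1r -mulr2n -scalerMnr mulr_natl scalerMnl.
rewrite (laplacianE (Xvar R (vix p) * f)) (eq_bigr _ (fun q _ => K q)) big_split (laplacianE f).
congr (_ + _).
  by rewrite mulr_sumr; apply: eq_bigr => q _; rewrite -scalerAr.
by rewrite -big_mkcond big_pred1_eq.
Qed.

Lemma iter_laplacian_XM p k f : iter k (@laplacian R m) (Xvar R (vix p) * f) =
  Xvar R (vix p) * iter k (@laplacian R m) f +
  (k%:R * (2 * (eps R p.2)%:C)) *: mderiv (vix p) (iter k.-1 (@laplacian R m) f).
Proof.
elim: k => [|k IH]; first by rewrite mul0r scale0r addr0.
rewrite !iterS IH laplacianD laplacian_XM laplacianZ -mderiv_laplacian -addrA; congr (_ + _).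
case: k {IH} => [|k]; first by rewrite mul0r scale0r addr0 mul1r.
rewrite -iterS -scalerDl; congr (_ *: _).
by rewrite -[X in X + _]mul1r -mulrDl -(natrD _ 1).
Qed.

Definition Xword w : P := foldr (fun p g => Xvar R (vix p) * g) 1 w.

Lemma iter_laplacian_Xword w k : (size w < k)%N -> iter k (@laplacian R m) (Xword w) = 0.
Proof.
elim: w k => [|p w IH] [] // k hk.
  rewrite iterSr /Xword /= laplacianE big1 => [|p _].
    exact: iter_laplacian0.
  by rewrite -mpolyC1 mderivC mderiv0 scaler0.
rewrite iter_laplacian_XM IH ?(ltnW hk) // mulr0 add0r.
by rewrite IH // mderiv0 scaler0.
Qed.

(* exp(-Delta/(8 pi)), truncated. *)
Definition heat N f : P := \sum_(k < N) ((lower / 2) ^+ k / k`!%:R) *: iter k (@laplacian R m) f.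

Lemma heatD N f g : heat N (f + g) = heat N f + heat N g.
Proof.
rewrite /heat -big_split /=; apply: eq_bigr => k _; rewrite -scalerDr; congr (_ *: _).
by elim: (k : nat) => //= e ->; rewrite laplacianD.
Qed.

Lemma heatZ N (z : C) f : heat N (z *: f) = z *: heat N f.
Proof.
rewrite /heat scaler_sumr; apply: eq_bigr => k _.
rewrite [RHS]scalerA [z * _]mulrC -(scalerA _ z); congr (_ *: _).
by elim: (k : nat) => //= e ->; rewrite laplacianZ.
Qed.

(** The commutator of the Laplacian with a variable is 2 [eps] times a partial derivative, so moving
    exp(lower Delta / 2) past the variable costs lower [eps] times that derivative. The hypothesis
    makes the truncation exact. *)
Lemma heat_XM N p f : iter N (@laplacian R m) f = 0 ->
  heat N.+1 (Xvar R (vix p) * f) = raisep p (heat N.+1 f).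
Proof.
move=> hN; rewrite /raisep {1}/heat.
under eq_bigr do rewrite iter_laplacian_XM scalerDr scalerAr.
rewrite big_split -mulr_sumr; congr (_ + _).
have -> : heat N.+1 f = heat N f by rewrite /heat big_ord_recr /= hN scaler0 addr0.
rewrite big_ord_recl /= mul0r scale0r scaler0 add0r /heat [mderiv _ (\sum_(_ < _) _)]raddf_sum scaler_sumr.
apply: eq_bigr => k _; rewrite /= mderivZ !scalerA; congr (_ *: _).
rewrite /bump add1n factS natrM exprS.
have f0 : (k`!%:R : C) != 0 by rewrite pnatr_eq0 -lt0n fact_gt0.
have s0 : (k.+1%:R : C) != 0 by rewrite pnatr_eq0.
move: (k.+1%:R) s0 (k`!%:R) f0 ((lower / 2) ^+ k) (lower) ((eps R p.2)%:C) => S s0 F f0 A L e.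
by field; rewrite f0 s0.
Qed.

Lemma heat_Xword N w : (size w < N)%N -> heat N (Xword w) = hword R w.
Proof.
case: N => // N; elim: w => [|p w IH] hw.
  rewrite /heat big_ord_recl big1 ?addr0 => [|k _]; first by rewrite expr0 fact0 divr1 scale1r.
  by rewrite (@iter_laplacian_Xword [::]) // scaler0.
have -> : heat N.+1 (Xword (p :: w)) = raisep p (heat N.+1 (Xword w)).
  by apply: heat_XM; exact: iter_laplacian_Xword.
by rewrite IH //; exact: ltnW.
Qed.

Lemma heat_harmonic N f : laplacian f = 0 -> heat N.+1 f = f.
Proof.
move=> h; rewrite /heat big_ord_recl big1 ?addr0 => [|k _].
  by rewrite expr0 fact0 divr1 scale1r.
by rewrite iterSr h iter_laplacian0 scaler0.
Qed.

Lemma Xword_cat w w' : Xword (w ++ w') = Xword w * Xword w'.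
Proof. by elim: w => [|p w IH]; rewrite ?mul1r //= IH mulrA. Qed.

Lemma monomial_word (mon : multinom n) :
  exists2 w, size w = mdeg mon & mpolyX C mon = Xword w.
Proof.
suff [w h1 h2] : exists2 w, size w = (\sum_(i < n) mon i)%N &
    \prod_(i < n) Xvar R i ^+ mon i = Xword w.
  by exists w; rewrite ?mdegE // mpolyXE_id.
elim: (index_enum _) => [|i s [w h1 h2]].
  by exists [::]; rewrite !big_nil.
have [p ip] := vixP i.
have [w' h1' h2'] : exists2 w, size w = mon i & Xvar R i ^+ mon i = Xword w.
  exists (nseq (mon i) p); first by rewrite size_nseq.
  by elim: (mon i) => //= e IH; rewrite exprS IH ip.
exists (w' ++ w); first by rewrite size_cat big_cons h1 h1'.
by rewrite big_cons h2 h2' Xword_cat.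
Qed.

(** Homogeneity makes every monomial a word of d variables, and the heat operator, which fixes f,
    turns it into a word of d raising operators applied to 1. An individual [hword] need not be
    spherical. *)
Lemma spherical_words d f : spherical d f -> exists2 s : seq (C * seq ('I_m * bool)),
  (forall q, q \in s -> size q.2 = d) & f = \sum_(q <- s) q.1 *: hword R q.2.
Proof.
move=> [/dhomogP hd hl].
suff [s h1 h2] : exists2 s : seq (C * seq ('I_m * bool)),
  (forall q, q \in s -> size q.2 = d) & f = \sum_(q <- s) q.1 *: Xword q.2.
  exists s => //; rewrite -{1}(heat_harmonic d hl) h2.
  have heat_sum : heat d.+1 (\sum_(q <- s) q.1 *: Xword q.2) =
      \sum_(q <- s) heat d.+1 (q.1 *: Xword q.2).
    elim: (s) => [|q r IH]; last by rewrite !big_cons heatD IH.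
    by have := heatZ d.+1 0 0; rewrite !scale0r !big_nil.
  rewrite heat_sum; apply: eq_big_seq => q /h1 hq.
  by rewrite heatZ heat_Xword // hq.
rewrite (mpolyE f).
have : {in msupp f, forall mon, mdeg mon = d} by [].
elim: (msupp f) => [|mon r IH] hr; first by exists [::]; rewrite ?big_nil.
have [|s h1 h2] := IH; first by move=> k kr; apply: hr; rewrite inE kr orbT.
have [w hw1 hw2] := monomial_word mon.
exists ((mcoeff mon f, w) :: s); last by rewrite !big_cons h2 hw2.
move=> q; rewrite inE => /orP[/eqP ->|/h1 //]; rewrite hw1.
by apply: hr; rewrite inE eqxx.
Qed.

End Spherical.

(** * Factorization of p[f] over the rows *)

Section ProductFormula.
Variables (R : realType) (m : nat).
Local Notation C := R[i].
Local Notation n := (m * 2)%N.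
Local Notation P := (mpoly n C).
Local Notation lower := (@lower R).
Implicit Types (w : seq ('I_m * bool)) (g : P).

Lemma dirderiv_comm (c c' : 'rV[R]_2) (j k : 'I_m) g :
  dirderiv c j (dirderiv c' k g) = dirderiv c' k (dirderiv c j g).
Proof.
have K (V : lmodType C) (a b a' b' : C) (x y z t : V) :
  a *: (a' *: x + b' *: y) + b *: (a' *: z + b' *: t) =
  a' *: (a *: x + b *: z) + b' *: (a *: y + b *: t).
  rewrite !scalerDr !scalerA (mulrC a a') (mulrC a b') (mulrC b a') (mulrC b b').
  by rewrite addrACA.
rewrite !dirderivE !mderivD !mderivZ !(mderiv_comm (vix (j, _)) (vix (k, _))).
exact: K.
Qed.

Lemma iter_dirderiv_prod (c : 'rV[R]_2) j k (F : 'I_m -> P) :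
  (forall i, i != j -> dirderiv c j (F i) = 0) ->
  iter k (dirderiv c j) (\prod_i F i) =
  \prod_i (if i == j then iter k (dirderiv c j) (F i) else F i).
Proof.
move=> h; elim: k => [|k IH]; first by apply: eq_bigr => i _; case: eqP.
rewrite iterS IH (bigD1 j) //= eqxx dirderivM [RHS](bigD1 j) //= eqxx.
have h0 : dirderiv c j (\prod_(i | i != j) (if i == j then iter k (dirderiv c j) (F i) else F i)) = 0.
  elim/big_rec: _ => [|i x ij hx]; first exact: dirderiv1.
  by rewrite dirderivM hx mulr0 (negbTE ij) h // mul0r addr0.
rewrite h0 mulr0 addr0; congr (_ * _); apply: eq_bigr => i ij.
by rewrite (negbTE ij).
Qed.

Lemma dirderivs_prod (c : 'M[R]_(m, 2)) (k : 'I_m -> nat) (F : 'I_m -> P) :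
  (forall i j, i != j -> dirderiv (row j c) j (F i) = 0) ->
  dirderivs c k (\prod_i F i) = \prod_i iter (k i) (dirderiv (row i c) i) (F i).
Proof.
move=> h; pose G (s : seq 'I_m) i := if i \in s then iter (k i) (dirderiv (row i c) i) (F i) else F i.
suff H (s : seq 'I_m) : uniq s -> foldr (fun j g => iter (k j) (dirderiv (row j c) j) g)
    (\prod_i F i) s = \prod_i G s i.
  rewrite /dirderivs H ?enum_uniq //; apply: eq_bigr => i _.
  by rewrite /G mem_enum inE.
elim: s => [|j s IH] //= /andP[js us]; rewrite IH // iter_dirderiv_prod => [|i ij].
  apply: eq_bigr => i _; rewrite /G in_cons; have [->|_] := eqVneq i j; last by rewrite orFb.
  by rewrite (negbTE js) orTb.
rewrite /G; case: ifP => _; last exact: h.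
elim: (k i) => [|e IHe]; first exact: h.
by rewrite iterS dirderiv_comm IHe dirderiv0.
Qed.

Lemma dirderivs_hword (c : 'M[R]_(m, 2)) (k : 'I_m -> nat) w :
  dirderivs c k (hword R w) =
  \prod_j iter (k j) (dirderiv (row j c) j) (rowp R j (wrow w j)).
Proof.
rewrite hword_prod dirderivs_prod // => i j ij.
by rewrite dirderivE !mderiv_rowp 1?eq_sym // !scaler0 addr0.
Qed.

(** Trades the sum by total degree for a sum over a full box, which factors over the rows; the
    additional multi-indices have total degree above d. *)
Lemma sum_multiindex d (H : ('I_m -> nat) -> C) :
  (forall k, (d < \sum_j k j)%N -> H k = 0) ->
  \sum_(k < d.+1) \sum_(kk : {ffun 'I_m -> 'I_k.+1} | (\sum_j kk j)%N == k) H (fun j => kk j) =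
  \sum_(kk : {ffun 'I_m -> 'I_d.+1}) H (fun j => kk j).
Proof.
move=> H0; rewrite [RHS](bigID (fun kk : {ffun 'I_m -> 'I_d.+1} => (\sum_j kk j < d.+1)%N)) /=.
rewrite [X in _ + X]big1 ?addr0; last by move=> kk; rewrite -leqNgt; exact: H0.
rewrite (partition_big (fun kk : {ffun 'I_m -> 'I_d.+1} => inord (\sum_j kk j) : 'I_d.+1) predT) //=.
apply: eq_bigr => k _.
have kd : (k.+1 <= d.+1)%N by [].
pose h (kk : {ffun 'I_m -> 'I_k.+1}) : {ffun 'I_m -> 'I_d.+1} := [ffun j => widen_ord kd (kk j)].
pose h' (kk : {ffun 'I_m -> 'I_d.+1}) : {ffun 'I_m -> 'I_k.+1} := [ffun j => inord (kk j)].
have hE kk : (\sum_j h kk j)%N = (\sum_j kk j)%N by apply: eq_bigr => j _; rewrite ffunE.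
rewrite (reindex_onto h h') => [|kk /andP[hlt /eqP hk]].
  apply: eq_big => [kk|kk _]; last by congr H; apply/funext => j; rewrite ffunE.
  rewrite hE; have -> : h' (h kk) == kk.
    by apply/eqP/ffunP => j; rewrite !ffunE; apply/val_inj; rewrite /= inordK.
  rewrite andbT; apply/eqP/andP => [e|[e1 /eqP e2]].
    by rewrite e; split => //; apply/eqP/val_inj; rewrite /= inordK.
  by have := congr1 val e2; rewrite /= inordK.
apply/ffunP => j; rewrite !ffunE; apply/val_inj; rewrite /= inordK //.
have := congr1 val hk; rewrite /= inordK // => <-.
by rewrite ltnS (bigD1 j) //= leq_addr.
Qed.

(** Distributing the signed sum over sigma leaves in each row the difference of the terms for c0 and
    c1. *)
Lemma pfun_hword (c0 c1 : 'M[R]_(m, 2)) w d v (X : 'M[R]_(m, 2)) : size w = d ->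
  pfun d c0 c1 (hword R w) (Num.sqrt v *: X) =
  \prod_j (rowterm v X j d.+1 (row j c0) (rowp R j (wrow w j)) (X j 0) (X j 1) -
           rowterm v X j d.+1 (row j c1) (rowp R j (wrow w j)) (X j 0) (X j 1)).
Proof.
move=> hw.
pose T j (s : bool) k := lower ^+ k / (k`!%:R) * (Ek v k (row j (if s then c1 else c0)) (X j 0) (X j 1) *
  rowev v X j (iter k (dirderiv (row j (if s then c1 else c0)) j) (rowp R j (wrow w j))) (X j 0) (X j 1)).
transitivity (\prod_j \sum_(s : bool) ((-1) ^+ s * \sum_(k < d.+1) T j s k)); last first.
  by apply: eq_bigr => j _; rewrite big_bool /= expr0 expr1 mul1r mulN1r addrC.
rewrite bigA_distr_bigA /pfun; apply: eq_bigr => s _.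
rewrite big_split /= prodrXr; congr (_ * _).
rewrite bigA_distr_bigA /= -(@sum_multiindex d (fun kk => \prod_j T j (s j) (kk j))).
  apply: eq_bigr => k _; rewrite mulr_sumr; apply: eq_bigr => kk /eqP hk.
  rewrite dirderivs_hword /evalat rmorph_prod (rmorph_prod (meval _)) /=.
  have -> : (-1) ^+ k / ((4 * pi) ^+ k)%:C = \prod_j lower ^+ (kk j) :> C.
    rewrite prodrXr hk /lower [RHS]exprNn; congr (_ * _).
    by rewrite -rmorphXn exprVn fmorphV.
  rewrite -!big_split /=; apply: eq_bigr => j _.
  have -> : row j (choose_rows c0 c1 s) = row j (if s j then c1 else c0).
    by apply/rowP => l; rewrite !mxE; case: (s j).
  rewrite /T /rowev setrow_id /Ek.
  have -> : B1 (row j (if s j then c1 else c0)) (row j (Num.sqrt v *: X)) /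
     Num.sqrt (- Q1 (row j (if s j then c1 else c0))) =
     Earg v (row j (if s j then c1 else c0)) (X j 0) (X j 1).
    rewrite /B1 /Earg /cn !mxE; ring.
  rewrite rmorphM -mulrA; congr (_ * _); rewrite mulrA; congr (_ * _ * _).
  by rewrite fmorphV rmorph_nat.
(* Pigeonhole: some row receives more derivatives than it has letters. *)
move=> kk hk; have [j hj] : exists j, (size (wrow w j) < kk j)%N.
  apply/existsP; apply: contraLR hk; rewrite negb_exists -leqNgt => /forallP h.
  by rewrite -hw -size_wrow leq_sum // => j _; rewrite leqNgt.
rewrite (bigD1 j) //= {1}/T iter_dirderiv_rowp //.
by rewrite /rowev /evalat meval0 !mulr0 mul0r.
Qed.

End ProductFormula.

(** * Summation over the lattice *)

Section MatrixSums.
Variable R : realType.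
Local Notation C := R[i].

Lemma csum_single (T : choiceType) (F : T -> C) (t0 : T) : (forall t, t = t0) ->
  asum F /\ csum F = F t0.
Proof.
move=> h; split.
  exists (cmod (F t0)) => s us; have : (size s <= 1)%N.
    by case: s us => [|x [|y s]] //=; rewrite inE (h x) (h y) eqxx.
  case: s us => [|x [|y s]] //= _ _; first by rewrite big_nil cmod_ge0.
  by rewrite big_seq1 (h x).
apply: hassum_csum => e e0; exists [:: t0] => B uB hB.
have -> : B = [:: t0].
  have := hB t0 (mem_head _ _); case: B uB {hB} => [|x [|y s]] //=.
    by rewrite (h x).
  by rewrite inE (h x) (h y) eqxx.
by rewrite big_seq1 subrr cmod0 ltW.
Qed.

(** Peels off the first row, so that sums over the matrix lattice become products of sums over Z^2
    by induction. *)
Definition row_split k (M : 'M[int]_(k.+1, 2)) : (int * int) * 'M[int]_(k, 2) :=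
  ((M 0 0, M 0 1), \matrix_(i, l) M (lift ord0 i) l).

Lemma row_split_bij k : bijective (@row_split k).
Proof.
pose g (q : (int * int) * 'M[int]_(k, 2)) : 'M[int]_(k.+1, 2) :=
  \matrix_(i, l) if unlift ord0 i is Some i' then q.2 i' l else if l == 0 then q.1.1 else q.1.2.
exists g => [M|[[p q] M]].
  apply/matrixP => i l; rewrite mxE; case: unliftP => [i' ->|->]; first by rewrite mxE.
  have [->//|] := eqVneq l 0.
  by case: l => [[|[|]]] //= hl _; congr (M _ _); apply/val_inj.
rewrite /row_split /g; congr (_, _); first by rewrite !mxE unlift_none.
by apply/matrixP => i l; rewrite !mxE liftK.
Qed.

Lemma csum_matrix k (F : 'I_k -> int * int -> C) : (forall j, asum (F j)) ->
  asum (fun n : 'M[int]_(k, 2) => \prod_j F j (n j 0, n j 1)) /\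
  csum (fun n : 'M[int]_(k, 2) => \prod_j F j (n j 0, n j 1)) = \prod_j csum (F j).
Proof.
elim: k F => [|k IH] F hF.
  have [|h1 h2] := @csum_single 'M[int]_(0, 2)
    (fun n : 'M[int]_(0, 2) => \prod_j F j (n j 0, n j 1)) 0.
    by move=> t; apply/matrixP => -[].
  by split => //; rewrite h2 !big_ord0.
have [h1 h2] := IH _ (fun j => hF (lift ord0 j)).
have aG := asum_prod (hF ord0) h1; have hb := @row_split_bij k.
have E : (fun n : 'M[int]_(k.+1, 2) => \prod_j F j (n j 0, n j 1)) =
  (fun n => (fun p : (int * int) * 'M[int]_(k, 2) =>
     F ord0 p.1 * \prod_j F (lift ord0 j) (p.2 j 0, p.2 j 1)) (row_split n)).
  by apply/funext => n; rewrite big_ord_recl; congr (_ * _); apply: eq_bigr => j _; rewrite !mxE.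
rewrite E; split; first exact: (asum_inj (bij_inj hb) aG).
rewrite (csum_bij hb aG); apply: (etrans (csum_prod (hF ord0) h1)).
by rewrite h2 big_ord_recl.
Qed.

End MatrixSums.

(** * Theta terms of a single word *)

Section ThetaWord.
Variables (R : realType) (m d : nat).
Local Notation C := R[i].
Variables (c0 c1 : 'M[R]_(m, 2)) (s t : 'I_m -> R).
Hypothesis hs : forall j (x : 'rV[R]_2), B1 (row j c0) x / Num.sqrt (- Q1 (row j c0)) =
  Num.sqrt 2 * Zt (s j) (x 0 0) (x 0 1).
Hypothesis ht : forall j (x : 'rV[R]_2), B1 (row j c1) x / Num.sqrt (- Q1 (row j c1)) =
  Num.sqrt 2 * Zt (t j) (x 0 0) (x 0 1).

Definition wprof (u v : R) (w : seq ('I_m * bool)) j :=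
  raise u v (wrow w j) (Rho (s j) (t j) u v).

Lemma Earg_Zt (c : 'rV[R]_2) r v : 0 < v ->
  (forall x, B1 c x / Num.sqrt (- Q1 c) = Num.sqrt 2 * Zt r (x 0 0) (x 0 1)) ->
  forall x y, Earg v c x y = amp v * Zt r x y.
Proof.
move=> v0 h x y; have := h (\row_l if l == 0 then x else y); rewrite /B1 !mxE /= => e.
by rewrite /amp sqrtrM // /Earg /cn [RHS]mulrAC -e; ring.
Qed.

Lemma eipi2_sum (F : 'I_m -> C) : eipi2 (\sum_j F j) = \prod_j eipi2 (F j).
Proof. by apply: (big_morph _ (@eipi2D R)); exact: eipi2_0. Qed.

Lemma theta_term_word (a b : 'M[R]_(m, 2)) w (u v : R) n : 0 < v -> size w = d ->
  theta_term d c0 c1 a b (hword R w) (u +i* v) n = (Num.sqrt v)%:C ^+ d *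
    \prod_j thterm (wprof u v w j) (a j 0) (a j 1) (b j 0) (b j 1) (n j 0, n j 1).
Proof.
move=> v0 hw; rewrite /theta_term; set X := a + _.
rewrite [complex.Im _]/= (pfun_hword c0 c1 v X hw) /Qm /Bm.
rewrite !rmorph_sum /= mulr_suml !eipi2_sum -!big_split /=.
have -> : (Num.sqrt v)%:C ^+ d = \prod_j (Num.sqrt v)%:C ^+ size (wrow w j) :> C.
  by rewrite prodrXr size_wrow hw.
rewrite -big_split; apply: eq_bigr => j _ /=.
have sz : (size (wrow w j) < d.+1)%N.
  by rewrite -hw -size_wrow ltnS (bigD1 j) //= leq_addr.
have := congr1 (fun f => f (X j 0) (X j 1))
  (rowterm_raise u X j v0 sz (Earg_Zt v0 (hs j)) (Earg_Zt v0 (ht j))).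
rewrite /thterm /wprof mulrA /=.
have -> : a j 0 + (n j 0)%:~R = X j 0 by rewrite !mxE.
have -> : a j 1 + (n j 1)%:~R = X j 1 by rewrite !mxE.
move=> <-; congr (_ * _ * _).
  rewrite /qf /eipi2; congr expc; rewrite /Q1 !mxE; move: (a j 0 + _) (a j 1 + _) => x y.
  move: (u +i* v) => tau; rewrite !rmorphM fmorphV /= rmorph_nat.
  by move: (@pi R)%:C => q; field.
by rewrite /chi /B1 !mxE.
Qed.

End ThetaWord.

(** * Linearity in f and the product form of the theta series *)

Section Theta.
Variables (R : realType) (m d : nat).
Local Notation C := R[i].
Local Notation P := (mpoly (m * 2) C).
Implicit Types (f g : P) (c a b : 'M[R]_(m, 2)).

Lemma dirderivsD c k f g : dirderivs c k (f + g) = dirderivs c k f + dirderivs c k g.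
Proof.
rewrite /dirderivs; elim: (enum _) => //= j s ->.
by elim: (k j) => //= e ->; rewrite dirderivD.
Qed.

Lemma dirderivsZ c k (z : C) f : dirderivs c k (z *: f) = z *: dirderivs c k f.
Proof.
rewrite /dirderivs; elim: (enum _) => //= j s ->.
by elim: (k j) => //= e ->; rewrite dirderivZ.
Qed.

Lemma pfunD c0 c1 f g X : pfun d c0 c1 (f + g) X = pfun d c0 c1 f X + pfun d c0 c1 g X.
Proof.
rewrite /pfun -big_split; apply: eq_bigr => s _ /=.
rewrite -mulrDr -big_split; congr (_ * _); apply: eq_bigr => k _ /=.
rewrite -mulrDr -big_split; congr (_ * _); apply: eq_bigr => kk _ /=.
by rewrite dirderivsD /evalat mevalD mulrDr.
Qed.

Lemma pfunZ c0 c1 (z : C) f X : pfun d c0 c1 (z *: f) X = z * pfun d c0 c1 f X.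
Proof.
rewrite /pfun mulr_sumr; apply: eq_bigr => s _ /=; rewrite mulrCA; congr (_ * _).
rewrite mulr_sumr; apply: eq_bigr => k _; rewrite mulrCA; congr (_ * _).
rewrite mulr_sumr; apply: eq_bigr => kk _; rewrite mulrCA; congr (_ * _).
by rewrite dirderivsZ /evalat mevalZ.
Qed.

Lemma theta_term_sum c0 c1 a b tau n (I : Type) (l : seq I) (z : I -> C) (F : I -> P) :
  theta_term d c0 c1 a b (\sum_(q <- l) z q *: F q) tau n =
  \sum_(q <- l) z q * theta_term d c0 c1 a b (F q) tau n.
Proof.
rewrite /theta_term; set X := a + _.
have -> : pfun d c0 c1 (\sum_(q <- l) z q *: F q) (Num.sqrt (complex.Im tau) *: X) =
  \sum_(q <- l) z q * pfun d c0 c1 (F q) (Num.sqrt (complex.Im tau) *: X).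
  elim: l => [|q l IH]; last by rewrite !big_cons pfunD pfunZ IH.
  by rewrite !big_nil -[0 in LHS](scale0r (0 : P)) pfunZ mul0r.
by rewrite !mulr_suml; apply: eq_bigr => q _; rewrite !mulrA.
Qed.

Variables (c0 c1 : 'M[R]_(m, 2)) (s t : 'I_m -> R).
Hypothesis hs : forall j (x : 'rV[R]_2), B1 (row j c0) x / Num.sqrt (- Q1 (row j c0)) =
  Num.sqrt 2 * Zt (s j) (x 0 0) (x 0 1).
Hypothesis ht : forall j (x : 'rV[R]_2), B1 (row j c1) x / Num.sqrt (- Q1 (row j c1)) =
  Num.sqrt 2 * Zt (t j) (x 0 0) (x 0 1).

Lemma sch_wprof u v w j : 0 < v -> sch (wprof s t u v w j).
Proof. by move=> v0; apply/sch_raise/sch_Rho. Qed.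

(** The prefactor v^(-d/2) cancels the sqrt v gained once per letter in [rowterm_raise]. *)
Lemma powR_half_sqrt (v : R) : 0 < v -> v `^ (- (d%:R / 2)) * Num.sqrt v ^+ d = 1.
Proof.
move=> v0; have -> : Num.sqrt v ^+ d = v `^ (d%:R / 2).
  by rewrite -powR12_sqrt ?(ltW v0) // -powR_mulrn ?powR_ge0 // -powRrM mulrC.
by rewrite -powRD ?addNr ?powRr0 // (gt_eqF v0) implybT.
Qed.

Lemma theta_words a b f (u v : R) (l : seq (C * seq ('I_m * bool))) : 0 < v ->
  (forall q, q \in l -> size q.2 = d) -> f = \sum_(q <- l) q.1 *: hword R q.2 ->
  asum (theta_term d c0 c1 a b f (u +i* v)) /\
  theta d c0 c1 a b f (u +i* v) = \sum_(q <- l) q.1 *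
    \prod_j Th (wprof s t u v q.2 j) (a j 0) (a j 1) (b j 0) (b j 1).
Proof.
move=> v0 hl ->.
pose G w (n : 'M[int]_(m, 2)) : C :=
  \prod_j thterm (wprof s t u v w j) (a j 0) (a j 1) (b j 0) (b j 1) (n j 0, n j 1).
have hG w := csum_matrix (fun j =>
  asum_thterm (a j 0) (a j 1) (b j 0) (b j 1) (sch_rd (sch_wprof u w j v0))).
have E : theta_term d c0 c1 a b (\sum_(q <- l) q.1 *: hword R q.2) (u +i* v) =
  (fun n => (Num.sqrt v)%:C ^+ d * \sum_(q <- l) q.1 * G q.2 n).
  apply/funext => n; rewrite theta_term_sum mulr_sumr; apply: eq_big_seq => q ql.
  by rewrite (theta_term_word hs ht a b u n v0 (hl q ql)) mulrCA.
have [h1 h2] := csum_finsum l (fun q => asumZ q.1 (hG q.2).1).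
rewrite /theta E; split; first exact: asumZ.
rewrite csumZ // h2 mulrA [complex.Im _]/=.
rewrite -rmorphXn -rmorphM powR_half_sqrt // mul1r.
apply: eq_bigr => q _; rewrite csumZ; last exact: (hG q.2).1.
by rewrite (hG q.2).2.
Qed.

End Theta.

Theorem theorem5p5 (R : realType) (m d : nat) (hm : (0 < m)%N)
    (c0 c1 : 'M[R]_(m, 2))
    (hc0 : forall j : 'I_m, coneC (row j c0))
    (hc1 : forall j : 'I_m, coneC (row j c1))
    (f : mpoly (m * 2) R[i]) (hf : spherical d f)
    (a b : 'M[R]_(m, 2)) (tau : R[i]) (htau : 0 < complex.Im tau) :
  abs_convergent (theta_term d c0 c1 a b f tau) /\
  theta d c0 c1 a b f (- 1 / tau) =
    (- tau) ^+ (m + d) * eipi2 (Bm a b)%:C * theta d c0 c1 (- b) a f tau.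
Proof.
case: tau htau => u v /= v0.
have [l hl fl] := spherical_words hf.
have /choice [s hs] := fun j => cone_param (hc0 j).
have /choice [t ht] := fun j => cone_param (hc1 j).
split; first by apply: abs_convergentP; have [] := theta_words hs ht a b u v0 hl fl.
have r0 : 0 < u ^+ 2 + v ^+ 2 by rewrite ltr_wpDl ?sqr_ge0 // exprn_gt0.
set r := _ + _ in r0; pose u1 := - u / r; pose v1 := v / r.
have v10 : 0 < v1 by rewrite divr_gt0.
have t0 : (u +i* v : R[i]) != 0 by rewrite eq_complex /= negb_and (gt_eqF v0) orbT.
have rE : u1 ^+ 2 + v1 ^+ 2 = r^-1.
  have -> : u1 ^+ 2 + v1 ^+ 2 = (u ^+ 2 + v ^+ 2) / r ^+ 2.
    by rewrite /u1 /v1 !expr_div_n sqrrN -mulrDl.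
  by rewrite -/r expr2 invfM mulrA divff ?mul1r // gt_eqF.
have tE : - 1 / (u +i* v) = u1 +i* v1 :> R[i].
  apply: (mulIf t0); rewrite divfK //.
  have re : u1 * u - v1 * v = -1.
    by rewrite /u1 /v1 -[_ / r * u]mulrAC -[v / r * v]mulrAC -mulrBl mulNr -opprD -!expr2 mulNr
      divff // gt_eqF.
  have im : u1 * v + v1 * u = 0.
    by rewrite /u1 /v1 -[_ / r * v]mulrAC -[v / r * u]mulrAC -mulrDl mulNr [v * u]mulrC addNr mul0r.
  by apply/eqP; rewrite eq_complex /= re im oppr0 !eqxx.
have tI : (u1 +i* v1)^-1 = - (u +i* v) :> R[i] by rewrite -tE mulN1r invrN invrK.
have uE : - u1 / (u1 ^+ 2 + v1 ^+ 2) = u.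
  by rewrite rE invrK /u1 mulNr divfK ?opprK // gt_eqF.
have vE : v1 / (u1 ^+ 2 + v1 ^+ 2) = v by rewrite rE invrK /v1 divfK // gt_eqF.
rewrite tE (theta_words hs ht a b u1 v10 hl fl).2 (theta_words hs ht (- b) a u v0 hl fl).2.
rewrite mulr_sumr; apply: eq_big_seq => q ql; rewrite mulrCA; congr (_ * _).
have -> : eipi2 (Bm a b)%:C = \prod_j chi (a j 0) (a j 1) (b j 0) (b j 1).
  rewrite /Bm rmorph_sum eipi2_sum; apply: eq_bigr => j _.
  by rewrite /chi /B1 !mxE.
have -> : (- (u +i* v)) ^+ (m + d) = \prod_(j < m) (- (u +i* v)) ^+ (size (wrow q.2 j)).+1 :> R[i].
  rewrite prodrXr; congr (_ ^+ _).
  under eq_bigr do rewrite -addn1; rewrite big_split /= size_wrow (hl q ql).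
  by rewrite sum_nat_const card_ord muln1 addnC.
rewrite -!big_split; apply: eq_bigr => j _ /=; rewrite !mxE.
(* Applied at -1/tau, whose image under inversion is tau: the factor tau^-1 of [FT_raise] becomes
   -tau. *)
have h := FT_raise u1 v10 (s j) (t j) (wrow q.2 j).
rewrite /= uE vE tI in h; rewrite h ThZ; last exact: sch_rd (sch_wprof s t u q.2 j v0).
by rewrite mulrA [chi _ _ _ _ * _]mulrC.
Qed.
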